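(* Consider the fractional optimal control problem (P): find a control $u$ and a corresponding state trajectory $x$ such that $$J[x(\cdot),u(\cdot)]=\int_a^bL(t,x(t),u(t))\,dt\longrightarrow\max,$$ $${}^{A}_{C}D^{\alpha,\beta,\gamma}_{a,b}x(t)=f(t,x(t),u(t)),\quad t\in[a,b],\qquad x(a)=x_a,$$ $$x(\cdot)\in AC^{\alpha,\beta}([a,b],\mathbb{R}),\qquad u(\cdot)\in L^2([a,b],\mathbb{R}),$$ where $|\alpha+\beta|\ge1$, $\gamma\in[0,1]$, and $L$ and $f$ are continuously differentiable in all their three arguments. If $(x,u)\mapsto L(t,x,u)$ and $(x,u)\mapsto f(t,x,u)$ are concave and $(\tilde x,\tilde u,\lambda)$ is a Pontryagin extremal of (P) with $\lambda(t)\ge0$ for $t\in[a,b]$, then $$J[\tilde x,\tilde u]\ge J[x,u]$$ for any admissible pair $(x,u)$; that is, the pair $(\tilde x,\tilde u)$ is a solution to (P).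
   Context: Let $[a,b]$ be a real interval, $\alpha\in[0,1]$ real, $\beta\in\mathbb{C}$ with $\mathrm{Re}(\beta)\ge0$, $R>(b-a)^{\mathrm{Re}(\beta)}$, and $A(x)=\sum_{n\ge0}a_nx^n$ a complex function analytic on the disc $D(0,R)$. For an analytic kernel $B$, an order $\nu$ and $x\in L^1([a,b],\mathbb{R})$, $${}^{B}I^{\nu,\beta}_{a^+}x(t)=\int_a^t(t-s)^{\nu-1}B\left((t-s)^{\beta}\right)x(s)\,ds,\qquad {}^{B}I^{\nu,\beta}_{b^-}x(t)=\int_t^b(s-t)^{\nu-1}B\left((s-t)^{\beta}\right)x(s)\,ds.$$ Put $A_\Gamma(x)=\sum_{n\ge0}a_n\Gamma(\beta n+\alpha)x^n$. The function $\bar A(x)=\sum_{n\ge0}\bar a_nx^n$ is the analytic function with $A_\Gamma\cdot\bar A_\Gamma=1$, where $\bar A_\Gamma(x)=\sum_{n\ge0}\bar a_n\Gamma(\beta n+1-\alpha)x^n$ ($\bar A$ being the kernel used with order $1-\alpha$). $L^{\alpha,\beta}([a,b],\mathbb{R})$ is the set of $x\in L^1([a,b],\mathbb{R})$ such that ${}^{\bar A}I^{1-\alpha,\beta}_{a^+}x$ and ${}^{\bar A}I^{1-\alpha,\beta}_{b^-}x$ are absolutely continuous on $[a,b]$. $AC^{\alpha,\beta}([a,b],\mathbb{R})$ is the set of absolutely continuous functions $x$ that can be represented as $x(t)=x(a)+{}^{\bar A}I^{\alpha,\beta}_{a^+}\varphi(t)$ and $x(t)=x(b)+{}^{\bar A}I^{\alpha,\beta}_{b^-}\varphi(t)$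 for some $\varphi\in L^{\alpha,\beta}([a,b],\mathbb{R})$. Riemann--Liouville derivatives, for $x\in L^{\alpha,\beta}$: ${}^{A}_{RL}D^{\alpha,\beta}_{a^+}x(t)=\frac{d}{dt}\left({}^{\bar A}I^{1-\alpha,\beta}_{a^+}x(t)\right)$ and ${}^{A}_{RL}D^{\alpha,\beta}_{b^-}x(t)=-\frac{d}{dt}\left({}^{\bar A}I^{1-\alpha,\beta}_{b^-}x(t)\right)$. Caputo derivatives, for $x\in AC^{\alpha,\beta}$: ${}^{A}_{C}D^{\alpha,\beta}_{a^+}x(t)=\frac{d}{dt}\left[{}^{\bar A}I^{1-\alpha,\beta}_{a^+}(x(t)-x(a))\right]$ and ${}^{A}_{C}D^{\alpha,\beta}_{b^-}x(t)=-\frac{d}{dt}\left[{}^{\bar A}I^{1-\alpha,\beta}_{b^-}(x(t)-x(b))\right]$. Combined operators, for $\gamma\in[0,1]$: ${}^{A}_{C}D^{\alpha,\beta,\gamma}_{a,b}=\gamma\,{}^{A}_{C}D^{\alpha,\beta}_{a^+}+(1-\gamma)\,{}^{A}_{C}D^{\alpha,\beta}_{b^-}$ and ${}^{A}_{RL}D^{\alpha,\beta,\gamma}_{a,b}=\gamma\,{}^{A}_{RL}D^{\alpha,\beta}_{a^+}+(1-\gamma)\,{}^{A}_{RL}D^{\alpha,\beta}_{b^-}$. An admissible pair is a pair $(x,u)\in AC^{\alpha,\beta}([a,b],\mathbb{R})\times L^2([a,b],\mathbb{R})$ satisfying the control system and the initial condition of (P). With $H(t,x,u,\lambda)=L(t,x,u)+\lambda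 f(t,x,u)$, a Pontryagin extremal of (P) is a triple $(\tilde x,\tilde u,\lambda)$ with $(\tilde x,\tilde u)$ admissible and $\lambda\in L^{\alpha,\beta}([a,b],\mathbb{R})$ such that, on $[a,b]$: (i) $\tilde u$ maximizes $u\mapsto H(t,\tilde x(t),u,\lambda(t))$ (controls being unconstrained, this gives $\frac{\partial H}{\partial u}(t,\tilde x(t),\tilde u(t),\lambda(t))=0$); (ii) ${}^{A}_{RL}D^{\alpha,\beta,1-\gamma}_{a,b}\lambda(t)=\frac{\partial H}{\partial x}(t,\tilde x(t),\tilde u(t),\lambda(t))$; (iii) $(1-\gamma)\,{}^{\bar A}I^{1-\alpha,\beta}_{a^+}\lambda(b)+\gamma\,{}^{\bar A}I^{1-\alpha,\beta}_{b^-}\lambda(b)=0$. *)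

(* Defs.v *)
(* Complex-valued functions of a real variable are
   integrated, differentiated and tested for absolute continuity componentwise,
   i.e. [R[i]] is identified with the plane over [R]. *)
From HB Require Import structures.
From mathcomp Require Import all_boot all_order all_algebra.
From mathcomp Require Import complex.
From mathcomp Require Import all_classical all_reals all_analysis.

Set Implicit Arguments.
Unset Strict Implicit.
Unset Printing Implicit Defensive.

Import Order.TTheory GRing.Theory Num.Theory.
Import numFieldNormedType.Exports.

Local Open Scope classical_set_scope.
Local Open Scope ring_scope.
Local Open Scope complex_scope.

Definition cintegrable {R : realType} (D : set R) (g : R -> R[i]) : Prop :=
  (@lebesgue_measure R).-integrable D (fun s => (complex.Re (g s))%:E) /\
  (@lebesgue_measure R).-integrable D (fun s => (complex.Im (g s))%:E).

Definition cintegral {R : realType} (D : set R) (g : R -> R[i]) : R[i] :=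
  (\int[@lebesgue_measure R]_(s in D) complex.Re (g s)) +i*
  (\int[@lebesgue_measure R]_(s in D) complex.Im (g s)).

Definition cderive {R : realType} (g : R -> R[i]) (t : R) : R[i] :=
  derive1 (fun s => complex.Re (g s)) t +i* derive1 (fun s => complex.Im (g s)) t.

Definition abs_continuous {R : realType} (a b : R) (g : R -> R) : Prop :=
  forall e : R, 0 < e -> exists2 d : R, 0 < d &
    forall (n : nat) (u v : 'I_n -> R),
      (forall i, a <= u i /\ u i <= v i /\ v i <= b) ->
      (forall i j, i != j -> v i <= u j \/ v j <= u i) ->
      \sum_i (v i - u i) < d ->
      \sum_i `|g (v i) - g (u i)| < e.

Definition cabs_continuous {R : realType} (a b : R) (g : R -> R[i]) : Prop :=
  abs_continuous a b (fun t => complex.Re (g t)) /\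
  abs_continuous a b (fun t => complex.Im (g t)).

(* [r ^ z = exp (z ln r)] for [0 < r]; the value at [r = 0] only matters on
   null sets below. *)
Definition cpow {R : realType} (r : R) (z : R[i]) : R[i] :=
  (r `^ complex.Re z)%:C *
  (cos (complex.Im z * ln r) +i* sin (complex.Im z * ln r)).

(* Euler's integral, i.e. the Gamma function on [0 < Re z].  The arguments
   [beta * n + alpha] and [beta * n + 1 - alpha] below lie in that half-plane,
   except when [alpha] is 0 or 1; then the argument for [n = 0] is the pole 0
   of Gamma, where the divergent integral is 0 by convention. *)
Definition cgamma {R : realType} (z : R[i]) : R[i] :=
  cintegral `]0, +oo[ (fun s => cpow s (z - 1) * (expR (- s))%:C).

Definition analytic_on_disc {R : realType} (r : R) (c : nat -> R[i])
    (B : R[i] -> R[i]) : Prop :=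
  forall z : R[i], `|z| < r%:C ->
    (fun n => (\sum_(0 <= k < n) c k * z ^+ k : R[i]^o)) @ \oo
      --> (B z : R[i]^o).

(* Coefficients of the transformed series
   [A_Gamma x = \sum_n a_n Gamma (beta n + nu) x^n]. *)
Definition gamma_coef {R : realType} (nu : R) (beta : R[i]) (c : nat -> R[i])
    (n : nat) : R[i] :=
  c n * cgamma (beta * n%:R + nu%:C).

(* [A_Gamma * Abar_Gamma = 1], as an identity of power series (Cauchy
   product): the two Gamma-transformed series may have radius of convergence
   0 even though [A] and [Abar] are analytic. *)
Definition gamma_inverse {R : realType} (alpha : R) (beta : R[i])
    (c cbar : nat -> R[i]) : Prop :=
  forall n : nat,
    \sum_(k < n.+1) gamma_coef alpha beta c k *
                    gamma_coef (1 - alpha) beta cbar (n - k) = (n == 0)%:R.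

Definition kernelD {R : realType} (B : R[i] -> R[i]) (nu : R) (beta : R[i])
    (r : R) : R[i] :=
  (r `^ (nu - 1))%:C * B (cpow r beta).

Definition fint_left {R : realType} (B : R[i] -> R[i]) (nu : R) (beta : R[i])
    (a : R) (x : R -> R) (t : R) : R[i] :=
  cintegral `[a, t] (fun s => kernelD B nu beta (t - s) * (x s)%:C).

Definition fint_right {R : realType} (B : R[i] -> R[i]) (nu : R) (beta : R[i])
    (b : R) (x : R -> R) (t : R) : R[i] :=
  cintegral `[t, b] (fun s => kernelD B nu beta (s - t) * (x s)%:C).

(* The integrals above are total functions with default values; these two
   predicates say that they converge for every [t] in [[a, b]]. *)
Definition fint_left_defined {R : realType} (B : R[i] -> R[i]) (nu : R)
    (beta : R[i]) (a b : R) (x : R -> R) : Prop :=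
  forall t, t \in `[a, b] ->
    cintegrable `[a, t] (fun s => kernelD B nu beta (t - s) * (x s)%:C).

Definition fint_right_defined {R : realType} (B : R[i] -> R[i]) (nu : R)
    (beta : R[i]) (a b : R) (x : R -> R) : Prop :=
  forall t, t \in `[a, b] ->
    cintegrable `[t, b] (fun s => kernelD B nu beta (s - t) * (x s)%:C).

Definition L1 {R : realType} (a b : R) (x : R -> R) : Prop :=
  (@lebesgue_measure R).-integrable `[a, b] (fun t => (x t)%:E).

Definition L2 {R : realType} (a b : R) (u : R -> R) : Prop :=
  measurable_fun `[a, b] u /\
  (@lebesgue_measure R).-integrable `[a, b] (fun t => (u t ^+ 2)%:E).

(* In all that follows [Abar] is the kernel inverse to [A]. *)
Definition Lab {R : realType} (Abar : R[i] -> R[i]) (alpha : R) (beta : R[i])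
    (a b : R) (x : R -> R) : Prop :=
  [/\ L1 a b x,
      fint_left_defined Abar (1 - alpha) beta a b x,
      fint_right_defined Abar (1 - alpha) beta a b x,
      cabs_continuous a b (fint_left Abar (1 - alpha) beta a x) &
      cabs_continuous a b (fint_right Abar (1 - alpha) beta b x)].

Definition ACab {R : realType} (Abar : R[i] -> R[i]) (alpha : R) (beta : R[i])
    (a b : R) (x : R -> R) : Prop :=
  abs_continuous a b x /\
  exists phi : R -> R,
    [/\ Lab Abar alpha beta a b phi,
        fint_left_defined Abar alpha beta a b phi,
        fint_right_defined Abar alpha beta a b phi,
        forall t, t \in `[a, b] ->
          (x t)%:C = (x a)%:C + fint_left Abar alpha beta a phi t &
        forall t, t \in `[a, b] ->
          (x t)%:C = (x b)%:C + fint_right Abar alpha beta b phi t].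

Definition RL_left {R : realType} (Abar : R[i] -> R[i]) (alpha : R)
    (beta : R[i]) (a : R) (x : R -> R) (t : R) : R[i] :=
  cderive (fint_left Abar (1 - alpha) beta a x) t.

Definition RL_right {R : realType} (Abar : R[i] -> R[i]) (alpha : R)
    (beta : R[i]) (b : R) (x : R -> R) (t : R) : R[i] :=
  - cderive (fint_right Abar (1 - alpha) beta b x) t.

Definition C_left {R : realType} (Abar : R[i] -> R[i]) (alpha : R)
    (beta : R[i]) (a : R) (x : R -> R) (t : R) : R[i] :=
  cderive (fint_left Abar (1 - alpha) beta a (fun s => x s - x a)) t.

Definition C_right {R : realType} (Abar : R[i] -> R[i]) (alpha : R)
    (beta : R[i]) (b : R) (x : R -> R) (t : R) : R[i] :=
  - cderive (fint_right Abar (1 - alpha) beta b (fun s => x s - x b)) t.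

Definition RL_combined {R : realType} (Abar : R[i] -> R[i]) (alpha : R)
    (beta : R[i]) (g a b : R) (x : R -> R) (t : R) : R[i] :=
  g%:C * RL_left Abar alpha beta a x t +
  (1 - g)%:C * RL_right Abar alpha beta b x t.

Definition C_combined {R : realType} (Abar : R[i] -> R[i]) (alpha : R)
    (beta : R[i]) (g a b : R) (x : R -> R) (t : R) : R[i] :=
  g%:C * C_left Abar alpha beta a x t +
  (1 - g)%:C * C_right Abar alpha beta b x t.

Definition continuous_strip {R : realType} (a b : R) (F : R -> R -> R -> R) :
    Prop :=
  {within [set p : R * R * R | p.1.1 \in `[a, b]],
    continuous (fun p : R * R * R => F p.1.1 p.1.2 p.2)}.

(* Continuous differentiability on the strip [[a, b] x R x R]; the derivative
   in [t] is one-sided at [a] and [b]. *)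
Definition C1_strip {R : realType} (a b : R) (F : R -> R -> R -> R) : Prop :=
  continuous_strip a b F /\
  exists Ft Fx Fu : R -> R -> R -> R,
    [/\ continuous_strip a b Ft, continuous_strip a b Fx,
        continuous_strip a b Fu &
        forall t x u, t \in `[a, b] ->
          [/\ (fun s => (F s x u - F t x u) / (s - t))
                @ within `[a, b] (t^') --> Ft t x u,
              is_derive x 1 (fun y => F t y u) (Fx t x u) &
              is_derive u 1 (fun w => F t x w) (Fu t x u)]].

Definition concave2 {R : realType} (F : R -> R -> R) : Prop :=
  forall (x y u v s : R), 0 <= s <= 1 ->
    s * F x u + (1 - s) * F y v <=
    F (s * x + (1 - s) * y) (s * u + (1 - s) * v).

(* Extended-real valued, since [L t (x t) (u t)] need not be integrable for
   [u] in L^2; for [L] concave and continuous its positive part is, so that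
   the integral is well defined in [[-oo, +oo[]. *)
Definition objective {R : realType} (a b : R) (L : R -> R -> R -> R)
    (x u : R -> R) : \bar R :=
  (\int[@lebesgue_measure R]_(t in `[a, b]) (L t (x t) (u t))%:E)%E.

(* Equations between (classes of) integrable functions hold almost
   everywhere. *)
Definition admissible {R : realType} (Abar : R[i] -> R[i]) (alpha : R)
    (beta : R[i]) (g a b xa : R) (f : R -> R -> R -> R) (x u : R -> R) : Prop :=
  [/\ ACab Abar alpha beta a b x,
      L2 a b u,
      {ae @lebesgue_measure R, forall t, t \in `[a, b] ->
        C_combined Abar alpha beta g a b x t = (f t (x t) (u t))%:C} &
      x a = xa].

Definition solution {R : realType} (Abar : R[i] -> R[i]) (alpha : R)
    (beta : R[i]) (g a b xa : R) (L f : R -> R -> R -> R) (x u : R -> R) : Prop :=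
  admissible Abar alpha beta g a b xa f x u /\
  forall y v, admissible Abar alpha beta g a b xa f y v ->
    (objective a b L y v <= objective a b L x u)%E.

Definition hamiltonian {R : realType} (L f : R -> R -> R -> R)
    (t x u lam : R) : R :=
  L t x u + lam * f t x u.

Definition pontryagin_extremal {R : realType} (Abar : R[i] -> R[i]) (alpha : R)
    (beta : R[i]) (g a b xa : R) (L f : R -> R -> R -> R)
    (x u lam : R -> R) : Prop :=
  [/\ admissible Abar alpha beta g a b xa f x u,
      Lab Abar alpha beta a b lam,
      {ae @lebesgue_measure R, forall t, t \in `[a, b] -> forall w,
        hamiltonian L f t (x t) w (lam t) <=
        hamiltonian L f t (x t) (u t) (lam t)},
      {ae @lebesgue_measure R, forall t, t \in `[a, b] ->
        RL_combined Abar alpha beta (1 - g) a b lam t =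
        (derive1 (fun y => hamiltonian L f t y (u t) (lam t)) (x t))%:C} &
      (1 - g)%:C * fint_left Abar (1 - alpha) beta a lam b +
      g%:C * fint_right Abar (1 - alpha) beta b lam b = 0].

(* Main.v *)
(* Write P and Q for the kernels r^(alpha-1) A(r^beta) and
   r^(-alpha) Abar(r^beta) cut off outside ]0, b-a], and * for convolution on
   the line.  The beta integral turns the relation A_Gamma . Abar_Gamma = 1
   into the Sonine identity P * Q = 1 on ]0, b-a].  Hence, if Q * lam is
   absolutely continuous with density G, then lam = P * G almost everywhere
   (Abel inversion), and since r^(-alpha) * r^(alpha-1) is constant, the
   function |Q| * |lam| is bounded.  This bound is what justifies exchanging
   the integrals in the fractional integration by parts: with H the Heaviside
   function and Y the density of x, both sides of the formula are values of
   (Q * lam) * Y = (H * G) * Y at a + b.  By transversality the boundary terms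
   cancel, so the adjoint equation integrates to
     int RL(lam) (x - xt) = int lam (f(x,u) - f(xt,ut)),
   where RL is the combined Riemann-Liouville operator.
   Concavity of the Hamiltonian and maximality of ut give pointwise
   L(x,u) <= L(xt,ut) + RL(lam) (x - xt) - lam (f(x,u) - f(xt,ut)),
   and it remains to integrate.  The orders alpha = 0 and alpha = 1 are excluded
   by the convention Gamma(0) = 0. *)

Require Import Defs.
From HB Require Import structures.
From mathcomp Require Import all_boot all_order all_algebra.
From mathcomp Require Import complex.
From mathcomp Require Import all_classical all_reals all_analysis.
From mathcomp Require Import finmap measurable_realfun.
From mathcomp Require Import ring lra.

Set Implicit Arguments.
Unset Strict Implicit.
Unset Printing Implicit Defensive.

Import Order.TTheory GRing.Theory Num.Theory.
Import numFieldNormedType.Exports.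

Local Open Scope classical_set_scope.
Local Open Scope ring_scope.

(** * Integrals, affine maps and convolution *)

(** The kernels are complex while the state and the multiplier are real. With P = P1 + i P2 and Q =
    Q1 + i Q2, the inversion uses the real part P1 * Q1 - P2 * Q2 = 1 of the Sonine identity, so it
    needs densities of both components of Q * lam, although the integration by parts itself only
    concerns real parts. The coefficient of order N in the product of the two Gamma-transformed
    series is Gamma(beta N + 1) times the coefficient of r^(beta N) in P * Q. Reading off the Sonine
    identity therefore requires that Gamma has no zero in the right half-plane; this is derived from
    the beta relation and Gamma(1) = 1. The multiplier and the density of the state are merely
    integrable, and convolution identities are needed at prescribed points such as a + b, not just
    almost everywhere. Absolute convergence is therefore tracked point by point, through the
    nonnegative convolution [econv]. Right-sided operators are reduced to left-sided ones by t -> a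
    + b - t. Objectives may be infinite, so the last comparison is not a subtraction of
    integrals. *)

Section affine_change.
Context {R : realType}.
Notation mu := (@lebesgue_measure R).
Local Open Scope ereal_scope.

Lemma measurable_affine (c d : R) :
  measurable_fun setT (fun s : R => (c * s + d)%R).
Proof.
by apply: measurable_funD => //; apply: measurable_funM.
Qed.

(** By uniqueness of the Lebesgue measure it is enough to compare both sides on intervals []a, b]].
    For c < 0 the preimage is closed on the left instead of the right, which does not affect its
    measure. *)
Lemma lebesgue_measure_affine (c d : R) (A : set R) : c != 0%R -> measurable A ->
  `|c|%:E * pushforward mu (fun s : R => (c * s + d)%R : measurableTypeR R) A = mu A.
Proof.
move=> c0 mA.
have mphi : measurable_fun [set: measurableTypeR R]
    (fun s : R => (c * s + d)%R : measurableTypeR R) by exact: measurable_affine.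
pose phi : {mfun measurableTypeR R >-> measurableTypeR R} :=
  HB.pack (fun s : R => (c * s + d)%R : measurableTypeR R)
  (isMeasurableFun.Build _ _ _ _ _ mphi).
pose nc : {nonneg R} := NngNum (normr_ge0 c).
apply/esym.
apply: (@lebesgue_measure_unique R (mscale nc (pushforward mu phi))) => //= _ [[a b]] _ <-.
rewrite /mscale/= /pushforward/=.
have [cp|cn] : (0 < c \/ c < 0)%R by case: (ltgtP c 0%R) c0 => //; [right|left].
- rewrite gtr0_norm//.
  have -> : (fun s : R => (c * s + d)%R) @^-1` `]a, b] = `]((a - d) / c)%R, ((b - d) / c)%R]%classic.
    by apply/seteqP; split => x/=; rewrite !in_itv/= ltr_pdivrMr// ler_pdivlMr//
      ltrBlDr lerBrDr (mulrC x).
  rewrite !lebesgue_measure_itv/= !lte_fin ltr_pM2r ?invr_gt0// ltrD2r.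
  case: ifPn => _; last by rewrite mule0.
  rewrite -!EFinB -EFinM; congr EFin.
  by field.
- rewrite ltr0_norm//.
  have -> : (fun s : R => (c * s + d)%R) @^-1` `]a, b] = `[((b - d) / c)%R, ((a - d) / c)%R[%classic.
    by apply/seteqP; split => x/=; rewrite !in_itv/= ler_ndivrMr// ltr_ndivlMr//
      ltrBlDr lerBrDr (mulrC x) andbC.
  rewrite !lebesgue_measure_itv/= !lte_fin ltr_nM2r ?invr_lt0// ltrD2r.
  case: ifPn => _; last by rewrite mule0.
  rewrite -!EFinB -EFinM; congr EFin.
  by field.
Qed.

Lemma ge0_integral_affine (c d : R) (f : R -> \bar R) : c != 0%R ->
  measurable_fun setT f -> (forall x, 0 <= f x) ->
  \int[mu]_x f x = `|c|%:E * \int[mu]_x f (c * x + d)%R.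
Proof.
move=> c0 mf f0.
have mphi : measurable_fun [set: measurableTypeR R]
    (fun s : R => (c * s + d)%R : measurableTypeR R) by exact: measurable_affine.
pose phi : {mfun measurableTypeR R >-> measurableTypeR R} :=
  HB.pack (fun s : R => (c * s + d)%R : measurableTypeR R)
  (isMeasurableFun.Build _ _ _ _ _ mphi).
pose nc : {nonneg R} := NngNum (normr_ge0 c).
have -> : \int[mu]_x f (c * x + d)%R = \int[mu]_(x in phi @^-1` setT) (f \o phi) x.
  by rewrite preimage_setT.
rewrite -ge0_integral_pushforward//=.
rewrite -[ `|c|%:E ]/(nc%:num%:E) -ge0_integral_mscale//=.
apply: eq_measure_integral => //= A mA _.
by rewrite /mscale/= -[LHS](lebesgue_measure_affine d c0).
Qed.

Lemma integrable_affine (c d : R) (f : R -> R) : c != 0%R ->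
  mu.-integrable setT (EFin \o f) ->
  mu.-integrable setT (fun x => (f (c * x + d)%R)%:E).
Proof.
move=> c0 /integrableP[mf fi]; apply/integrableP; split.
  have mf' : measurable_fun [set: R] (EFin \o f) := mf.
  exact: (measurableT_comp mf' (measurable_affine c d)).
have cp : (0 < `|c|)%R by rewrite normr_gt0.
move: fi; rewrite (@ge0_integral_affine c d)//; last exact: measurableT_comp.
have : 0 <= \int[mu]_x `|(f (c * x + d)%R)%:E| by exact: integral_ge0.
rewrite -[\int[mu]_x `|(EFin \o f) (c * x + d)%R|]/(\int[mu]_x `|(f (c * x + d)%R)%:E|).
case: (\int[mu]_x `|(f (c * x + d)%R)%:E|) => [r _ _|_|//]; first by rewrite ltry.
by rewrite muleC gt0_mulye// lte_fin.
Qed.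

Lemma Rintegral_affine (c d : R) (f : R -> R) : c != 0%R ->
  measurable_fun setT f ->
  (\int[mu]_x f x = `|c| * \int[mu]_x f (c * x + d))%R.
Proof.
move=> c0 mf.
have cp : (0 < `|c|)%R by rewrite normr_gt0.
have mEf : measurable_fun [set: R] (EFin \o f) by exact/measurable_EFinP.
rewrite /Rintegral [in LHS]integralE [in RHS]integralE/=.
rewrite (@ge0_integral_affine c d (EFin \o f)^\+)//; last exact: measurable_funepos.
rewrite (@ge0_integral_affine c d (EFin \o f)^\-)//; last exact: measurable_funeneg.
set I := (X in _ * X - _); set J := (X in _ - _ * X).
have EI : \int[mu]_x (fun x0 => (f (c * x0 + d)%R)%:E)^\+ x = I.
  by apply: eq_integral => x _; rewrite !funeposE.
have EJ : \int[mu]_x (fun x0 => (f (c * x0 + d)%R)%:E)^\- x = J.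
  by apply: eq_integral => x _; rewrite !funenegE.
rewrite EI EJ.
have I0 : 0 <= I by apply: integral_ge0 => x _; exact: funepos_ge0.
have J0 : 0 <= J by apply: integral_ge0 => x _; exact: funeneg_ge0.
(* No integrability is assumed: as soon as the positive or the negative part has infinite integral,
   [fine] sends both sides to 0. *)
clear EI EJ; move: I J I0 J0 => [x| |] [y| |]//= _ _.
- by rewrite -mulrBr.
- by rewrite gt0_muley ?lte_fin//= mulr0.
- by rewrite gt0_muley ?lte_fin//= mulr0.
- by rewrite gt0_muley ?lte_fin//= mulr0.
Qed.

End affine_change.

Section convolution.
Context {R : realType}.
Notation mu := (@lebesgue_measure R).
Implicit Types f g h : R -> R.

Lemma measurable_shift (t : R) : measurable_fun setT (fun s : R => t - s).
Proof.
have -> : (fun s : R => t - s) = (fun s => -1 * s + t).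
  by apply/funext => s; rewrite mulN1r addrC.
exact: measurable_affine.
Qed.

Lemma measurable_Rintegral1 (H : R * R -> R) : measurable_fun setT H ->
  measurable_fun setT (fun x => \int[mu]_y H (x, y)).
Proof.
move=> mH.
pose F (z : measurableTypeR R * measurableTypeR R) : \bar R := (H z)%:E.
have mF : measurable_fun setT F by exact/measurable_EFinP.
have mfine : measurable_fun [set: \bar R] fine by [].
apply: (measurableT_comp mfine).
under eq_fun do rewrite integralE.
apply: emeasurable_funB.
  have := @measurable_fun_fubini_tonelli_F _ _ _ _ R mu F^\+%E
    (measurable_funepos mF) (fun=> funepos_ge0 _ _).
  rewrite /fubini_F; apply: eq_measurable_fun => x _.
  by apply: eq_integral => y _; rewrite !funeposE.
have := @measurable_fun_fubini_tonelli_F _ _ _ _ R mu F^\-%E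
  (measurable_funeneg mF) (fun=> funeneg_ge0 _ _).
rewrite /fubini_F; apply: eq_measurable_fun => x _.
by apply: eq_integral => y _; rewrite !funenegE.
Qed.

Lemma measurable_Rintegral2 (H : R * R -> R) : measurable_fun setT H ->
  measurable_fun setT (fun y => \int[mu]_x H (x, y)).
Proof.
move=> mH.
apply: (@measurable_Rintegral1 (fun z => H (z.2, z.1))).
exact: (measurableT_comp mH (measurable_fun_pair measurable_snd measurable_fst)).
Qed.

(** Only the product a k has to be integrable: for a = 0 both sides are 0 whatever k is, otherwise k
    is a^-1 times an integrable function. Fubini gives exactly this information on the inner
    integrals. *)
Lemma Rintegral_scaled_ae (a : R) (k : R -> R) :
  mu.-integrable setT (fun y => (a * k y)%:E) ->
  (a * \int[mu]_y k y)%:E = (\int[mu]_y (a * k y)%:E)%E.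
Proof.
move=> ik.
have [->|a0] := eqVneq a 0.
  rewrite mul0r; apply/esym; under eq_integral do rewrite mul0r.
  exact: integral0.
have ik' : mu.-integrable setT (fun y => (k y)%:E).
  have := integrableZl measurableT a^-1 ik.
  by apply: eq_integrable => // y _; rewrite -EFinM mulKf.
under [RHS]eq_integral do rewrite EFinM.
rewrite integralZl// EFinM; congr (_ * _)%E.
by rewrite /Rintegral fineK//; exact: integrable_fin_num.
Qed.

Lemma fubini_kernel f g (K : R * R -> R) :
  measurable_fun setT f -> measurable_fun setT g -> measurable_fun setT K ->
  (\int[mu]_x \int[mu]_y (`|f x * (K (x, y) * g y)|)%:E < +oo)%E ->
  \int[mu]_x (f x * \int[mu]_y (K (x, y) * g y)) =
  \int[mu]_y (g y * \int[mu]_x (K (x, y) * f x)).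
Proof.
move=> mf mg mK Foo.
pose F (z : measurableTypeR R * measurableTypeR R) : \bar R :=
  (f z.1 * (K z * g z.2))%:E.
have mF : measurable_fun setT F.
  apply/measurable_EFinP; apply: measurable_funM.
    exact: (measurableT_comp mf measurable_fst).
  by apply: measurable_funM => //; exact: (measurableT_comp mg measurable_snd).
have iF : (mu \x mu)%E.-integrable setT F.
  by apply/integrable12ltyP.
(* For exceptional x or y the inner real integral may be a default value, so it agrees with the
   inner integral of Fubini's theorem only almost everywhere. *)
have a1 := ae_integrable1 iF.
have a2 := ae_integrable2 iF.
have E1 : (\int[mu]_x (f x * \int[mu]_y (K (x, y) * g y))%:E =
   \int[mu]_x \int[mu]_y F (x, y))%E.
  apply: ae_eq_integral => //.
  - apply/measurable_EFinP; apply: measurable_funM => //.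
    apply: (@measurable_Rintegral1 (fun z => K z * g z.2)).
    by apply: measurable_funM => //; exact: (measurableT_comp mg measurable_snd).
  - exact: (measurable_fubini_F iF).
  - apply: filterS a1 => x /= iFx _.
    exact: Rintegral_scaled_ae.
have E2 : (\int[mu]_y (g y * \int[mu]_x (K (x, y) * f x))%:E =
   \int[mu]_y \int[mu]_x F (x, y))%E.
  apply: ae_eq_integral => //.
  - apply/measurable_EFinP; apply: measurable_funM => //.
    apply: (@measurable_Rintegral2 (fun z => K z * f z.1)).
    by apply: measurable_funM => //; exact: (measurableT_comp mf measurable_fst).
  - exact: (measurable_fubini_G iF).
  - apply: filterS a2 => y /= iFy _.
    have E x : F (x, y) = (g y * (K (x, y) * f x))%:E.
      by rewrite /F/= mulrC -!mulrA mulrCA; congr EFin; ring.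
    rewrite Rintegral_scaled_ae//.
      by apply: eq_integral => x _; rewrite E.
    by apply: eq_integrable iFy => // x _; rewrite E.
by rewrite /Rintegral E1 E2 (Fubini iF).
Qed.

Definition conv f g (t : R) : R := \int[mu]_s (f (t - s) * g s).

Lemma measurable_sub2 f : measurable_fun setT f ->
  measurable_fun setT (fun z : R * R => f (z.1 - z.2)).
Proof.
move=> mf; apply: (measurableT_comp mf).
by apply: measurable_funB; [exact: measurable_fst|exact: measurable_snd].
Qed.

Lemma measurable_conv f g : measurable_fun setT f -> measurable_fun setT g ->
  measurable_fun setT (conv f g).
Proof.
move=> mf mg; apply: (@measurable_Rintegral1 (fun z => f (z.1 - z.2) * g z.2)).
apply: measurable_funM; first exact: measurable_sub2.
exact: (measurableT_comp mg measurable_snd).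
Qed.

Lemma convC f g : measurable_fun setT f -> measurable_fun setT g ->
  conv f g = conv g f.
Proof.
move=> mf mg; apply/funext => t; rewrite /conv.
rewrite (@Rintegral_affine R (-1) t) ?oppr_eq0 ?oner_eq0//; last first.
  apply: measurable_funM => //.
  exact: (measurableT_comp mf (measurable_shift t)).
rewrite normrN1 mul1r; apply: eq_Rintegral => s _.
by rewrite mulN1r opprD opprK addrCA subrr addr0 mulrC addrC.
Qed.

(** Used for nonnegative functions, where Tonelli gives commutativity and associativity at every
    point without integrability. Its finiteness at t on absolute values is the condition under which
    [conv] can be rearranged at t. *)
Definition econv (f g : R -> \bar R) (t : R) : \bar R :=
  (\int[mu]_s (f (t - s)%R * g s))%E.

Implicit Types u v w : R -> \bar R.

Lemma emeasurable_sub2 u : measurable_fun setT u ->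
  measurable_fun setT (fun z : R * R => u (z.1 - z.2)).
Proof.
move=> mu_; apply: (measurableT_comp mu_).
by apply: measurable_funB; [exact: measurable_fst|exact: measurable_snd].
Qed.

Lemma emeasurable_econv2 u v : measurable_fun setT u -> measurable_fun setT v ->
  measurable_fun setT (fun z : R * R => (u (z.1 - z.2)%R * v z.2)%E).
Proof.
move=> mu_ mv; apply: emeasurable_funM; first exact: emeasurable_sub2.
exact: (measurableT_comp mv measurable_snd).
Qed.

Lemma econv_ge0 u v t : (forall x, 0 <= u x)%E -> (forall x, 0 <= v x)%E ->
  (0 <= econv u v t)%E.
Proof. by move=> u0 v0; apply: integral_ge0 => s _; rewrite mule_ge0. Qed.

Lemma measurable_econv u v : measurable_fun setT u -> measurable_fun setT v ->
  (forall x, 0 <= u x)%E -> (forall x, 0 <= v x)%E ->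
  measurable_fun setT (econv u v).
Proof.
move=> mu_ mv u0 v0.
apply: (@measurable_fun_fubini_tonelli_F _ _ _ _ R mu
  (fun z : measurableTypeR R * measurableTypeR R => (u (z.1 - z.2)%R * v z.2)%E)).
  exact: emeasurable_econv2.
by move=> z; rewrite mule_ge0.
Qed.

Lemma econvC u v : measurable_fun setT u -> measurable_fun setT v ->
  (forall x, 0 <= u x)%E -> (forall x, 0 <= v x)%E -> econv u v = econv v u.
Proof.
move=> mu_ mv u0 v0; apply/funext => t; rewrite /econv.
rewrite (@ge0_integral_affine R (-1) t) ?oppr_eq0 ?oner_eq0//; last 2 first.
- apply: emeasurable_funM => //.
  exact: (measurableT_comp mu_ (measurable_shift t)).
- by move=> s; rewrite mule_ge0.
rewrite normrN1 mul1e; apply: eq_integral => s _.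
by rewrite mulN1r opprD opprK addrCA subrr addr0 muleC addrC.
Qed.

Lemma emeasurable_translate u (s : R) : measurable_fun setT u ->
  measurable_fun setT (fun x : R => u (x - s)).
Proof.
move=> mu_; have -> : (fun x : R => u (x - s)) = (fun x : R => u (1 * x + (- s))).
  by apply/funext => x; rewrite mul1r.
exact: (measurableT_comp mu_ (measurable_affine _ _)).
Qed.

Lemma emeasurable_reflect u (t : R) : measurable_fun setT u ->
  measurable_fun setT (fun x : R => u (t - x)).
Proof. by move=> mu_; exact: (measurableT_comp mu_ (measurable_shift t)). Qed.

Lemma ge0_integral_translate u (s : R) : measurable_fun setT u ->
  (forall x, 0 <= u x)%E -> (\int[mu]_x u (x - s)%R = \int[mu]_x u x)%E.
Proof.
move=> mu_ u0; rewrite (@ge0_integral_affine R 1 (- s) u)// ?oner_eq0//.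
by rewrite normr1 mul1e; apply: eq_integral => x _; rewrite mul1r.
Qed.

Lemma integral_econv u v : measurable_fun setT u -> measurable_fun setT v ->
  (forall x, 0 <= u x)%E -> (forall x, 0 <= v x)%E ->
  (\int[mu]_t econv u v t = \int[mu]_t u t * \int[mu]_t v t)%E.
Proof.
move=> mu_ mv u0 v0.
have := @fubini_tonelli _ _ _ _ R mu mu
  (fun z : measurableTypeR R * measurableTypeR R => (u (z.1 - z.2)%R * v z.2)%E)
  (emeasurable_econv2 mu_ mv) (fun z => mule_ge0 (u0 _) (v0 _)).
rewrite /= => ->.
have U0 : (0 <= \int[mu]_t u t)%E by exact: integral_ge0.
rewrite -ge0_integralZl//; apply: eq_integral => s _.
under eq_integral do rewrite muleC.
rewrite ge0_integralZl//; last exact: emeasurable_translate.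
by rewrite ge0_integral_translate// muleC.
Qed.

Lemma econvA u v w :
  measurable_fun setT u -> measurable_fun setT v -> measurable_fun setT w ->
  (forall x, 0 <= u x)%E -> (forall x, 0 <= v x)%E -> (forall x, 0 <= w x)%E ->
  econv u (econv v w) = econv (econv u v) w.
Proof.
move=> mu_ mv mw u0 v0 w0; apply/funext => t; rewrite /econv.
pose F (z : measurableTypeR R * measurableTypeR R) : \bar R :=
  (u (t - z.1)%R * (v (z.1 - z.2)%R * w z.2))%E.
have mF : measurable_fun setT F.
  apply: emeasurable_funM; last exact: emeasurable_econv2.
  apply: (measurableT_comp mu_).
  exact: (measurableT_comp (measurable_shift t) measurable_fst).
have F0 z : (0 <= F z)%E by rewrite /F !mule_ge0.
transitivity (\int[mu]_x \int[mu]_y F (x, y))%E.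
  apply: eq_integral => x _; rewrite -ge0_integralZl//.
  - apply: emeasurable_funM => //; exact: emeasurable_reflect.
  - by move=> y _; rewrite mule_ge0.
rewrite (fubini_tonelli F)//; apply: eq_integral => r _.
rewrite /F/=.
transitivity (w r * \int[mu]_x (u (t - x)%R * v (x - r)%R))%E.
  rewrite -ge0_integralZl//.
  - by apply: eq_integral => x _; rewrite muleA muleC.
  - apply: emeasurable_funM; [exact: emeasurable_reflect|exact: emeasurable_translate].
  - by move=> x _; rewrite mule_ge0.
rewrite muleC; congr (_ * _)%E.
rewrite -(@ge0_integral_translate (fun s => u (t - r - s)%R * v s)%E r)//.
- by apply: eq_integral => x _; rewrite opprB addrA subrK.
- apply: emeasurable_funM => //; exact: emeasurable_reflect.
- by move=> x; rewrite mule_ge0.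
Qed.

Definition nabs f (x : R) : \bar R := (`|f x|)%:E.

Lemma measurable_nabs f : measurable_fun setT f -> measurable_fun setT (nabs f).
Proof. by move=> mf; apply/measurable_EFinP; exact: measurableT_comp. Qed.

Lemma nabs_ge0 f x : (0 <= nabs f x)%E. Proof. by rewrite lee_fin. Qed.

Lemma conv_integrable_at f g t : measurable_fun setT f -> measurable_fun setT g ->
  (econv (nabs f) (nabs g) t < +oo)%E ->
  mu.-integrable setT (fun s => (f (t - s) * g s)%:E).
Proof.
move=> mf mg fg; apply/integrableP; split.
  apply/measurable_EFinP; apply: measurable_funM => //.
  exact: (measurableT_comp mf (measurable_shift t)).
apply: le_lt_trans fg; rewrite le_eqVlt; apply/orP; left; apply/eqP.
by apply: eq_integral => s _; rewrite /nabs -EFinM -normrM.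
Qed.

Lemma abs_conv_le f g t : measurable_fun setT f -> measurable_fun setT g ->
  (`|(conv f g t)%:E| <= econv (nabs f) (nabs g) t)%E.
Proof.
move=> mf mg.
have [fg|] := ltP (econv (nabs f) (nabs g) t) +oo%E; last first.
  by rewrite leye_eq => /eqP ->; rewrite leey.
have ifg := conv_integrable_at mf mg fg.
have /= -> := @EFin_normr_Rintegral _ _ _ mu setT (fun s => f (t - s) * g s) measurableT ifg.
apply: (le_trans (le_abse_integral _ _ _)) => //.
  exact: measurable_int ifg.
rewrite le_eqVlt; apply/orP; left; apply/eqP.
by apply: eq_integral => s _; rewrite /nabs -EFinM -normrM.
Qed.

Lemma econv_lty_ae u v : measurable_fun setT u -> measurable_fun setT v ->
  (forall x, 0 <= u x)%E -> (forall x, 0 <= v x)%E ->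
  (\int[mu]_x u x < +oo)%E -> (\int[mu]_x v x < +oo)%E ->
  (\int[mu]_x econv u v x < +oo)%E.
Proof.
move=> mu_ mv u0 v0 ui vi; rewrite integral_econv// lte_mul_pinfty//.
  exact: integral_ge0.
by rewrite ge0_fin_numE//; exact: integral_ge0.
Qed.

Lemma integrable_nabs f : mu.-integrable setT (EFin \o f) ->
  (\int[mu]_x nabs f x < +oo)%E.
Proof. by case/integrableP. Qed.

Lemma integrable_measurable f : mu.-integrable setT (EFin \o f) ->
  measurable_fun setT f.
Proof. by case/integrableP => /measurable_EFinP. Qed.

Lemma integrable_conv f g : mu.-integrable setT (EFin \o f) ->
  mu.-integrable setT (EFin \o g) -> mu.-integrable setT (EFin \o conv f g).
Proof.
move=> fi gi; have mf := integrable_measurable fi; have mg := integrable_measurable gi.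
apply/integrableP; split; first by apply/measurable_EFinP; exact: measurable_conv.
apply: le_lt_trans (econv_lty_ae (measurable_nabs mf) (measurable_nabs mg)
  (nabs_ge0 f) (nabs_ge0 g) (integrable_nabs fi) (integrable_nabs gi)).
apply: ge0_le_integral => //.
- by do 2 apply: measurableT_comp => //; exact: measurable_conv.
- by apply: measurable_econv => //; first [exact: measurable_nabs|exact: nabs_ge0].
- by move=> x _; exact: abs_conv_le.
Qed.

(** Fubini at a fixed t, which needs the triple convolution of absolute values to be finite at that
    t only. *)
Lemma convA f g h t :
  measurable_fun setT f -> measurable_fun setT g -> measurable_fun setT h ->
  (econv (nabs f) (econv (nabs g) (nabs h)) t < +oo)%E ->
  conv f (conv g h) t = conv (conv f g) h t.
Proof.
move=> mf mg mh fin.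
have mft : measurable_fun setT (fun s : R => f (t - s)).
  exact: (measurableT_comp mf (measurable_shift t)).
have := @fubini_kernel (fun s => f (t - s)) h (fun z => g (z.1 - z.2)) mft mh
  (measurable_sub2 mg).
rewrite /= => H; rewrite {1}/conv/= H.
  apply: eq_Rintegral => r _; rewrite mulrC; congr (_ * _).
  rewrite /conv (@Rintegral_affine R 1 (- r) (fun s => f (t - r - s) * g s))//.
  - rewrite normr1 mul1r; apply: eq_Rintegral => s _.
    by rewrite mul1r mulrC opprB addrA subrK.
  - apply: measurable_funM => //; exact: (measurableT_comp mf (measurable_shift _)).
apply: le_lt_trans fin; rewrite le_eqVlt; apply/orP; left; apply/eqP.
apply: eq_integral => s _; rewrite -ge0_integralZl//.
- by apply: eq_integral => r _; rewrite /nabs -!EFinM -!normrM.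
- apply: emeasurable_funM; last exact: measurable_nabs.
  exact: emeasurable_reflect (measurable_nabs mg).
- by move=> r _; rewrite mule_ge0// nabs_ge0.
- exact: nabs_ge0.
Qed.

Lemma conv_pairing f g h :
  measurable_fun setT f -> measurable_fun setT g -> measurable_fun setT h ->
  (\int[mu]_t (nabs f t * econv (nabs g) (nabs h) t) < +oo)%E ->
  \int[mu]_t (f t * conv g h t) = \int[mu]_s (h s * \int[mu]_t (g (t - s) * f t)).
Proof.
move=> mf mg mh fin.
apply: (@fubini_kernel f h (fun z => g (z.1 - z.2)) mf mh (measurable_sub2 mg)).
apply: le_lt_trans fin; rewrite le_eqVlt; apply/orP; left; apply/eqP.
apply: eq_integral => s _; rewrite -ge0_integralZl//.
- by apply: eq_integral => r _; rewrite /nabs -!EFinM -!normrM.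
- apply: emeasurable_funM; last exact: measurable_nabs.
  exact: emeasurable_reflect (measurable_nabs mg).
- by move=> r _; rewrite mule_ge0// nabs_ge0.
- exact: nabs_ge0.
Qed.

End convolution.

(** * Densities of absolutely continuous functions *)

Section absolutely_continuous.
Context {R : realType}.
Notation mu := (@lebesgue_measure R).
Implicit Types (a b e d : R) (g : R -> R) (s r : seq (R * R)).

Definition apart (p q : R * R) : bool := (p.2 <= q.1) || (q.2 <= p.1).

Definition within_itv a b (p : R * R) : bool := [&& a <= p.1, p.1 <= p.2 & p.2 <= b].

(** Lists replace the indexed families of [abs_continuous], so that one interval can be exchanged
    for the steps of a partition ([family_refine]). *)
Definition family a b s : bool := all (within_itv a b) s && pairwise apart s.

Definition len s : R := \sum_(p <- s) (p.2 - p.1).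

Definition var g s : R := \sum_(p <- s) `|g p.2 - g p.1|.

Lemma abs_continuous_family a b g : abs_continuous a b g ->
  forall e, 0 < e -> exists2 d, 0 < d &
    forall s, family a b s -> len s < d -> var g s < e.
Proof.
move=> acg e e0; have [d d0 H] := acg e e0; exists d => // s /andP[alls prs] lens.
have tE i : tnth (in_tuple s) i = nth (0, 0) s i by exact: tnth_nth.
have := H (size s) (fun i => (tnth (in_tuple s) i).1) (fun i => (tnth (in_tuple s) i).2).
rewrite -!(big_tuple _ _ (in_tuple s) xpredT (fun p => p.2 - p.1)).
rewrite -!(big_tuple _ _ (in_tuple s) xpredT (fun p => `|g p.2 - g p.1|)).
apply=> //.
- move=> i; have /(allP alls)/and3P[] : tnth (in_tuple s) i \in s by exact: mem_tnth.
  by [].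
- move=> i j; rewrite neq_ltn => /orP[] ij.
  + have := (pairwiseP (0, 0) prs) i j; rewrite !inE !ltn_ord => /(_ isT isT ij).
    by rewrite -!tE => /orP[]; [left|right].
  + have := (pairwiseP (0, 0) prs) j i; rewrite !inE !ltn_ord => /(_ isT isT ij).
    by rewrite -!tE => /orP[]; [right|left].
Qed.

Lemma abs_continuousP a b g :
  (forall e, 0 < e -> exists2 d, 0 < d &
    forall s, family a b s -> len s < d -> var g s < e) ->
  abs_continuous a b g.
Proof.
move=> H e e0; have [d d0 {}H] := H e e0; exists d => // n u v uv dis lens.
have := H [seq (u i, v i) | i <- index_enum 'I_n].
rewrite /len /var !big_map/=; apply => //.
apply/andP; split.
  by apply/allP => p /mapP[i _ ->]; rewrite /within_itv/=; have [-> [-> ->]] := uv i.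
rewrite pairwise_map.
have := index_enum_uniq 'I_n; rewrite uniq_pairwise.
apply: sub_pairwise => i j /= ij; rewrite /apart/=.
by have [->|->] := dis _ _ ij; rewrite ?orbT.
Qed.

Fixpoint steps (u : R) (p : seq R) : seq (R * R) :=
  if p is x :: p' then (u, x) :: steps x p' else [::].

Lemma variation_steps u v g p : itv_partition u v p ->
  variation u v g p = var g (steps u p).
Proof.
move=> uvp; rewrite variation_zip// /var.
have : size p = size p by [].
elim: p u {uvp} => [|x p ih] u _; rewrite ?big_nil//=.
by rewrite !big_cons/= ih.
Qed.

Lemma family_steps u v p : itv_partition u v p ->
  family u v (steps u p) /\ len (steps u p) = v - u.
Proof.
elim: p u => [|x p ih] u [].
  by move=> _ /eqP/= <-; rewrite /family/= /len big_nil subrr.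
move=> /= /andP[ux xp] xv; have [/andP[al pw] le] := ih x (conj xp xv).
have xv' : x <= v.
  have [p0|p0] := posnP (size p).
    by move: xv; rewrite (size0nil p0)/= => /eqP ->.
  by apply: ltW; apply: (itv_partition_size_neq0 p0); split.
split; last by rewrite /len big_cons/= -/(len _) le; ring.
apply/andP; split => /=.
  rewrite {1}/within_itv/= lexx (ltW ux) xv'/=.
  apply: sub_all al => q /and3P[q1 q2 q3]; rewrite /within_itv q2 q3 !andbT.
  by rewrite (le_trans _ q1)// ltW.
rewrite pw andbT; apply: sub_all al => q /and3P[q1 q2 q3].
by rewrite /apart/= q1.
Qed.

Lemma apart_sub u v q q' : within_itv u v q -> apart (u, v) q' -> apart q q'.
Proof.
move=> /and3P[q1 q2 q3] /orP[/= h|/= h]; rewrite /apart.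
  by rewrite (le_trans q3).
by rewrite (le_trans h q1) orbT.
Qed.

Lemma apartC q q' : apart q q' = apart q' q.
Proof. by rewrite /apart orbC. Qed.

Lemma family_refine a b r u v s t : family a b (r ++ (u, v) :: s) ->
  family u v t -> family a b ((r ++ t) ++ s).
Proof.
rewrite /family !all_cat !pairwise_cat/= => /andP[/and3P[ar uva as_]] /and4P[].
move=> rs pr us ps /andP[at_ pt].
move: rs; rewrite allrel_consr => /andP[ru rs].
apply/andP; split.
  rewrite ar as_ andbT/=; apply: sub_all at_ => q /and3P[q1 q2 q3].
  move/and3P : uva => /=[h1 h2 h3].
  by rewrite /within_itv q2 (le_trans h1 q1) (le_trans q3 h3).
rewrite allrel_catl rs ps pr pt /= !andbT.
apply/andP; split.
  apply/allrelP => q q' qt q's; apply: (@apart_sub u v).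
    exact: (allP at_).
  exact: (allP us).
apply/allrelP => q q' qr q't; rewrite apartC; apply: (@apart_sub u v).
  exact: (allP at_).
by rewrite apartC; exact: (allP ru).
Qed.

(** Refining an interval by a partition keeps the total length, so the bound e survives, and the
    supremum over partitions turns increments into total variations. The intervals are treated one
    at a time; r collects those already replaced by partition steps. *)
Lemma family_total_variation a b g e d :
  (forall s, family a b s -> len s < d -> var g s < e) ->
  forall s r, family a b (r ++ s) -> len (r ++ s) < d ->
  ((var g r)%:E + \sum_(p <- s) total_variation p.1 p.2 g <= e%:E)%E.
Proof.
move=> H; elim => [|[u v] s ih] r.
  by rewrite cats0 big_nil adde0 lee_fin => h1 h2; exact/ltW/H.
move=> fam lens; rewrite big_cons/=.
have uv : u <= v.
  by move: fam; rewrite /family all_cat/= => /andP[/and3P[_ /and3P[]]].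
have K p : itv_partition u v p ->
    ((var g r)%:E + ((variation u v g p)%:E + \sum_(q <- s) total_variation q.1 q.2 g) <= e%:E)%E.
  move=> uvp; have [fst_ lst] := family_steps uvp.
  have := ih (r ++ steps u p) (family_refine fam fst_).
  rewrite variation_steps// addeA -EFinD.
  have -> : var g (r ++ steps u p) = var g r + var g (steps u p) by rewrite /var big_cat.
  apply; move: lens; rewrite /len !big_cat big_cons /= -!/(len _) lst.
  by rewrite addrA.
have [p0 uvp0] : exists p, itv_partition u v p.
  move: uv; rewrite le_eqVlt => /predU1P[->|uv]; last by exists [:: v]; exact: itv_partition1.
  by exists [::]; split => /=.
have TV0 : (0 <= \sum_(q <- s) total_variation q.1 q.2 g)%E.
  rewrite big_seq; apply: sume_ge0 => q qs; apply: total_variation_ge0.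
  by move: fam; rewrite /family all_cat/= => /andP[/and3P[_ _ /allP /(_ _ qs) /and3P[]]].
(* A single partition shows that the remaining sum is finite, so it can be moved to the other side
   before the supremum is taken. *)
have Y0 := K _ uvp0.
case: (\sum_(q <- s) _)%E K TV0 Y0 => // y K _ _.
have TVle : (total_variation u v g <= (e - var g r - y)%:E)%E.
  rewrite /total_variation; apply: ge_ereal_sup => _ [_ [p uvp <-] <-].
  by have := K _ uvp; rewrite -!EFinD !lee_fin; lra.
apply: (@le_trans _ _ ((var g r)%:E + ((e - var g r - y)%:E + y%:E))%E).
  by rewrite leeD2l// leeD2r.
by rewrite -!EFinD lee_fin; lra.
Qed.

Lemma abs_continuous_TV_lty a b g : a <= b -> abs_continuous a b g ->
  (total_variation a b g < +oo)%E.
Proof.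
move=> ab /abs_continuous_family/(_ _ ltr01)[d d0 H].
(* Equally spaced points capped at b. A step is shorter than the d attached to e = 1, so it carries
   variation at most 1, and finitely many steps reach b. *)
pose c k := Num.min b (a + k%:R * (d / 2)).
have ac k : a <= c k by rewrite le_min ab lerDl mulr_ge0// divr_ge0// ltW.
have cb k : c k <= b by rewrite ge_min lexx.
have cc k : c k <= c k.+1.
  rewrite le_min cb/= ge_min lerD2l ler_wpM2r ?orbT ?ler_nat// divr_ge0//.
  exact: ltW.
have cd k : c k.+1 - c k < d.
  rewrite /c !minEle -natr1; do 2 case: ifPn => //; rewrite -?ltNge; move: d0; lra.
have step k : (total_variation (c k) (c k.+1) g <= 1)%E.
  have := @family_total_variation a b g 1 d H [:: (c k, c k.+1)] [::].
  rewrite /= big_seq1 /var big_nil add0e; apply.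
    by rewrite /family/= /within_itv/= ac cc cb.
  by rewrite /len big_seq1/=.
have fin k : (total_variation a (c k) g < +oo)%E.
  elim: k => [|k ih].
    by rewrite /c mul0r addr0 min_r// total_variationxx.
  by rewrite (total_variationD g (ac k) (cc k)) lte_add_pinfty// (le_lt_trans (step k))// ltry.
have [k kb] : exists k : nat, b <= a + k%:R * (d / 2).
  exists (Num.bound ((b - a) / (d / 2))); rewrite -lerBlDl -ler_pdivrMr ?divr_gt0//.
  by apply/ltW/archi_boundP; rewrite !divr_ge0 ?subr_ge0// ltW.
by have := fin k; rewrite /c min_l.
Qed.

(** Jordan decomposition g = T - (T - g), with T the variation of g from a. [family_total_variation]
    makes T absolutely continuous; the modulus is taken at e / 2 because that lemma only returns a
    weak inequality. *)
Lemma abs_continuous_monotone_split a b g : a < b -> abs_continuous a b g ->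
  exists T : R -> R, [/\ abs_continuous a b T,
    {in `[a, b] &, {homo T : x y / x <= y}} &
    {in `[a, b] &, {homo (fun x => T x - g x) : x y / x <= y}}].
Proof.
move=> ab acg; have TVf := abs_continuous_TV_lty (ltW ab) acg.
pose T t := fine (total_variation a t g).
have TVE u v : a <= u -> u <= v -> v <= b ->
    (T v - T u)%:E = total_variation u v g.
  move=> au uv vb; have av := le_trans au uv.
  have h1 := total_variationD g av vb; have h2 := total_variationD g au uv.
  have p1 := total_variation_ge0 g au; have p2 := total_variation_ge0 g uv.
  have p3 := total_variation_ge0 g vb.
  move: TVf; rewrite /T h1 h2.
  case: (total_variation a u g) p1 => [x| |] // _;
    case: (total_variation u v g) p2 => [y| |] // _;
    case: (total_variation v b g) p3 => [z| |] //= _ _.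
  by congr EFin; ring.
exists T; split.
- apply: abs_continuousP => e e0.
  have e20 : 0 < e / 2 by rewrite divr_gt0.
  have [d d0 H] := abs_continuous_family acg e20; exists d => // s fam lens.
  have := @family_total_variation a b g _ d H s [::] fam lens.
  rewrite /var big_nil add0e.
  have -> : (\sum_(p <- s) total_variation p.1 p.2 g =
             (\sum_(p <- s) `|T p.2 - T p.1|)%:E)%E.
    rewrite -sumEFin big_seq [RHS]big_seq; apply: eq_bigr => p ps.
    move: fam => /andP[/allP/(_ _ ps)/and3P[p1 p2 p3] _].
    by rewrite ger0_norm ?TVE// -lee_fin TVE// total_variation_ge0.
  by rewrite lee_fin => /le_lt_trans; apply; lra.
- move=> x y; rewrite !in_itv/= => /andP[ax xb] /andP[ay yb] xy.
  by rewrite -subr_ge0 -lee_fin TVE// total_variation_ge0.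
- move=> x y; rewrite !in_itv/= => /andP[ax xb] /andP[ay yb] xy.
  have := total_variation_ge g xy; rewrite -TVE// lee_fin => /(le_trans (ler_norm _)).
  lra.
Qed.

Lemma abs_continuousB a b g h : abs_continuous a b g -> abs_continuous a b h ->
  abs_continuous a b (fun x => g x - h x).
Proof.
move=> acg ach e e0.
have e20 : 0 < e / 2 by rewrite divr_gt0.
have [d1 d10 H1] := acg _ e20; have [d2 d20 H2] := ach _ e20.
exists (Num.min d1 d2); first by rewrite lt_min d10.
move=> n u v uv dis; rewrite lt_min => /andP[l1 l2].
have := ltrD (H1 n u v uv dis l1) (H2 n u v uv dis l2).
rewrite -big_split/= -splitr; apply: le_lt_trans; apply: ler_sum => i _.
have -> : g (v i) - h (v i) - (g (u i) - h (u i)) =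
  (g (v i) - g (u i)) - (h (v i) - h (u i)) by ring.
exact: ler_normB.
Qed.

(** Composition with it extends a function on [a, b] by constants, preserving continuity and
    monotonicity. This yields functions on the whole line, as Stieltjes measures and continuity
    statements require. *)
Definition clamp a b (x : R) : R := Num.max a (Num.min b x).

Lemma clamp_itv a b x : a <= b -> a <= clamp a b x <= b.
Proof. by move=> ab; rewrite /clamp le_max lexx/= ge_max ab ge_min lexx. Qed.

Lemma clamp_id a b x : a <= x <= b -> clamp a b x = x.
Proof. by move=> /andP[ax xb]; rewrite /clamp min_r// max_r. Qed.

Lemma clamp_le a b x y : x <= y -> clamp a b x <= clamp a b y.
Proof.
move=> xy; rewrite /clamp ge_max le_max lexx/= le_max; apply/orP; right.
by rewrite le_min !ge_min lexx xy/= orbT.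
Qed.

Lemma clamp_dist a b x y : x <= y -> clamp a b y - clamp a b x <= y - x.
Proof.
move=> xy; rewrite /clamp !maxEle !minEle.
by do !case: ifPn => //; rewrite -?ltNge; lra.
Qed.

Lemma abs_continuous_clamp a b g : a <= b -> abs_continuous a b g ->
  continuous (fun x => g (clamp a b x)).
Proof.
move=> ab acg x; apply/cvgrPdist_lt => e e0.
have [d d0 H] := abs_continuous_family acg e0.
have D u v : u <= v -> v - u < d -> `|g (clamp a b v) - g (clamp a b u)| < e.
  move=> uv vu; have /andP[au ub] := clamp_itv u ab; have /andP[av vb] := clamp_itv v ab.
  have := H [:: (clamp a b u, clamp a b v)].
  rewrite /len /var !big_seq1/=; apply.
    by rewrite /family/= /within_itv/= au vb clamp_le.
  exact: le_lt_trans (clamp_dist a b uv) vu.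
exists d => //= y; rewrite /ball_/=; have [xy|/ltW yx] := leP x y.
  by rewrite distrC ger0_norm ?subr_ge0// distrC; exact: D.
by rewrite ger0_norm ?subr_ge0//; exact: D.
Qed.

(** * Density of a nondecreasing absolutely continuous function, by Radon-Nikodym *)

Section monotone.
Variables (a b : R) (h : R -> R).
Hypothesis ab : a < b.
Hypothesis ach : abs_continuous a b h.
Hypothesis ndh : {in `[a, b] &, {homo h : x y / x <= y}}.

Let H x := h (clamp a b x).

Let ndH : nondecreasing H.
Proof.
move=> x y xy; apply: ndh; rewrite ?in_itv/= ?clamp_itv ?(ltW ab)//.
exact: clamp_le.
Qed.

Let rcH : forall x, H @ at_right x --> H x.
Proof. by apply: right_continuousW; exact: (abs_continuous_clamp (ltW ab) ach). Qed.

Let cH : cumulative R R := HB.pack H (isCumulative.Build R _ R H ndH rcH).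

Let D : set (measurableTypeR R) := `]a, b]%classic.

Let mD : measurable D. Proof. exact: measurable_itv. Qed.

Let nuE x y : x <= y -> lebesgue_stieltjes_measure cH `]x, y]%classic = (H y - H x)%:E.
Proof.
move=> xy; rewrite /lebesgue_stieltjes_measure /measure_extension measurable_mu_extE; last exact: is_ocitv.
by rewrite /= wlength_itv_bnd.
Qed.

Let Dfin : (lebesgue_stieltjes_measure cH D < +oo)%E.
Proof. by rewrite nuE ?ltW// ltry. Qed.

Let nu : {finite_measure set (measurableTypeR R) -> \bar R} := mfrestr mD Dfin.

Let sub_le_var (X : set (ocitv_type R)) : measurable X -> X !=set0 -> X `<=` D ->
  exists p : R * R, [/\ within_itv a b p, p.1 < p.2 & X = `]p.1, p.2]%classic].
Proof.
move=> /ocitvP[-> [x]//|[[x y]/= xy ->]] _ sub; exists (x, y); split => //.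
have : D y by apply: sub; rewrite /= in_itv/= xy lexx.
rewrite /D/= in_itv/= => /andP[ay yb].
(* If x < a, the interval would contain min(a, y), which is not in []a, b]]. *)
rewrite /within_itv/= (ltW xy) yb !andbT leNgt; apply/negP => xa.
have : D (Num.min a y) by apply: sub; rewrite /= in_itv/= lt_min xa xy/= ge_min lexx orbT.
by rewrite /D/= in_itv/= lt_min ltxx.
Qed.

(** A finite union of half-open intervals splits into finitely many disjoint ones, which form a
    [family]. Its length is the Lebesgue measure of the union and, h being nondecreasing, its
    variation is the Stieltjes measure. *)
Let small_union e d : 0 < e ->
  (forall s, family a b s -> len s < d -> var h s < e) ->
  forall (F : (set (ocitv_type R))^nat) n, (forall k, measurable (F k)) ->
  (forall k, F k `<=` D) ->
  (mu (\big[setU/set0]_(k < n) F k) < d%:E)%E ->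
  (lebesgue_stieltjes_measure cH (\big[setU/set0]_(k < n) F k) <= e%:E)%E.
Proof.
move=> e0 He F n mF FD.
have mB : measurable (\big[setU/set0]_(k < n) F k : set (SetRing.type (ocitv_type R))).
  by apply: bigsetU_measurable => k _; exact: SetRing.measurable_subring.
have [C [Cfin C0 Ctriv Cm CE]] := SetRing.ring_finite_set mB.
have CD X : C X -> X `<=` D.
  move=> CX x Xx.
  have : (\bigcup_(X in C) X) x by exists X.
  by rewrite -CE; elim/big_ind : _ => //[U V hU hV []//|k _]; exact: FD.
have /choice[p pP] : forall X, exists p : R * R, C X ->
    [/\ within_itv a b p, p.1 < p.2 & X = `]p.1, p.2]%classic].
  move=> X; have [CX|nCX] := pselect (C X); last by exists (0, 0).
  by have [p ?] := sub_le_var (Cm _ (mem_set CX)) (C0 _ CX) (CD _ CX); exists p.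
have Cmm X : C X -> measurable (X : set (measurableTypeR R)).
  by move=> /pP[_ _ ->]; exact: measurable_itv.
have inC X : X \in fset_set C -> C X by rewrite in_fset_set// => /set_mem.
pose s := [seq p X | X <- fset_set C].
have fam : family a b s.
  apply/andP; split.
    by apply/allP => q /mapP[X /inC /pP[? _ _] ->].
  rewrite /s pairwise_map; apply: (@sub_in_pairwise _ (mem (fset_set C)) (fun X Y => X != Y)).
  - move=> X Y /inC CX /inC CY XY; apply/negPn/negP; rewrite /apart negb_or -!ltNge => /andP[h1 h2].
    have [_ X1 EX] := pP _ CX; have [_ Y1 EY] := pP _ CY.
    move/eqP : XY; apply; apply: Ctriv => //; exists (Num.min (p X).2 (p Y).2); split.
      by rewrite [X in X _]EX /= in_itv/= lt_min X1 h2 ge_min lexx.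
    by rewrite [X in X _]EY /= in_itv/= lt_min h1 Y1 ge_min lexx orbT.
  - by apply/allP.
  - by rewrite -uniq_pairwise.
have lenE : mu (\big[setU/set0]_(k < n) F k) = (len s)%:E.
  rewrite [X in mu X]CE measure_fin_bigcup// fsbig_finite//= /len /s big_map -sumEFin.
  rewrite big_seq [RHS]big_seq; apply: eq_bigr => X /inC /pP[/and3P[_ p12 _] _ {1}->].
  by rewrite lebesgue_measure_itv/= lte_fin; case: ltgtP p12 => // ->; rewrite subrr.
have varE : lebesgue_stieltjes_measure cH (\big[setU/set0]_(k < n) F k) = (var h s)%:E.
  rewrite [X in lebesgue_stieltjes_measure cH X]CE measure_fin_bigcup// fsbig_finite//= /var /s big_map -sumEFin.
  rewrite big_seq [RHS]big_seq; apply: eq_bigr => X /inC /pP[/and3P[p1 p12 p2] _ {1}->].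
  have p1' := le_trans p12 p2; have p2' := le_trans p1 p12.
  rewrite nuE// /H !clamp_id ?p1 ?p2 ?andbT// ger0_norm// subr_ge0.
  by apply: ndh => //; rewrite in_itv/= ?p1 ?p2 ?andbT.
rewrite lenE varE lte_fin lee_fin => l; exact/ltW/He.
Qed.

(** A null set has a countable cover by half-open intervals of total length less than d. After
    intersection with []a, b]], each finite union has Stieltjes measure at most e, and continuity
    from below passes this to the whole cover. *)
Let nu_small e : 0 < e -> forall A : set (measurableTypeR R),
  measurable A -> mu A = 0%E -> (nu A <= e%:E)%E.
Proof.
move=> e0 A mA A0; have [d d0 He] := abs_continuous_family ach e0.
have : ((wlength idfun)^*%mu A < d%:E)%E.
  by rewrite -[X in (X < _)%E]/(mu A) A0 lte_fin.
rewrite /mu_ext => /ereal_inf_lt[_ [F [mF AF] <-] Fd].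
pose G k : set (ocitv_type R) := F k `&` D.
have mG k : measurable (G k) by apply: measurableI => //; exact: is_ocitv.
have GD k : G k `<=` D by move=> x [].
have mFm k : measurable (F k : set (measurableTypeR R)) by exact: sub_sigma_algebra.
have mGm k : measurable (G k : set (measurableTypeR R)).
  by apply: measurableI => //; exact: sub_sigma_algebra.
have le_d n : (mu (\big[setU/set0]_(k < n) G k) < d%:E)%E.
  apply: le_lt_trans Fd.
  apply: (@le_trans _ _ (\sum_(k < n) wlength idfun (F k))%E); last first.
    rewrite -(big_mkord xpredT (fun k => wlength idfun (F k))).
    by apply: nneseries_lim_ge => k _ _; exact: measure_ge0.
  apply: (@le_trans _ _ (\sum_(k < n) mu (G k))%E).
    by apply: (@Boole_inequality _ _ _ mu G n) => k _; exact: mGm.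
  apply: lee_sum => k _; apply: (@le_trans _ _ (mu (F k))).
    by apply: (@le_measure _ _ _ mu); [exact: mem_set (mGm k)|exact: mem_set (mFm k)|exact: subIsetl].
  by rewrite /lebesgue_measure /lebesgue_stieltjes_measure /measure_extension measurable_mu_extE.
have small n := small_union e0 He mG GD (le_d n).
have Acov : A `&` D `<=` \bigcup_k G k.
  by move=> x [/AF[k _ Fx] Dx]; exists k.
have cvgG := @nondecreasing_cvg_mu _ _ _ (lebesgue_stieltjes_measure cH)
  (fun n => \big[setU/set0]_(k < n.+1) G k).
have {}cvgG : (lebesgue_stieltjes_measure cH (\big[setU/set0]_(k < n.+1) G k) @[n --> \oo]
    --> lebesgue_stieltjes_measure cH (\bigcup_k G k))%E.
  rewrite -bigcup_bigsetU_bigcup; apply: cvgG.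
  - by move=> n; apply: bigsetU_measurable => k _.
  - by apply: bigcup_measurable => n _; apply: bigsetU_measurable => k _.
  - by move=> m n mn; apply/subsetPset; apply: subset_bigsetU.
apply: (@le_trans _ _ (lebesgue_stieltjes_measure cH (\bigcup_k G k))).
  rewrite [nu A]/(lebesgue_stieltjes_measure cH (A `&` D)).
  by apply: (@le_measure _ _ _ (lebesgue_stieltjes_measure cH)) => //; apply/mem_set;
    [exact: measurableI|exact: bigcup_measurable].
rewrite -(cvg_lim (@ereal_hausdorff R) cvgG).
apply: lime_le; first by apply/cvg_ex; eexists; exact: cvgG.
by apply: nearW => n; exact: small.
Qed.

Lemma monotone_dominates : nu `<< mu.
Proof.
move=> N muN A mA AN; have A0 := muN A mA AN.
apply/eqP; rewrite eq_le measure_ge0 andbT.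
by apply/lee_addgt0Pr => e e0; rewrite add0e; exact: nu_small.
Qed.

Lemma monotone_density : exists G : R -> R,
  mu.-integrable setT (EFin \o G) /\
  forall t, t \in `[a, b] -> h t = h a + \int[mu]_(s in `]a, t]) G s.
Proof.
have dom := monotone_dominates.
pose G := fine \o Radon_Nikodym_SigmaFinite.f nu mu.
have GE x : (G x)%:E = Radon_Nikodym_SigmaFinite.f nu mu x.
  by rewrite /G/= fineK//; exact: Radon_Nikodym_SigmaFinite.f_fin_num.
exists G; split.
  apply: eq_integrable (Radon_Nikodym_SigmaFinite.f_integrable dom) => //.
  by move=> x _; rewrite /= GE.
move=> t; rewrite in_itv/= => /andP[at_ tb].
have : nu `]a, t]%classic = (h t - h a)%:E.
  rewrite /nu/= /mfrestr/= /mrestr setIidl; last first.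
    by move=> x; rewrite /D/= !in_itv/= => /andP[-> xt]; rewrite (le_trans xt).
  rewrite nuE// /H !clamp_id ?at_ ?tb// lexx ltW//.
rewrite (Radon_Nikodym_SigmaFinite.f_integral dom); last exact: measurable_itv.
rewrite /Rintegral; under [X in _ -> _ = _ + fine X]eq_integral do rewrite GE.
by move=> ->/=; rewrite addrC subrK.
Qed.

End monotone.

Lemma abs_continuous_density a b g : a < b -> abs_continuous a b g ->
  exists G : R -> R, mu.-integrable setT (EFin \o G) /\
  forall t, t \in `[a, b] -> g t = g a + \int[mu]_(s in `]a, t]) G s.
Proof.
move=> ab acg; have [T [acT ndT ndTg]] := abs_continuous_monotone_split ab acg.
have [G1 [iG1 G1E]] := monotone_density ab acT ndT.
have [G2 [iG2 G2E]] := monotone_density ab (abs_continuousB acT acg) ndTg.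
exists (fun x => G1 x - G2 x); split.
  by rewrite [_ \o _](_ : _ = ((EFin \o G1) \- (EFin \o G2))%E)//; exact: integrableB.
move=> t tab; have := G1E t tab; have := G2E t tab.
rewrite RintegralB//; [lra|exact: integrableS iG1|exact: integrableS iG2].
Qed.

End absolutely_continuous.

(** * Power kernels, complex powers and the Gamma function *)

Section power_kernels.
Context {R : realType}.
Notation mu := (@lebesgue_measure R).

Lemma restrict_if (f : R -> R) (i : interval R) :
  f \_ [set` i] = fun r => if r \in i then f r else 0.
Proof. by apply/funext => r; rewrite patchE/= mem_setE. Qed.

Lemma measurable_if_itv (f : R -> R) (i : interval R) :
  measurable_fun [set` i] f ->
  measurable_fun setT (fun r => if r \in i then f r else 0).
Proof. by move=> mf; rewrite -restrict_if; apply/(measurable_restrictT f). Qed.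

Lemma integral_if_itv (f : R -> R) (i : interval R) :
  (\int[mu]_r (if r \in i then f r else 0)%:E = \int[mu]_(r in [set` i]) (f r)%:E)%E.
Proof.
rewrite [RHS]integral_mkcond; apply: eq_integral => r _.
by rewrite patchE mem_setE; case: ifP.
Qed.

(** On []0, +oo[] these are homogeneous models of the kernels, with exact scaling under convolution;
    on []0, c]] they are integrable majorants. *)
Definition pw (i : interval R) (x r : R) : R := if r \in i then r `^ x else 0.

Lemma measurable_pw i x : measurable_fun setT (pw i x).
Proof. by apply: measurable_if_itv; exact: measurable_funTS (measurable_powR x). Qed.

Lemma pw_ge0 i x r : 0 <= pw i x r.
Proof. by rewrite /pw; case: ifP => // _; exact: powR_ge0. Qed.

Lemma integral_powR_itv (x e c : R) : x + 1 != 0 -> 0 < e -> e < c ->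
  (\int[mu]_(r in `[e, c]) (r `^ x)%:E =
   ((c `^ (x + 1) - e `^ (x + 1)) / (x + 1))%:E)%E.
Proof.
move=> x1 e0 ec; pose F (r : R) := (x + 1)^-1 * r `^ (x + 1).
have dF (r : R) : 0 < r -> is_derive r 1 F (r `^ x).
  move=> r0; have := is_derive1_powR (x + 1) r0.
  move=> /(is_deriveZ (x + 1)^-1) h.
  by apply: is_derive_eq h _; rewrite addrK /GRing.scale/= mulKf.
have cF (r : R) : 0 < r -> {for r, continuous F}.
  by move=> /dF h; apply: differentiable_continuous; apply/derivable1_diffP; exact: ex_derive.
have cp (r : R) : 0 < r -> {for r, continuous (fun r : R => r `^ x)}.
  move=> r0; apply: differentiable_continuous; apply/derivable1_diffP.
  by apply: derivable_powR; rewrite in_itv/= r0.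
rewrite (@continuous_FTC2 _ _ F) //.
- by rewrite -EFinB /F -mulrBr mulrC.
- apply: continuous_in_subspaceT => r; rewrite mem_setE in_itv/= => /andP[er _].
  exact/cp/(lt_le_trans e0).
- split.
  + by move=> r; rewrite in_itv/= => /andP[er _]; apply: ex_derive; apply: dF; exact: lt_trans er.
  + by apply: cvg_at_right_filter; exact: cF.
  + by apply: cvg_at_left_filter; apply: cF; exact: lt_trans ec.
- move=> r; rewrite in_itv/= => /andP[er _]; rewrite derive1E.
  by apply: derive_val; apply: dF; exact: lt_trans er.
Qed.

Lemma pw_integral_lty (x c : R) : -1 < x ->
  (\int[mu]_r (pw `]0%R, c] x r)%:E < +oo)%E.
Proof.
move=> x1; rewrite integral_if_itv.
have x10 : 0 < x + 1 by lra.
have [c0|c0] := leP c 0; first by rewrite set_itv_ge ?integral_set0// bnd_simp -leNgt.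
(* [n.+2] keeps the left end strictly below c, as [integral_powR_itv] requires. *)
pose F (n : nat) : set (measurableTypeR R) := `[c / n.+2%:R, c]%classic.
have en n : 0 < c / n.+2%:R by rewrite divr_gt0.
have enc n : c / n.+2%:R < c by rewrite ltr_pdivrMr// ltr_pMr// ltr1n.
have := @ge0_nondecreasing_set_cvg_integral _ _ R F (fun r => (r `^ x)%:E) mu.
have -> : \bigcup_n F n = `]0, c]%classic.
  apply/seteqP; split => r; rewrite /F/=.
    by move=> [n _]; rewrite /= !in_itv/= => /andP[h ->]; rewrite (lt_le_trans _ h).
  rewrite in_itv/= => /andP[r0 rc]; exists (Num.bound (c / r)) => //=.
  rewrite in_itv/= rc andbT ler_pdivrMr// mulrC -ler_pdivrMr//.
  apply: ltW; apply: lt_le_trans (archi_boundP _) _; first by rewrite divr_ge0// ltW.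
  by rewrite ler_nat; apply: ltnW.
move=> H; have {}H := H _ _ _ _.
rewrite -(cvg_lim (@ereal_hausdorff R) (H _ _ _ _)).
- apply: le_lt_trans (ltry (c `^ (x + 1) / (x + 1))).
  apply: lime_le.
    apply/cvg_ex; eexists; apply: H.
    + move=> m n mn; apply/subsetPset => r; rewrite /F/= !in_itv/= => /andP[h ->].
      by rewrite andbT (le_trans _ h)// ler_pM2l// lef_pV2 ?posrE// ler_nat.
    + by move=> n; exact: measurable_itv.
    + by move=> n; apply/measurable_EFinP; apply: measurable_funTS; exact: measurable_powR.
    + by move=> n r _; rewrite lee_fin powR_ge0.
  apply: nearW => n; rewrite /F integral_powR_itv ?gt_eqF// lee_fin.
  by rewrite ler_pM2r ?invr_gt0// gerBl powR_ge0.
- move=> m n mn; apply/subsetPset => r; rewrite /F/= !in_itv/= => /andP[h ->].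
  by rewrite andbT (le_trans _ h)// ler_pM2l// lef_pV2 ?posrE// ler_nat.
- by move=> n; exact: measurable_itv.
- by move=> n; apply/measurable_EFinP; apply: measurable_funTS; exact: measurable_powR.
- by move=> n r _; rewrite lee_fin powR_ge0.
Qed.

Lemma pw_integrable (x c : R) : -1 < x ->
  mu.-integrable setT (EFin \o pw `]0%R, c] x).
Proof.
move=> x1; apply/integrableP; split; first by apply/measurable_EFinP; exact: measurable_pw.
apply: le_lt_trans (pw_integral_lty c x1).
rewrite le_eqVlt; apply/orP; left; apply/eqP; apply: eq_integral => r _.
by rewrite /= ger0_norm// pw_ge0.
Qed.

Let econvpw (x y r : R) := econv (EFin \o pw `]0%R, +oo[ x) (EFin \o pw `]0%R, +oo[ y) r.

Lemma econv_pw_scale (x y r : R) : 0 < r ->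
  econvpw x y r = ((r `^ (x + y + 1))%:E * econvpw x y 1)%E.
Proof.
move=> r0; rewrite /econvpw /econv/=.
have m1 : measurable_fun setT
  (fun s : R => (pw `]0%R, +oo[ x (r - s))%:E * (pw `]0%R, +oo[ y s)%:E)%E.
  apply: emeasurable_funM; apply/measurable_EFinP; last exact: measurable_pw.
  exact: (measurableT_comp (measurable_pw _ x) (measurable_shift r)).
have rn0 : r != 0 by rewrite gt_eqF.
rewrite (@ge0_integral_affine R r 0 _ rn0 m1); last first.
  by move=> s; rewrite mule_ge0// lee_fin pw_ge0.
have rp : r `^ (x + y + 1) = r * (r `^ x * r `^ y).
  by rewrite !powRD ?rn0 ?implybT// powRr1 ?ltW// mulrC.
rewrite rp EFinM (gtr0_norm r0) -muleA; congr (_ * _)%E.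
rewrite -ge0_integralZl//; last 3 first.
- apply: emeasurable_funM; apply/measurable_EFinP; last exact: measurable_pw.
  exact: (measurableT_comp (measurable_pw _ x) (measurable_shift 1)).
- by move=> s _; rewrite mule_ge0// lee_fin pw_ge0.
- by rewrite lee_fin mulr_ge0 ?powR_ge0.
apply: eq_integral => s _; rewrite -!EFinM addr0; congr EFin.
have -> : r - r * s = r * (1 - s) by ring.
rewrite /pw !in_itv/= !andbT !pmulr_rgt0//.
case: ifPn => s1; last by rewrite !mul0r mulr0.
case: ifPn => s0; last by rewrite !mulr0.
by rewrite !powRM ?ltW//; ring.
Qed.

Lemma econv_pw_neg (x y r : R) : r <= 0 -> econvpw x y r = 0%E.
Proof.
move=> r0; rewrite /econvpw /econv; apply: integral0_eq => s _.
rewrite /pw/= !in_itv/= !andbT; case: ifPn => [rs|]; last by rewrite mul0e.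
by rewrite ifF ?mule0//; apply/negbTE; rewrite -leNgt; lra.
Qed.

(** Finiteness of the beta integral without estimating it: were it infinite at 1, scaling would make
    the convolution infinite on all of []0, 1]], where it agrees with the convolution of the
    truncated powers. But the latter, of two integrable functions, has finite integral. *)
Lemma econv_pw_lty (x y : R) : -1 < x -> -1 < y -> (econvpw x y 1 < +oo)%E.
Proof.
move=> x1 y1; rewrite ltey; apply/eqP => Joo.
have mE z i : measurable_fun setT (EFin \o pw i z).
  by apply/measurable_EFinP; exact: measurable_pw.
have := @econv_lty_ae R _ _ (mE x `]0, 1]) (mE y `]0, 1]).
have E0 z i (s : R) : (0 <= (EFin \o pw i z) s)%E by rewrite lee_fin pw_ge0.
move=> /(_ (E0 _ _) (E0 _ _) (pw_integral_lty _ x1) (pw_integral_lty _ y1)).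
apply/negP; rewrite -leNgt leye_eq; apply/eqP.
apply/eqP; rewrite -leye_eq.
apply: (@le_trans _ _ (\int[mu]_(r in `]0%R, 1%R]) +oo%E)%E).
  by rewrite integral_cst//= lebesgue_measure_itv/= lte_fin ltr01 sube0 mule1.
apply: (@le_trans _ _ (\int[mu]_(r in `]0%R, 1%R])
   econv (EFin \o pw `]0%R, 1%R] x) (EFin \o pw `]0%R, 1%R] y) r)%E); last first.
  apply: ge0_subset_integral => //.
  - exact: measurable_econv.
  - by move=> r _; exact: econv_ge0.
apply: ge0_le_integral => //.
- by apply: measurable_funTS; exact: measurable_econv.
- move=> r; rewrite /= in_itv/= => /andP[r0 r1].
  have : econvpw x y r = +oo%E by rewrite econv_pw_scale// Joo gt0_muley// lte_fin powR_gt0.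
  move=> <-; rewrite /econvpw /econv le_eqVlt; apply/orP; left; apply/eqP.
  apply: eq_integral => s _; rewrite /pw/= !in_itv/= !andbT.
  case: ifPn => rs; case: ifPn => s0; rewrite ?mule0 ?mul0e//.
    by rewrite !ifT//; apply/andP; split => //; lra.
Qed.

End power_kernels.

Section complex_powers.
Local Open Scope complex_scope.
Context {R : realType}.
Notation mu := (@lebesgue_measure R).
Implicit Types (z w : R[i]) (r s : R).
Import ComplexField.Normc.
Local Notation Re := complex.Re.
Local Notation Im := complex.Im.

Lemma ReM z w : Re (z * w) = Re z * Re w - Im z * Im w.
Proof. by case: z; case: w. Qed.

Lemma ImM z w : Im (z * w) = Re z * Im w + Im z * Re w.
Proof. by case: z => a b; case: w => c d; rewrite /=. Qed.

Lemma ReD z w : Re (z + w) = Re z + Re w. Proof. by case: z; case: w. Qed.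

Lemma ImD z w : Im (z + w) = Im z + Im w. Proof. by case: z; case: w. Qed.

Lemma complex_eq z w : Re z = Re w -> Im z = Im w -> z = w.
Proof. by case: z => a b; case: w => c d /= -> ->. Qed.

Lemma normc_ge0 z : 0 <= normc z.
Proof. by case: z => a b; exact: sqrtr_ge0. Qed.

Lemma normrE z : `|z| = (normc z)%:C. Proof. by []. Qed.

Lemma normc_Re z : `|Re z| <= normc z.
Proof.
by case: z => a b /=; rewrite -sqrtr_sqr ler_wsqrtr// lerDl sqr_ge0.
Qed.

Lemma normc_Im z : `|Im z| <= normc z.
Proof.
by case: z => a b /=; rewrite -sqrtr_sqr ler_wsqrtr// lerDr sqr_ge0.
Qed.

Lemma normc_le z : normc z <= `|Re z| + `|Im z|.
Proof.
case: z => a b /=; rewrite -[leRHS]ger0_norm ?addr_ge0// -sqrtr_sqr ler_wsqrtr//.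
rewrite sqrrD !real_normK ?num_real// addrAC lerDl.
by rewrite mulrn_wge0// mulr_ge0.
Qed.

Lemma normc_real r : normc r%:C = `|r|.
Proof. by rewrite /= expr0n addr0 sqrtr_sqr. Qed.

Lemma normc_prod (z : R[i]) n : normc (z ^+ n) = normc z ^+ n.
Proof. by elim: n => [|n ih]; [rewrite !expr0 normc1|rewrite !exprS normcM ih]. Qed.

Lemma normc_sum (I : Type) (r : seq I) (P : pred I) (F : I -> R[i]) :
  normc (\sum_(i <- r | P i) F i) <= \sum_(i <- r | P i) normc (F i).
Proof.
elim/big_ind2 : _ => [|x1 x2 y1 y2 h1 h2|//]; first by rewrite normc0.
by rewrite (le_trans (le_normcD _ _))// lerD.
Qed.

Lemma cpowD r z w : 0 < r -> cpow r (z + w) = cpow r z * cpow r w.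
Proof.
move=> r0; apply: complex_eq; rewrite /cpow ?ReM ?ImM /= !ReD !ImD/=;
  (rewrite powRD; last by rewrite (gt_eqF r0) implybT);
  rewrite ?mulrDl ?cosD ?sinD; ring.
Qed.

Lemma cpowM r s z : 0 < r -> 0 < s -> cpow (r * s) z = cpow r z * cpow s z.
Proof.
move=> r0 s0; apply: complex_eq; rewrite /cpow ?ReM ?ImM /=;
  rewrite lnM ?posrE// powRM ?ltW// mulrDr cosD sinD; ring.
Qed.

Lemma normc_cpow r z : 0 <= r -> normc (cpow r z) = r `^ Re z.
Proof.
move=> r0; rewrite /cpow normcM normc_real /= cos2Dsin2 sqrtr1 mulr1.
by rewrite ger0_norm// powR_ge0.
Qed.

Lemma cpow_real r (x : R) : cpow r x%:C = (r `^ x)%:C.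
Proof. by rewrite /cpow/= mul0r cos0 sin0 mulr1. Qed.

Lemma cpow0 r : cpow r 0 = 1.
Proof. by rewrite -[0]/(0%:C) cpow_real powRr0. Qed.

Lemma cpow1 z : cpow 1 z = 1.
Proof. by rewrite /cpow powR1 ln1 mulr0 cos0 sin0 mul1r. Qed.

Lemma cpow_nat r z n : 0 < r -> cpow r (z * n%:R) = cpow r z ^+ n.
Proof.
move=> r0; elim: n => [|n ih]; first by rewrite mulr0 cpow0.
by rewrite -addn1 natrD mulrDr mulr1 cpowD// ih addn1 exprSr.
Qed.

Lemma measurable_cpow z :
  measurable_fun setT (fun r => Re (cpow r z)) /\
  measurable_fun setT (fun r => Im (cpow r z)).
Proof.
have mln : measurable_fun setT (fun r => Im z * ln r).
  by apply: measurable_funM => //; exact: measurable_ln.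
have mc : measurable_fun setT (fun r => cos (Im z * ln r)).
  apply: (measurableT_comp _ mln); apply: continuous_measurable_fun.
  exact: continuous_cos.
have ms : measurable_fun setT (fun r => sin (Im z * ln r)).
  apply: (measurableT_comp _ mln); apply: continuous_measurable_fun.
  exact: continuous_sin.
split.
- have -> : (fun r => Re (cpow r z)) = (fun r => r `^ Re z * cos (Im z * ln r)).
    by apply/funext => r; rewrite /cpow ReM/= mul0r subr0.
  by apply: measurable_funM => //; exact: measurable_powR.
- have -> : (fun r => Im (cpow r z)) = (fun r => r `^ Re z * sin (Im z * ln r)).
    by apply/funext => r; rewrite /cpow ImM/= mul0r addr0.
  by apply: measurable_funM => //; exact: measurable_powR.
Qed.

End complex_powers.

(** * Integrals and convolutions of complex-valued functions *)

Section complex_integrals.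
Local Open Scope complex_scope.
Context {R : realType}.
Notation mu := (@lebesgue_measure R).
Import ComplexField.Normc.
Implicit Types (f g : R -> R[i]) (z w : R[i]).
Local Notation Re := complex.Re.
Local Notation Im := complex.Im.

Definition cmeasurable f : Prop :=
  measurable_fun setT (fun t => Re (f t)) /\ measurable_fun setT (fun t => Im (f t)).

Lemma cmeasurableM f g : cmeasurable f -> cmeasurable g ->
  cmeasurable (fun t => f t * g t).
Proof.
move=> [f1 f2] [g1 g2]; split.
- under eq_fun do rewrite ReM.
  by apply: measurable_funB; exact: measurable_funM.
- under eq_fun do rewrite ImM.
  by apply: measurable_funD; exact: measurable_funM.
Qed.

Lemma cmeasurable_comp f (h : R -> R) : cmeasurable f -> measurable_fun setT h ->
  cmeasurable (f \o h).
Proof. by move=> [f1 f2] mh; split; [exact: (measurableT_comp f1 mh)|exact: (measurableT_comp f2 mh)]. Qed.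

Lemma cmeasurable_real (h : R -> R) : measurable_fun setT h ->
  cmeasurable (fun t => (h t)%:C).
Proof. by move=> mh; split => //=; exact: measurable_cst. Qed.

Lemma cintegrable_measurable f : cintegrable setT f -> cmeasurable f.
Proof. by move=> [f1 f2]; split; exact: integrable_measurable. Qed.

Lemma integrable_dominated (u v : R -> R) : measurable_fun setT u ->
  (forall t, `|u t| <= v t) -> mu.-integrable setT (EFin \o v) ->
  mu.-integrable setT (EFin \o u).
Proof.
move=> mu_ uv iv; apply: (le_integrable measurableT _ _ iv).
  exact/measurable_EFinP.
by move=> t _; rewrite /= lee_fin (le_trans (uv t))// ler_norm.
Qed.

Lemma cintegrable_dominated f (v : R -> R) : cmeasurable f ->
  (forall t, normc (f t) <= v t) -> mu.-integrable setT (EFin \o v) ->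
  cintegrable setT f.
Proof.
move=> [f1 f2] fv iv; split.
- by apply: (integrable_dominated f1 _ iv) => t; exact: le_trans (normc_Re _) _.
- by apply: (integrable_dominated f2 _ iv) => t; exact: le_trans (normc_Im _) _.
Qed.

Lemma cintegralZ z f : cintegrable setT f ->
  cintegral setT (fun t => z * f t) = z * cintegral setT f.
Proof.
move=> [f1 f2]; apply: complex_eq; rewrite /cintegral ?ReM ?ImM/=.
- under eq_Rintegral do rewrite ReM.
  rewrite RintegralB//= ?RintegralZl//; first exact: (integrableZl measurableT (Re z) f1).
  exact: (integrableZl measurableT (Im z) f2).
- under eq_Rintegral do rewrite ImM.
  rewrite RintegralD//= ?RintegralZl//; first exact: (integrableZl measurableT (Re z) f2).
  exact: (integrableZl measurableT (Im z) f1).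
Qed.

Lemma cintegrableD f g : cintegrable setT f -> cintegrable setT g ->
  cintegrable setT (fun t => f t + g t).
Proof.
move=> [f1 f2] [g1 g2]; split.
- under eq_fun do rewrite ReD EFinD; exact: integrableD.
- under eq_fun do rewrite ImD EFinD; exact: integrableD.
Qed.

Lemma cintegralD f g : cintegrable setT f -> cintegrable setT g ->
  cintegral setT (fun t => f t + g t) = cintegral setT f + cintegral setT g.
Proof.
move=> [f1 f2] [g1 g2]; apply: complex_eq; rewrite /cintegral ?ReD ?ImD/=.
- by under eq_Rintegral do rewrite ReD; rewrite RintegralD.
- by under eq_Rintegral do rewrite ImD; rewrite RintegralD.
Qed.

Lemma cintegrableZ z f : cintegrable setT f -> cintegrable setT (fun t => z * f t).
Proof.
move=> [f1 f2]; split.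
- under eq_fun do rewrite ReM EFinB; apply: integrableB => //.
    exact: (integrableZl measurableT (Re z) f1).
  exact: (integrableZl measurableT (Im z) f2).
- under eq_fun do rewrite ImM EFinD; apply: integrableD => //.
    exact: (integrableZl measurableT (Re z) f2).
  exact: (integrableZl measurableT (Im z) f1).
Qed.

Lemma cintegrable0 : cintegrable setT (fun _ : R => 0 : R[i]).
Proof. by split => /=; exact: integrable0. Qed.

Lemma cintegral0 : cintegral setT (fun _ : R => 0 : R[i]) = 0.
Proof.
by apply: complex_eq; rewrite /cintegral/= Rintegral_cst//= mul0r.
Qed.

Lemma cintegrable_sum (I : Type) (s : seq I) (F : I -> R -> R[i]) :
  (forall i, cintegrable setT (F i)) ->
  cintegrable setT (fun t => \sum_(i <- s) F i t).
Proof.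
move=> iF; elim: s => [|i s ih].
  by under eq_fun do rewrite big_nil; exact: cintegrable0.
by under eq_fun do rewrite big_cons; exact: cintegrableD.
Qed.

Lemma cintegral_sum (I : Type) (s : seq I) (F : I -> R -> R[i]) :
  (forall i, cintegrable setT (F i)) ->
  cintegral setT (fun t => \sum_(i <- s) F i t) = \sum_(i <- s) cintegral setT (F i).
Proof.
move=> iF; elim: s => [|i s ih].
  by under eq_fun do rewrite big_nil; rewrite big_nil cintegral0.
under eq_fun do rewrite big_cons; rewrite big_cons -ih.
by apply: cintegralD => //; exact: cintegrable_sum.
Qed.

(** The factor 2 comes from estimating the real and imaginary parts separately. *)
Lemma normc_cintegral f (v : R -> R) : cintegrable setT f ->
  (forall t, normc (f t) <= v t) -> mu.-integrable setT (EFin \o v) ->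
  normc (cintegral setT f) <= 2 * \int[mu]_t v t.
Proof.
move=> [f1 f2] fv iv; apply: le_trans (normc_le _) _; rewrite mulr_natl mulr2n.
have K (u : R -> R) : mu.-integrable setT (EFin \o u) -> (forall t, `|u t| <= v t) ->
    `|\int[mu]_t u t| <= \int[mu]_t v t.
  move=> iu uv; apply: le_trans (le_normr_Rintegral _ iu) _ => //.
  by apply: le_Rintegral => //; exact: (integrable_norm iu).
apply: lerD.
  by apply: (K (fun t => Re (f t))) => // t; exact: le_trans (normc_Re _) (fv t).
by apply: (K (fun t => Im (f t))) => // t; exact: le_trans (normc_Im _) (fv t).
Qed.

Lemma cintegral_affine (c d : R) f : c != 0 -> cmeasurable f ->
  cintegral setT f = `|c|%:C * cintegral setT (fun s => f (c * s + d)).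
Proof.
move=> c0 [f1 f2]; apply: complex_eq; rewrite /cintegral ?ReM ?ImM/= mul0r ?subr0 ?addr0.
- exact: Rintegral_affine.
- exact: Rintegral_affine.
Qed.

Definition cconv f g (t : R) : R[i] := cintegral setT (fun s => f (t - s) * g s).

Lemma Rintegral_conv (u v : R -> R) : mu.-integrable setT (EFin \o u) ->
  mu.-integrable setT (EFin \o v) ->
  \int[mu]_t conv u v t = (\int[mu]_t u t) * (\int[mu]_t v t).
Proof.
move=> iu iv; have mu_ := integrable_measurable iu; have mv := integrable_measurable iv.
have fin := econv_lty_ae (measurable_nabs mu_) (measurable_nabs mv)
  (nabs_ge0 u) (nabs_ge0 v) (integrable_nabs iu) (integrable_nabs iv).
have := @conv_pairing R (fun=> 1) u v (@measurable_cst _ _ _ _ _ _) mu_ mv.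
rewrite /=.
have -> : \int[mu]_t (1 * conv u v t) = \int[mu]_t conv u v t.
  by apply: eq_Rintegral => t _; rewrite mul1r.
move=> ->; last first.
  apply: le_lt_trans fin; rewrite le_eqVlt; apply/orP; left; apply/eqP.
  by apply: eq_integral => t _; rewrite /nabs/= normr1 mul1e.
have E s : \int[mu]_t (u (t - s) * 1) = \int[mu]_t u t.
  rewrite [RHS](@Rintegral_affine R 1 (- s))// ?oner_eq0// normr1 mul1r.
  by apply: eq_Rintegral => t _; rewrite mulr1 mul1r.
under eq_Rintegral do rewrite E.
by rewrite RintegralZr// mulrC.
Qed.

Let nc f (t : R) : R := normc (f t).

Lemma measurable_normc f : cmeasurable f -> measurable_fun setT (nc f).
Proof.
move=> [f1 f2]; have -> : nc f = fun t => Num.sqrt (Re (f t) ^+ 2 + Im (f t) ^+ 2).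
  by apply/funext => t; rewrite /nc; case: (f t).
have ms : measurable_fun setT (@Num.sqrt R).
  by apply: continuous_measurable_fun; exact: sqrt_continuous.
by apply: (measurableT_comp ms); apply: measurable_funD; exact: measurable_funX.
Qed.

Lemma cconv_integrable_at f g t : cmeasurable f -> cmeasurable g ->
  (econv (nabs (nc f)) (nabs (nc g)) t < +oo)%E ->
  cintegrable setT (fun s => f (t - s) * g s).
Proof.
move=> mf mg fin; have := conv_integrable_at (measurable_normc mf) (measurable_normc mg) fin.
apply: cintegrable_dominated.
  by apply: cmeasurableM => //; exact: (cmeasurable_comp mf (measurable_shift t)).
by move=> s; rewrite normcM.
Qed.

Lemma cconv_ReIm f g t : cmeasurable f -> cmeasurable g ->
  (econv (nabs (nc f)) (nabs (nc g)) t < +oo)%E ->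
  Re (cconv f g t) = conv (@complex.Re R \o f) (@complex.Re R \o g) t - conv (@complex.Im R \o f) (@complex.Im R \o g) t /\
  Im (cconv f g t) = conv (@complex.Re R \o f) (@complex.Im R \o g) t + conv (@complex.Im R \o f) (@complex.Re R \o g) t.
Proof.
move=> mf mg fin; have dom := conv_integrable_at (measurable_normc mf) (measurable_normc mg) fin.
have [[f1 f2] [g1 g2]] := (mf, mg).
have K (u v : R -> R) : measurable_fun setT u -> measurable_fun setT v ->
    (forall s, `|u s| <= normc (f s)) -> (forall s, `|v s| <= normc (g s)) ->
    mu.-integrable setT (EFin \o (fun s => u (t - s) * v s)).
  move=> mu_ mv uf vg; apply: (integrable_dominated _ _ dom).
    by apply: measurable_funM => //; exact: (measurableT_comp mu_ (measurable_shift t)).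
  by move=> s; rewrite normrM ler_pM.
split; rewrite /cconv /cintegral/= /conv.
- rewrite -RintegralB//; last 2 first.
  + by apply: K => // s; exact: normc_Re.
  + by apply: K => // s; exact: normc_Im.
  by apply: eq_Rintegral => s _; rewrite ReM.
- rewrite -RintegralD//; last 2 first.
  + by apply: K => // s; first [exact: normc_Re|exact: normc_Im].
  + by apply: K => // s; first [exact: normc_Re|exact: normc_Im].
  by apply: eq_Rintegral => s _; rewrite ImM.
Qed.

Lemma cintegral_conv f g : cintegrable setT f -> cintegrable setT g ->
  (forall t, econv (nabs (nc f)) (nabs (nc g)) t < +oo)%E ->
  cintegral setT (cconv f g) = cintegral setT f * cintegral setT g.
Proof.
move=> fi gi fin; have mf := cintegrable_measurable fi; have mg := cintegrable_measurable gi.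
have E t := cconv_ReIm mf mg (fin t).
have [[f1 f2] [g1 g2]] := (fi, gi).
apply: complex_eq; rewrite ?ReM ?ImM.
- transitivity (\int[mu]_t (conv (@complex.Re R \o f) (@complex.Re R \o g) t -
    conv (@complex.Im R \o f) (@complex.Im R \o g) t)).
    by apply: eq_Rintegral => t _; exact: (E t).1.
  by rewrite RintegralB ?Rintegral_conv//; exact: integrable_conv.
- transitivity (\int[mu]_t (conv (@complex.Re R \o f) (@complex.Im R \o g) t +
    conv (@complex.Im R \o f) (@complex.Re R \o g) t)).
    by apply: eq_Rintegral => t _; exact: (E t).2.
  by rewrite RintegralD ?Rintegral_conv//; exact: integrable_conv.
Qed.

Lemma cintegral_dominated_cvg (F : nat -> R -> R[i]) f (v : R -> R) :
  (forall n, cmeasurable (F n)) ->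
  (forall t, Re (F n t) @[n --> \oo] --> Re (f t)) ->
  (forall t, Im (F n t) @[n --> \oo] --> Im (f t)) ->
  cmeasurable f ->
  (forall n t, normc (F n t) <= v t) -> mu.-integrable setT (EFin \o v) ->
  (Re (cintegral setT (F n)) @[n --> \oo] --> Re (cintegral setT f)) /\
  (Im (cintegral setT (F n)) @[n --> \oo] --> Im (cintegral setT f)).
Proof.
move=> mF cR cI mf Fv iv.
have K (U : nat -> R -> R) (u : R -> R) : (forall n, measurable_fun setT (U n)) ->
    measurable_fun setT u ->
    (forall n t, `|U n t| <= v t) -> (forall t, U n t @[n --> \oo] --> u t) ->
    \int[mu]_t U n t @[n --> \oo] --> \int[mu]_t u t.
  move=> mU mu_ Uv cU.
  have uv t : `|u t| <= v t.
    have : `|U n t| @[n --> \oo] --> `|u t| by apply: cvg_norm; exact: cU.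
    by move=> /cvg_lim <- //; apply: limr_le; [apply/cvg_ex; exists `|u t|; apply: cvg_norm; exact: cU|exact: nearW].
  have iu : mu.-integrable setT (EFin \o u) := integrable_dominated mu_ uv iv.
  have iU n : mu.-integrable setT (EFin \o U n) := integrable_dominated (mU n) (Uv n) iv.
  have : (\int[mu]_t (U n t)%:E)%E @[n --> \oo] --> (\int[mu]_t u t)%:E.
    rewrite /Rintegral fineK; last exact: integrable_fin_num.
    apply: (@dominated_cvg _ _ _ mu _ measurableT _ _ (EFin \o v)) => //.
    - by move=> n; apply/measurable_EFinP; exact: mU.
    - by move=> t _; apply: cvg_EFin; [exact: nearW|exact: cU].
    - by move=> n t _; rewrite lee_fin.
  exact: fine_cvg.
split; apply: (K (fun n t => _ (F n t)) (fun t => _ (f t))) => //.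
- by move=> n; case: (mF n).
- by case: mf.
- by move=> n t; exact: le_trans (normc_Re _) (Fv n t).
- by move=> n; case: (mF n).
- by case: mf.
- by move=> n t; exact: le_trans (normc_Im _) (Fv n t).
Qed.

End complex_integrals.

Section gamma_beta.
Local Open Scope complex_scope.
Context {R : realType}.
Notation mu := (@lebesgue_measure R).
Import ComplexField.Normc.
Implicit Types (z w : R[i]) (r s t : R).
Local Notation Re := complex.Re.
Local Notation Im := complex.Im.

(** The exponent is z - 1, so that convolution adds the parameters, up to a beta factor
    ([cconv_cpw]). *)
Definition cpw z r : R[i] := if 0 < r then cpow r (z - 1) else 0.

Lemma Re_sub1 z : Re (z - 1) = Re z - 1.
Proof. by case: z. Qed.

Lemma normc_cpw z r : normc (cpw z r) = pw `]0, +oo[ (Re z - 1) r.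
Proof.
rewrite /cpw /pw in_itv/= andbT; case: ifPn => r0; last exact: normc0.
by rewrite normc_cpow ?ltW// Re_sub1.
Qed.

Lemma cmeasurable_cpw z : cmeasurable (cpw z).
Proof.
have [m1 m2] := measurable_cpow (z - 1).
split.
- have -> : (fun t => Re (cpw z t)) =
      fun t => if t \in `]0%R, +oo[ then Re (cpow t (z - 1)) else 0.
    by apply/funext => t; rewrite /cpw in_itv/= andbT; case: ifP.
  by apply: measurable_if_itv; exact: measurable_funTS.
- have -> : (fun t => Im (cpw z t)) =
      fun t => if t \in `]0%R, +oo[ then Im (cpow t (z - 1)) else 0.
    by apply/funext => t; rewrite /cpw in_itv/= andbT; case: ifP.
  by apply: measurable_if_itv; exact: measurable_funTS.
Qed.

Lemma econv_cpw_lty z w t : 0 < Re z -> 0 < Re w ->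
  (econv (nabs (fun t => normc (cpw z t))) (nabs (fun t => normc (cpw w t))) t < +oo)%E.
Proof.
move=> z0 w0.
have E v : nabs (fun t => normc (cpw v t)) = EFin \o pw `]0%R, +oo[ (Re v - 1).
  by apply/funext => s; rewrite /nabs normc_cpw ger0_norm ?pw_ge0.
rewrite !E; have [t0|t0] := leP t 0; first by rewrite econv_pw_neg.
have z1 : -1 < Re z - 1 by lra.
have w1 : -1 < Re w - 1 by lra.
rewrite econv_pw_scale// lte_mul_pinfty//; last exact: econv_pw_lty.
by rewrite lee_fin powR_ge0.
Qed.

(** Euler's beta function: at t = 1 the convolution is the integral of (1 - s)^(z - 1) s^(w - 1)
    over []0, 1[]. *)
Definition cbeta z w : R[i] := cconv (cpw z) (cpw w) 1.

Lemma cconv_cpw z w t : 0 < Re z -> 0 < Re w ->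
  cconv (cpw z) (cpw w) t = cpw (z + w) t * cbeta z w.
Proof.
move=> z0 w0; have [t0|t0] := ltP 0 t; last first.
  rewrite [cpw (z + w) t]/cpw ltNge t0/= mul0r -[RHS]cintegral0 /cconv; congr cintegral.
  apply/funext => s; rewrite /cpw; case: ifPn => ts; last by rewrite mul0r.
  by rewrite ifF ?mulr0//; apply/negbTE; rewrite -leNgt; lra.
rewrite [cpw (z + w) t]/cpw t0.
have m1 : cmeasurable (fun s => cpw z (t - s) * cpw w s).
  apply: cmeasurableM; last exact: cmeasurable_cpw.
  exact: (cmeasurable_comp (cmeasurable_cpw z) (measurable_shift t)).
have tn0 : t != 0 by rewrite gt_eqF.
rewrite /cconv (cintegral_affine 0 tn0 m1) (gtr0_norm t0).
have E s : cpw z (t - (t * s + 0)) * cpw w (t * s + 0) =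
    (cpow t (z - 1) * cpow t (w - 1)) * (cpw z (1 - s) * cpw w s).
  rewrite addr0; have -> : t - t * s = t * (1 - s) by ring.
  rewrite /cpw !pmulr_rgt0//; case: ifPn => s1; last by rewrite !mul0r mulr0.
  case: ifPn => s0; last by rewrite !mulr0.
  by rewrite !cpowM//; ring.
have -> : (fun s => cpw z (t - (t * s + 0)) * cpw w (t * s + 0)) =
    fun s => (cpow t (z - 1) * cpow t (w - 1)) * (cpw z (1 - s) * cpw w s).
  by apply/funext => s; exact: E.
rewrite cintegralZ; last first.
  apply: cconv_integrable_at; [exact: cmeasurable_cpw|exact: cmeasurable_cpw|].
  exact: econv_cpw_lty.
rewrite mulrA; congr (_ * _).
have -> : t%:C = cpow t 1 by rewrite -[1 in RHS]/(1%:C) cpow_real powRr1 ?ltW.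
by rewrite -!cpowD//; congr cpow; ring.
Qed.

Definition gammaf z t : R[i] := cpw z t * (expR (- t))%:C.

Lemma cmeasurable_gammaf z : cmeasurable (gammaf z).
Proof.
apply: cmeasurableM; first exact: cmeasurable_cpw.
apply: cmeasurable_real; apply: measurableT_comp => //.
Qed.

Lemma normc_gammaf z t : normc (gammaf z t) = pw `]0, +oo[ (Re z - 1) t * expR (- t).
Proof. by rewrite normcM normc_cpw normc_real ger0_norm ?expR_ge0. Qed.

(** Split exp(-t) into two factors exp(-t/2). One absorbs the power, by the Taylor bound t^(m+1) <=
    2^(m+1) (m+1)! exp(t/2); the other is twice the exponential density of rate 1/2. *)
Lemma powR_expR_bound (x : R) : exists2 C : R, 0 <= C &
  forall t, 1 <= t -> t `^ x * expR (- t) <= C * exponential_pdf 2^-1 t.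
Proof.
pose m := Num.bound `|x|; pose C := (2 ^+ m.+1 * (m.+1)`!%:R : R).
have C0 : 0 <= C by rewrite mulr_ge0// exprn_ge0.
exists (C * 2); first by rewrite mulr_ge0.
move=> t t1; have t0 : 0 <= t by rewrite (le_trans ler01).
rewrite exponential_pdfE// mulrA -(mulrA C) divff// mulr1.
have -> : expR (- t) = expR (- 2^-1 * t) * expR (- 2^-1 * t).
  by rewrite -expRD; congr expR; lra.
rewrite mulrA ler_wpM2r ?expR_ge0//.
have h1 : t `^ x <= t ^+ m.+1.
  rewrite -powR_mulrn// ler_powR// (le_trans (ler_norm x))//.
  apply: ltW; apply: lt_trans (archi_boundP (normr_ge0 x)) _.
  by rewrite ltr_nat.
have h2 : t ^+ m.+1 <= C * expR (t / 2).
  have t2 : 0 <= t / 2 by rewrite divr_ge0.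
  have := expR_ge1Dxn m t2; rewrite expr_div_n => h.
  have {h} : t ^+ m.+1 / 2 ^+ m.+1 / (m.+1)`!%:R <= expR (t / 2) by lra.
  rewrite -mulrA -invfM ler_pdivrMr; last by rewrite mulr_gt0 ?exprn_gt0// ltr0n fact_gt0.
  by rewrite mulrC.
apply: (@le_trans _ _ (C * expR (t / 2) * expR (- 2^-1 * t))).
  by rewrite ler_wpM2r ?expR_ge0// (le_trans h1).
by rewrite -mulrA -expRD (_ : t / 2 + _ = 0) ?expR0 ?mulr1//; lra.
Qed.

Lemma integrable_gammaf z : 0 < Re z -> cintegrable setT (gammaf z).
Proof.
move=> z0; have [C C0 HC] := powR_expR_bound (Re z - 1).
apply: (@cintegrable_dominated _ _
  (fun t => pw `]0%R, 1%R] (Re z - 1) t + C * exponential_pdf 2^-1 t)).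
- exact: cmeasurable_gammaf.
- move=> t; rewrite normc_gammaf /pw !in_itv/= andbT.
  have e0 : 0 <= C * exponential_pdf 2^-1 t by rewrite mulr_ge0// exponential_pdf_ge0.
  case: ifPn => t0 /=; last by rewrite mul0r add0r.
  case: ifPn => t1.
    rewrite -[leLHS]addr0 lerD// ler_piMr ?powR_ge0//.
    by rewrite -expR0 ler_expR; lra.
  by rewrite add0r HC// ltW// ltNge.
- rewrite (_ : _ \o _ = ((EFin \o pw `]0%R, 1%R] (Re z - 1)) \+
      (fun t => C%:E * (exponential_pdf 2^-1 t)%:E))%E)//.
  apply: integrableD => //; first by apply: pw_integrable; lra.
  by apply: integrableZl => //; exact: integrable_exponential_pdf.
Qed.

Lemma cgammaE z : cgamma z = cintegral setT (gammaf z).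
Proof.
rewrite /cgamma /cintegral; congr (_ +i* _); rewrite Rintegral_mkcond restrict_if;
  apply: eq_Rintegral => t _; rewrite /gammaf /cpw in_itv/= andbT;
  by case: ifP => // _; rewrite mul0r.
Qed.

(** The left-hand side is the integral of the convolution of the two Gamma integrands. There exp(-(t
    - s)) exp(-s) = exp(-t) leaves the convolution integral, and the rest is the convolution of two
    powers. *)
Lemma cgammaM z w : 0 < Re z -> 0 < Re w ->
  cgamma z * cgamma w = cbeta z w * cgamma (z + w).
Proof.
move=> z0 w0; rewrite !cgammaE.
have zw0 : 0 < Re (z + w) by rewrite ReD addr_gt0.
have fin t : (econv (nabs (fun t => normc (gammaf z t))) (nabs (fun t => normc (gammaf w t))) t < +oo)%E.
  apply: le_lt_trans (econv_cpw_lty t z0 w0).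
  apply: ge0_le_integral => //.
  - by move=> s _; rewrite mule_ge0// nabs_ge0.
  - apply: emeasurable_funM; last by apply: measurable_nabs; exact: (measurable_normc (cmeasurable_gammaf _)).
    by apply: emeasurable_reflect; apply: measurable_nabs; exact: (measurable_normc (cmeasurable_gammaf _)).
  - apply: emeasurable_funM; last by apply: measurable_nabs; exact: (measurable_normc (cmeasurable_cpw _)).
    by apply: emeasurable_reflect; apply: measurable_nabs; exact: (measurable_normc (cmeasurable_cpw _)).
  - move=> s _; rewrite /nabs /gammaf !normcM !normc_real -!EFinM lee_fin !ger0_norm ?mulr_ge0 ?expR_ge0 ?normc_ge0//.
    rewrite /cpw; case: ifPn => ts; last by rewrite normc0 !mul0r.
    case: ifPn => s0; last by rewrite normc0 mul0r !mulr0.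
    by rewrite ler_pM ?mulr_ge0 ?normc_ge0 ?expR_ge0// ler_piMr ?normc_ge0// -expR0 ler_expR; lra.
rewrite -(cintegral_conv (integrable_gammaf z0) (integrable_gammaf w0) fin).
rewrite -cintegralZ; last exact: integrable_gammaf.
congr cintegral; apply/funext => t.
rewrite /gammaf mulrA (mulrC (cbeta z w)) -cconv_cpw// mulrC /cconv -cintegralZ; last first.
  apply: cconv_integrable_at; [exact: cmeasurable_cpw|exact: cmeasurable_cpw|].
  exact: econv_cpw_lty.
congr cintegral; apply/funext => s.
have -> : (expR (- t))%:C = (expR (- (t - s)))%:C * (expR (- s))%:C :> R[i].
  by rewrite -rmorphM/= -expRD; congr ((expR _)%:C); ring.
by ring.
Qed.

End gamma_beta.

(** * Gamma has no zero in the right half-plane *)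

Section gamma_nonzero.
Local Open Scope complex_scope.
Context {R : realType}.
Notation mu := (@lebesgue_measure R).
Import ComplexField.Normc.
Implicit Types (z w : R[i]) (r s t : R).
Local Notation Re := complex.Re.
Local Notation Im := complex.Im.

Lemma continuous_powR (a x : R) : 0 < x -> {for x, continuous (fun r : R => r `^ a)}.
Proof.
move=> x0; apply: differentiable_continuous; apply/derivable1_diffP.
by apply: derivable_powR; rewrite in_itv/= x0.
Qed.

Lemma integrableBR (u v : R -> R) : mu.-integrable setT (EFin \o u) ->
  mu.-integrable setT (EFin \o v) -> mu.-integrable setT (EFin \o (fun x => u x - v x)).
Proof.
move=> iu iv; rewrite (_ : _ \o _ = (EFin \o u) \- (EFin \o v))%E//; exact: integrableB.
Qed.

Lemma integrableDR (u v : R -> R) : mu.-integrable setT (EFin \o u) ->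
  mu.-integrable setT (EFin \o v) -> mu.-integrable setT (EFin \o (fun x => u x + v x)).
Proof.
move=> iu iv; rewrite (_ : _ \o _ = (EFin \o u) \+ (EFin \o v))%E//; exact: integrableD.
Qed.

Lemma integrable_normc (f : R -> R[i]) : cintegrable setT f ->
  mu.-integrable setT (EFin \o (fun t => normc (f t))).
Proof.
move=> fi; have mf := cintegrable_measurable fi; have [f1 f2] := fi.
apply: (integrable_dominated (measurable_normc mf)
  (v := fun t => `|Re (f t)| + `|Im (f t)|)).
  by move=> t; rewrite ger0_norm ?normc_ge0//; exact: normc_le.
apply: integrableDR; first exact: (integrable_norm f1).
exact: (integrable_norm f2).
Qed.

Lemma integrable_if_itv (f : R -> R) (i : interval R) :
  mu.-integrable [set` i] (EFin \o f) ->
  mu.-integrable setT (EFin \o (fun r => if r \in i then f r else 0)).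
Proof.
move=> fi; rewrite -restrict_if.
have [+ _] := @integrable_mkcond _ _ R mu [set` i] (EFin \o f) (measurable_itv i).
move=> /(_ fi).
by apply: eq_integrable => // r _; rewrite restrict_EFin.
Qed.

(** [cpw 1] is the indicator of the positive reals, so the second factor truncates at c. *)
Lemma integrable_cpw_trunc z c : 0 < Re z ->
  cintegrable setT (fun v => cpw z v * cpw 1 (c - v)).
Proof.
move=> z0; have c1 : 0 < Re (1 : R[i]) by exact: ltr01.
have := cconv_integrable_at (cmeasurable_cpw 1) (cmeasurable_cpw z) (econv_cpw_lty c c1 z0).
by under eq_fun do rewrite mulrC.
Qed.

Lemma cconv_cpw1 z c : 0 < Re z ->
  cconv (cpw z) (cpw 1) c = cintegral setT (fun v => cpw z v * cpw 1 (c - v)).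
Proof.
move=> z0; have n1 : (-1 : R) != 0 by rewrite oppr_eq0 oner_eq0.
rewrite /cconv (@cintegral_affine _ (-1) c _ n1); last first.
- apply: cmeasurableM; last exact: cmeasurable_cpw.
  exact: (cmeasurable_comp (cmeasurable_cpw z) (measurable_shift c)).
rewrite normrN1 mul1r; congr cintegral; apply/funext => s.
by congr (cpw z _ * cpw 1 _); ring.
Qed.

Lemma cpw1 r : cpw 1 r = (0 < r)%R%:R.
Proof. by rewrite /cpw; case: ifPn => // r0; rewrite subrr cpow0. Qed.

(** If it were 0, v^(z-1) would have integral 0 over ]0, c[ for every c, hence over [1, 1 + d[.
    There its real part is at least 1/2 for small d, since it is 1 at v = 1. *)
Lemma cbeta_one_neq0 z : 0 < Re z -> cbeta z 1 != 0.
Proof.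
move=> z0; apply/eqP => b0.
have one : 0 < Re (1 : R[i]) by exact: ltr01.
have I0 c : \int[mu]_v Re (cpw z v * cpw 1 (c - v)) = 0.
  rewrite -[LHS]/(Re (cintegral setT (fun v => cpw z v * cpw 1 (c - v)))).
  by rewrite -cconv_cpw1// cconv_cpw// b0 mulr0.
pose h (v : R) := Re (cpow v (z - 1)).
have hE v : h v = v `^ (Re z - 1) * cos (Im (z - 1) * ln v).
  by rewrite /h /cpow ReM/= mul0r subr0 Re_sub1.
have ch : {for 1, continuous h}.
  have -> : h = fun v => v `^ (Re z - 1) * cos (Im (z - 1) * ln v) by apply/funext.
  apply: cvgM.
    exact: continuous_powR (ltr01 : (0 : R) < 1).
  apply: continuous_comp; last exact: continuous_cos.
  by apply: cvgM; [exact: cvg_cst|apply: continuous_ln; exact: ltr01].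
have h1 : h 1 = 1 by rewrite /h cpow1.
have [d d0 hd] : exists2 d, 0 < d & forall v, 1 <= v -> v < 1 + d -> 2^-1 <= h v.
  have half0 : (0 : R) < 2^-1 by rewrite invr_gt0 ltr0n.
  move/cvgrPdist_lt : ch => /(_ _ half0); rewrite h1 => -[d /= d0 hd]; exists d => // v v1 vd.
  have : `|1 - h v| < 2^-1.
    by apply: hd; rewrite /= distrC ger0_norm ?subr_ge0//; lra.
  by rewrite ltr_distlC => /andP[+ _]; lra.
have i1 c := (integrable_cpw_trunc c z0).1.
have E : \int[mu]_v (Re (cpw z v * cpw 1 (1 + d - v)) - Re (cpw z v * cpw 1 (1 - v))) = 0.
  by rewrite (RintegralB measurableT (i1 (1 + d)) (i1 1)) !I0 subrr.
have : d / 2 <= 0.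
  rewrite -{}E -[d / 2](_ : \int[mu]_v (if v \in `[1, 1 + d[ then 2^-1 else 0) = _); last first.
    have -> : \int[mu]_v (if v \in `[1, 1 + d[ then 2^-1 else 0) = \int[mu]_(v in `[1, 1 + d[) 2^-1.
      by rewrite [RHS]Rintegral_mkcond restrict_if.
    by rewrite Rintegral_cst//= lebesgue_measure_itv/= lte_fin ltrDl d0 -EFinD/= addrAC subrr add0r mulrC.
  apply: le_Rintegral => //.
  - apply: (@integrable_if_itv (fun=> 2^-1)).
    apply: measurable_bounded_integrable => //; last exact: bounded_cst.
    by rewrite /= lebesgue_measure_itv/=; case: ifP => _; rewrite ltry.
  - by apply: integrableBR; exact: i1.
  - move=> v _; rewrite !cpw1 in_itv/= !subr_gt0.
    have [v1|v1] := ltP v 1.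
      by rewrite (lt_trans v1) ?ltrDl//= subrr.
    have [vd|vd] := ltP v (1 + d); last by rewrite !mulr0 subrr.
    by rewrite mulr1 mulr0 subr0 /cpw (lt_le_trans ltr01 v1) hd.
lra.
Qed.

Lemma cgamma1 : cgamma (1 : R[i]) = 1.
Proof.
have E (s : R) : s \in `]0, +oo[%classic -> cpow s (1 - 1) * (expR (- s))%:C = (expR (- s))%:C.
  by move=> _; rewrite subrr cpow0 mul1r.
have -> : cgamma (1 : R[i]) = cintegral `]0, +oo[ (fun s : R => (expR (- s))%:C).
  by rewrite /cgamma /cintegral; congr (_ +i* _); apply: eq_Rintegral => s /E ->.
apply: complex_eq; rewrite /cintegral/=; last by rewrite Rintegral_cst//= mul0r.
have := integral_exponential_pdf (ltr01 : (0 : R) < 1).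
have F (s : R) : exponential_pdf 1 s = if s \in `[0, +oo[ then expR (- s) else 0.
  rewrite in_itv/= andbT; case: leP => s0; last by rewrite lt0_exponential_pdf.
  by rewrite exponential_pdfE// mul1r mulN1r.
under eq_integral do rewrite F.
rewrite integral_if_itv -integral_itv_obnd_cbnd//; last first.
  by apply/measurable_EFinP; apply: measurable_funTS; apply: measurableT_comp.
by rewrite /Rintegral => ->.
Qed.

(** By the beta relation, Gamma(z/2)^2 is a multiple of Gamma(z). *)
Lemma cgamma_half z : 0 < Re z -> cgamma z = 0 -> cgamma (z * (2^-1)%:C) = 0.
Proof.
move=> z0 gz; have h : 0 < Re (z * (2^-1)%:C).
  by rewrite ReM/= mulr0 subr0 divr_gt0.
have E : z * (2^-1)%:C + z * (2^-1)%:C = z.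
  by rewrite -mulrDr -rmorphD/= (_ : 2^-1 + 2^-1 = 1) ?mulr1//; lra.
have /eqP := cgammaM h h; rewrite E gz mulr0 mulf_eq0.
by case/orP => /eqP.
Qed.

(* A zero z of Gamma propagates to z / 2^n by [cgamma_half], hence to
   1 + z / 2^n, and in the limit to 1, where Gamma is 1. *)
Lemma cgamma_neq0 z : 0 < Re z -> cgamma z != 0.
Proof.
move=> z0; apply/eqP => gz.
pose e n : R := 2^-1 ^+ n.
have e0 n : 0 < e n by rewrite exprn_gt0// invr_gt0.
have e1 n : e n <= 1 by rewrite exprn_ile1 ?invr_ge0// invf_le1// ler1n.
pose zn n := z * (e n)%:C.
have Rzn n : Re (zn n) = Re z * e n by rewrite ReM/= mulr0 subr0.
have Izn n : Im (zn n) = Im z * e n by rewrite ImM/= mulr0 add0r.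
have zn0 n : 0 < Re (zn n) by rewrite Rzn mulr_gt0.
have gn n : cgamma (zn n) = 0.
  elim: n => [|n ih]; first by rewrite /zn /e expr0 mulr1.
  have -> : zn n.+1 = zn n * (2^-1)%:C.
    by rewrite /zn /e exprSr rmorphM/= mulrA.
  exact: cgamma_half.
have one : 0 < Re (1 : R[i]) by exact: ltr01.
have gS n : cgamma (1 + zn n) = 0.
  have := cgammaM (zn0 n) one; rewrite gn mul0r addrC => /esym/eqP.
  by rewrite mulf_eq0 (negbTE (cbeta_one_neq0 (zn0 n))) => /eqP.
have cve : e n @[n --> \oo] --> 0.
  by apply: cvg_expr; rewrite ger0_norm ?invr_ge0// invf_lt1// ltr1n.
have z1 : 0 < Re (1 + z) by rewrite ReD addr_gt0.
(* Majorant for all n: t^(Re z / 2^n) is at most 1 for t < 1 and at most t^(Re z) for t >= 1. *)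
pose v t := normc (gammaf 1 t) + normc (gammaf (1 + z) t).
have iv : mu.-integrable setT (EFin \o v).
  by apply: integrableDR; apply: integrable_normc; exact: integrable_gammaf.
have sub1 w : 1 + w - 1 = w by rewrite addrC addKr.
have gE n t : 0 < t -> gammaf (1 + zn n) t =
    (expR (Re z * e n * ln t) * expR (- t))%:C *
    (cos (Im z * e n * ln t) +i* sin (Im z * e n * ln t)).
  move=> t0; rewrite /gammaf /cpw t0 sub1 /cpow Rzn Izn /powR gt_eqF//.
  by rewrite rmorphM/= -mulrA [X in _ * X = _]mulrC mulrA.
have g1E t : 0 < t -> gammaf 1 t = (expR (- t))%:C.
  by move=> t0; rewrite /gammaf cpw1 t0 mul1r.
have ce (k t : R) : k * e n * ln t @[n --> \oo] --> 0.
  rewrite -[0](_ : k * 0 * ln t = _); last by rewrite mulr0 mul0r.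
  by apply: cvgMl; apply: cvgMr.
have cexp t : expR (Re z * e n * ln t) * expR (- t) @[n --> \oo] --> expR (- t).
  rewrite -[X in _ --> X]mul1r; apply: cvgMl; rewrite -expR0.
  apply: continuous_cvg; [exact: continuous_expR|exact: ce].
have ccos t : cos (Im z * e n * ln t) @[n --> \oo] --> (1 : R).
  by rewrite -cos0; apply: continuous_cvg; [exact: continuous_cos|exact: ce].
have csin t : sin (Im z * e n * ln t) @[n --> \oo] --> (0 : R).
  by rewrite -sin0; apply: continuous_cvg; [exact: continuous_sin|exact: ce].
have [|||cR _] := @cintegral_dominated_cvg R (fun n => gammaf (1 + zn n)) (gammaf 1) v
  (fun n => cmeasurable_gammaf _) _ _ (cmeasurable_gammaf _) _ iv.
- move=> t; have [t0|t0] := ltP 0 t.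
    have -> : (fun n => Re (gammaf (1 + zn n) t)) =
        fun n => expR (Re z * e n * ln t) * expR (- t) * cos (Im z * e n * ln t).
      by apply/funext => n; rewrite gE// ReM/= mul0r subr0.
    by rewrite g1E//=; have := cvgM (cexp t) (ccos t); rewrite mulr1; exact.
  have E w : gammaf w t = 0 by rewrite /gammaf /cpw ltNge t0/= mul0r.
  by rewrite (_ : (fun n => _) = fun=> 0) ?E; [exact: cvg_cst|apply/funext => n; rewrite E].
- move=> t; have [t0|t0] := ltP 0 t.
    have -> : (fun n => Im (gammaf (1 + zn n) t)) =
        fun n => expR (Re z * e n * ln t) * expR (- t) * sin (Im z * e n * ln t).
      by apply/funext => n; rewrite gE// ImM/= mul0r addr0.
    by rewrite g1E//=; have := cvgM (cexp t) (csin t); rewrite mulr0; exact.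
  have E w : gammaf w t = 0 by rewrite /gammaf /cpw ltNge t0/= mul0r.
  by rewrite (_ : (fun n => _) = fun=> 0) ?E; [exact: cvg_cst|apply/funext => n; rewrite E].
- move=> n t; rewrite /v !normc_gammaf -mulrDl ler_wpM2r ?expR_ge0//.
  have R1 w : Re (1 + w) - 1 = Re w by rewrite ReD/=; ring.
  rewrite !R1 Rzn subrr /pw in_itv/= andbT; case: ifPn => t0; last by rewrite addr0.
  rewrite powRr0; have [t1|t1] := leP 1 t.
    apply: (@le_trans _ _ (t `^ Re z)); last by rewrite lerDr.
    by rewrite ler_powR// ler_piMr// ltW.
  apply: (@le_trans _ _ 1); last by rewrite lerDl powR_ge0.
  have E1 : (1 : R) `^ (Re z * e n) = 1 by rewrite powR1.
  by rewrite -[leRHS]E1 ge0_ler_powR ?nnegrE ?mulr_ge0 ?ltW.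
have Rg n : Re (cintegral setT (gammaf (1 + zn n))) = 0 by rewrite -cgammaE gS.
have /eqP := oner_neq0 R; apply; rewrite -[1]/(Re (1 : R[i])) -cgamma1 cgammaE.
apply: cvg_unique cR _ => //.
by rewrite (_ : (fun n => _) = fun=> 0); [exact: cvg_cst|apply/funext => n; rewrite Rg].
Qed.

End gamma_nonzero.

(** * The Sonine identity *)

Section power_series.
Local Open Scope complex_scope.
Context {R : realType}.
Import ComplexField.Normc.
Local Notation Re := complex.Re.
Local Notation Im := complex.Im.

Lemma cvg_normc (u : nat -> R[i]) (l : R[i]) :
  (u n : R[i]^o) @[n --> \oo] --> (l : R[i]^o) ->
  forall e : R, 0 < e -> \forall n \near \oo, normc (l - u n) < e.
Proof.
move=> /cvgrPdist_lt ul e e0.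
have e0' : 0 < (e%:C : R[i]) by rewrite ltcR.
by have := ul _ e0'; apply: filterS => n; rewrite /= normrE ltcR.
Qed.

Lemma normc_cvg (u : nat -> R[i]) (l : R[i]) :
  (forall e : R, 0 < e -> \forall n \near \oo, normc (l - u n) < e) ->
  (Re (u n) @[n --> \oo] --> Re l) /\ (Im (u n) @[n --> \oo] --> Im l).
Proof.
move=> H; split; apply/cvgrPdist_lt => e e0; have := H e e0; apply: filterS => n.
- by apply: le_lt_trans; rewrite (le_trans _ (normc_Re _))// raddfB.
- by apply: le_lt_trans; rewrite (le_trans _ (normc_Im _))// raddfB.
Qed.

Lemma geometric_le (q : R) n : 0 <= q -> q < 1 -> \sum_(k < n) q ^+ k <= (1 - q)^-1.
Proof.
move=> q0 q1; have q1' : 0 < 1 - q by rewrite subr_gt0.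
rewrite -[leRHS]mul1r ler_pdivlMr//.
have -> : (\sum_(k < n) q ^+ k) * (1 - q) = 1 - q ^+ n.
  elim: n => [|n ih]; first by rewrite big_ord0 mul0r expr0 subrr.
  by rewrite big_ord_recr/= mulrDl ih exprSr; ring.
by rewrite gerBl exprn_ge0.
Qed.

(** Convergence at a point z between r and rho bounds the terms there, and the ratio r / z < 1 gives
    a geometric majorant at r. *)
Lemma analytic_summable (rho r : R) (c : nat -> R[i]) (A : R[i] -> R[i]) :
  analytic_on_disc rho c A -> 0 <= r -> r < rho ->
  exists M, forall n, \sum_(k < n) normc (c k) * r ^+ k <= M.
Proof.
move=> an r0 rrho; pose z : R := (r + rho) / 2.
have z0 : 0 < z by rewrite /z; lra.
have rz : r < z by rewrite /z; lra.
have /an/cvg_normc/(_ _ ltr01) [N _ HN] : `|z%:C| < rho%:C.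
  by rewrite normrE normc_real ltcR gtr0_norm// /z; lra.
pose S n := \sum_(0 <= k < n) c k * z%:C ^+ k.
have term k : normc (c k) * z ^+ k = normc (c k * z%:C ^+ k).
  by rewrite normcM normc_prod normc_real gtr0_norm.
(* From index N on a term is the difference of two partial sums within 1 of the limit, hence the 2;
   the sum takes care of the earlier terms. *)
pose K := 2 + \sum_(k < N) normc (c k) * z ^+ k.
have tK k : normc (c k) * z ^+ k <= K.
  have S0 : 0 <= \sum_(k < N) normc (c k) * z ^+ k.
    by apply: sumr_ge0 => i _; rewrite mulr_ge0 ?normc_ge0 ?exprn_ge0// ltW.
  have [kN|Nk] := ltnP k N.
    rewrite /K (bigD1 (Ordinal kN))//= addrCA lerDl addr_ge0//.
    by apply: sumr_ge0 => i _; rewrite mulr_ge0 ?normc_ge0 ?exprn_ge0// ltW.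
  rewrite (@le_trans _ _ 2) ?lerDl// term.
  have -> : c k * z%:C ^+ k = (A z%:C - S k) - (A z%:C - S k.+1).
    by rewrite /S big_nat_recr//=; ring.
  apply: le_trans (le_normcD _ _) _; rewrite normcN.
  have /= h1 := HN k Nk; have /= h2 := HN k.+1 (leqW Nk).
  by rewrite /S; lra.
pose q := r / z.
have q0 : 0 <= q by rewrite divr_ge0// ltW.
have q1 : q < 1 by rewrite ltr_pdivrMr// mul1r.
have K0 : 0 <= K := le_trans (mulr_ge0 (normc_ge0 _) (exprn_ge0 0 (ltW z0))) (tK 0%N).
exists (K * (1 - q)^-1) => n.
apply: (@le_trans _ _ (K * \sum_(k < n) q ^+ k)); last by rewrite ler_wpM2l// geometric_le.
rewrite mulr_sumr; apply: ler_sum => k _.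
have -> : r = z * q by rewrite /q mulrCA divff ?mulr1// gt_eqF.
by rewrite exprMn mulrA ler_wpM2r ?exprn_ge0.
Qed.

Lemma summable_tail (u : nat -> R) M : (forall k, 0 <= u k) ->
  (forall n, \sum_(k < n) u k <= M) -> forall e, 0 < e ->
  exists K, forall n, \sum_(K <= m < n) u m <= e.
Proof.
move=> u0 uM e e0; pose S n := \sum_(k < n) u k.
have Snd : nondecreasing_seq S.
  apply/nondecreasing_seqP => n; rewrite /S big_ord_recr/= lerDl//.
have Scv : cvgn S.
  by apply: nondecreasing_is_cvgn => //; exists M => _ [n _ <-]; exact: uM.
have := Scv; move=> /cvgrPdist_lt /(_ _ e0) [K _ HK].
exists K => n; have [nK|Kn] := leqP n K; first by rewrite big_geq// ltW.
have Sn : S n <= limn S by exact: nondecreasing_cvgn_le.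
have := HK K (leqnn _); rewrite /= => /(le_lt_trans (ler_norm _)) h.
have : S n = S K + \sum_(K <= m < n) u m.
  by rewrite /S -(big_mkord xpredT) -(big_mkord xpredT u) (big_cat_nat (leq0n K) (ltnW Kn)).
lra.
Qed.

(** This is the gap between the square and the triangular partial sums of a Cauchy product. In each
    term either k is large, and the tail of u is small, or n - k is large, and the tail of v is
    small. *)
Lemma triangle_defect (u v : nat -> R) M : (forall k, 0 <= u k) -> (forall k, 0 <= v k) ->
  (forall n, \sum_(k < n) u k <= M) -> (forall n, \sum_(k < n) v k <= M) ->
  forall e, 0 < e -> \forall n \near \oo,
    \sum_(k < n) (u k * \sum_(n - k <= m < n) v m) <= e.
Proof.
move=> u0 v0 uM vM e e0.
have M0 : 0 <= M by have := uM 0%N; rewrite big_ord0.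
(* Each of the two ranges contributes at most M d <= e / 2; M + 1 avoids a division by 0. *)
pose d := e / (2 * (M + 1)).
have d0 : 0 < d by rewrite divr_gt0// mulr_gt0//; lra.
have [K1 H1] := summable_tail u0 uM d0; have [K2 H2] := summable_tail v0 vM d0.
exists (K1 + K2)%N => // n /= Kn.
have K1n : (K1 <= n)%N by rewrite (leq_trans _ Kn)// leq_addr.
rewrite -(big_mkord xpredT (fun k => u k * \sum_(n - k <= m < n) v m)).
rewrite (big_cat_nat (leq0n K1) K1n)/=.
have A1 : \sum_(0 <= k < K1) u k * \sum_(n - k <= m < n) v m <= M * d.
  apply: (@le_trans _ _ (\sum_(0 <= k < K1) u k * d)).
    rewrite !big_nat; apply: ler_sum => k /andP[_ kK1]; apply: ler_wpM2l => //.
    have K2nk : (K2 <= n - k)%N by rewrite leq_subRL ?(leq_trans (ltnW kK1))// (leq_trans _ Kn)// leq_add2r ltnW.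
    apply: le_trans (H2 n); rewrite (big_cat_nat K2nk (leq_subr _ _))/= lerDr.
    by apply: sumr_ge0.
  by rewrite -mulr_suml ler_wpM2r ?(ltW d0)// big_mkord.
have A2 : \sum_(K1 <= k < n) u k * \sum_(n - k <= m < n) v m <= d * M.
  apply: (@le_trans _ _ (\sum_(K1 <= k < n) u k * M)).
    apply: ler_sum => k _; apply: ler_wpM2l => //.
    apply: le_trans (vM n); rewrite -(big_mkord xpredT v).
    rewrite (big_cat_nat (leq0n (n - k)) (leq_subr _ _))/= lerDr.
    by apply: sumr_ge0.
  by rewrite -mulr_suml ler_wpM2r.
have : d * M <= e / 2.
  rewrite /d -mulrA ler_wpM2l ?(ltW e0)// invfM -mulrA -[leRHS]mulr1.
  by rewrite ler_wpM2l ?invr_ge0// mulrC ler_pdivrMr; lra.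
by move: A1 A2; rewrite (mulrC M); lra.
Qed.

Lemma triangle_sum (V : zmodType) (x : nat -> nat -> V) n :
  \sum_(N < n) \sum_(k < N.+1) x k (N - k)%N = \sum_(k < n) \sum_(0 <= m < n - k) x k m.
Proof.
elim: n => [|n ih]; first by rewrite !big_ord0.
rewrite big_ord_recr/= ih [in RHS]big_ord_recr/= [in RHS]subSnn big_nat1.
rewrite [X in _ + X = _]big_ord_recr/= subnn addrA; congr (_ + _).
rewrite -big_split/=; apply: eq_bigr => k _.
by rewrite subSn ?(ltnW (ltn_ord k))// big_nat_recr.
Qed.

End power_series.

Section sonine.
Local Open Scope complex_scope.
Context {R : realType}.
Notation mu := (@lebesgue_measure R).
Import ComplexField.Normc.
Local Notation Re := complex.Re.
Local Notation Im := complex.Im.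

(** The substitution r -> 2 r shows that 1/r has the same integral over []0, 1]] and []0, 1/2]]. If
    it were finite, the integral over []1/2, 1]] would be 0, whereas it is at least 1/2. *)
Lemma pw_integral_pole : (\int[mu]_r (pw `]0%R, 1%R] (-1) r)%:E = +oo%E)%E.
Proof.
have mp i : measurable_fun setT (fun r => (pw i (-1) r)%:E : \bar R).
  by apply/measurable_EFinP; exact: measurable_pw.
have p0 i (r : R) : (0 <= (pw i (-1) r)%:E)%E by rewrite lee_fin pw_ge0.
have half (r : R) : pw `]0, 1] (-1) r = pw `]0, 2^-1] (-1) r + pw `]2^-1, 1] (-1) r.
  rewrite /pw !in_itv/=; have [r0|r0] := ltP 0 r; last first.
    by rewrite /= [2^-1 < r]ltNge (le_trans r0) ?invr_ge0//= addr0.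
  have [r2|r2] := leP r 2^-1; last by rewrite add0r.
  by rewrite (le_trans r2) ?addr0// invf_le1// ler1n.
have scale : (\int[mu]_r (pw `]0%R, 1%R] (-1) r)%:E = \int[mu]_r (pw `]0%R, 2^-1%R] (-1) r)%:E)%E.
  have two0 : (2 : R) != 0 by [].
  rewrite (ge0_integral_affine 0 two0 (mp _))// ger0_norm// -ge0_integralZl//; last first.
    exact: (measurableT_comp (mp _) (measurable_affine _ _)).
  apply: eq_integral => r _; rewrite -EFinM addr0; congr EFin.
  have E2 : (2 * r <= 1) = (r <= 2^-1) by rewrite -[2^-1]mul1r ler_pdivlMr// mulrC.
  rewrite /pw !in_itv/= pmulr_rgt0// E2.
  case: ifPn => [/andP[r0 _]|_]; last by rewrite mulr0.
  have r20 : 0 <= 2 * r by rewrite mulr_ge0// ltW.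
  by rewrite (powR_inv1 r20) (powR_inv1 (ltW r0)) invfM mulrA divff// mul1r.
have low : (2^-1%:E <= \int[mu]_r (pw `]2^-1%R, 1%R] (-1) r)%:E)%E.
  apply: (@le_trans _ _ (\int[mu]_(r in `]2^-1%R, 1%R]) 1%:E)%E).
    rewrite integral_cst//= lebesgue_measure_itv/= lte_fin invf_lt1// ltr1n mul1e -EFinB lee_fin; lra.
  rewrite integral_if_itv; apply: ge0_le_integral => //.
  - by apply/measurable_EFinP; apply: measurable_funTS; exact: measurable_powR.
  - move=> r; rewrite /= in_itv/= => /andP[r2 r1]; have r0 : 0 < r by apply: lt_trans r2.
    by rewrite lee_fin (powR_inv1 (ltW r0)) invf_ge1.
have : (\int[mu]_r (pw `]0%R, 1%R] (-1) r)%:E = \int[mu]_r (pw `]0%R, 1%R] (-1) r)%:E +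
    \int[mu]_r (pw `]2^-1%R, 1%R] (-1) r)%:E)%E.
  rewrite {2}scale -ge0_integralD//; [|exact: mp|exact: mp].
  by apply: eq_integral => r _; rewrite half EFinD.
have : (0 <= \int[mu]_r (pw `]0%R, 1%R] (-1) r)%:E)%E by exact: integral_ge0.
case: (\int[mu]_r (pw `]0%R, 1%R] (-1) r)%:E)%E => [y _|//|//].
case: (\int[mu]_r (pw `]2^-1%R, 1%R] (-1) r)%:E)%E low => [w|//|//].
rewrite lee_fin -EFinD => w2 [] /eqP; rewrite -subr_eq0 opprD addNKr oppr_eq0 => /eqP w0.
by move: w2; rewrite w0 leNgt invr_gt0 ltr0n.
Qed.

(* The divergent integral of [s ^ (-1) * exp (- s)] is [+oo], which [fine] sends to 0. *)
Lemma cgamma0 : cgamma (0 : R[i]) = 0.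
Proof.
have E : forall s : R, s \in `]0, +oo[%classic -> cpow s (0 - 1) * (expR (- s))%:C = (s `^ (-1) * expR (- s))%:C.
  move=> s _; have -> : 0 - 1 = (-1)%:C :> R[i] by rewrite sub0r rmorphN1.
  by rewrite cpow_real -rmorphM.
have -> : cgamma (0 : R[i]) = cintegral `]0, +oo[ (fun s : R => (s `^ (-1) * expR (- s))%:C).
  by rewrite /cgamma /cintegral; congr (_ +i* _); apply: eq_Rintegral => s /E ->.
apply: complex_eq; rewrite /cintegral/=; last by rewrite Rintegral_cst//= mul0r.
rewrite /Rintegral.
suff -> : (\int[mu]_(s in `]0%R, +oo[) (s `^ (-1) * expR (- s))%:E = +oo)%E by [].
apply/eqP; rewrite -leye_eq.
have mexp : measurable_fun setT (fun s : R => expR (- s)) by apply: measurableT_comp.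
apply: (@le_trans _ _ ((expR (- 1))%:E * \int[mu]_r (pw `]0%R, 1%R] (-1) r)%:E)%E).
  by rewrite pw_integral_pole gt0_muley// lte_fin expR_gt0.
rewrite -ge0_integralZl//; last 2 first.
- by apply/measurable_EFinP; exact: measurable_pw.
- by move=> r _; rewrite lee_fin pw_ge0.
rewrite -(integral_if_itv (fun s => s `^ (-1) * expR (- s))).
apply: ge0_le_integral => //.
- by move=> r _; rewrite mule_ge0// lee_fin ?expR_ge0 ?pw_ge0.
- by apply: emeasurable_funM => //; apply/measurable_EFinP; exact: measurable_pw.
- apply/measurable_EFinP; apply: measurable_if_itv; apply: measurable_funTS.
  by apply: measurable_funM => //; exact: measurable_powR.
- move=> r _; rewrite -EFinM lee_fin /pw !in_itv/= andbT.
  have [r0|r0] := ltP 0 r; last by rewrite mulr0.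
  rewrite /=; case: ifPn => r1; last by rewrite mulr0 mulr_ge0 ?powR_ge0 ?expR_ge0.
  by rewrite mulrC ler_wpM2l ?powR_ge0// ler_expR lerN2.
Qed.

Lemma powR_anti (t x y : R) : 0 < t -> t <= 1 -> x <= y -> t `^ y <= t `^ x.
Proof.
move=> t0 t1 xy; have -> : y = x + (y - x) by ring.
rewrite powRD; last by rewrite (gt_eqF t0) implybT.
rewrite ler_piMr ?powR_ge0//.
have E1 : (1 : R) `^ (y - x) = 1 by rewrite powR1.
by rewrite -[leRHS]E1 ge0_ler_powR ?nnegrE ?subr_ge0// ltW.
Qed.

Variables (alpha c rho : R) (beta : R[i]) (A B : R[i] -> R[i]) (a b : nat -> R[i]).
Hypothesis halpha : 0 < alpha < 1.
Hypothesis hbeta : 0 <= Re beta.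
Hypothesis c0 : 0 < c.
Hypothesis hrho : c `^ Re beta < rho.
Hypothesis hA : analytic_on_disc rho a A.
Hypothesis hB : analytic_on_disc rho b B.
Hypothesis hab : gamma_inverse alpha beta a b.

Let q := c `^ Re beta.

Let q0 : 0 <= q. Proof. exact: powR_ge0. Qed.

Let Re_arg (x : R) k : Re (beta * k%:R + x%:C) = Re beta * k%:R + x.
Proof. by rewrite ReD ReM/= -[k%:R : R[i]](rmorph_nat (real_complex R)) /= mulr0 subr0. Qed.

Let Re_arg_ge (x : R) k : x <= Re (beta * k%:R + x%:C).
Proof. by rewrite Re_arg lerDr mulr_ge0. Qed.

(** The coefficient of r^(beta (k + m)) in the convolution of the two kernel series: the orders
    alpha and 1 - alpha add up to 1, so no other power of r remains. *)
Let x k m := a k * b m * cbeta (beta * k%:R + alpha%:C) (beta * m%:R + (1 - alpha)%:C).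

(** For k + m = N the arguments of the two Gamma factors add up to beta N + 1. The beta relation
    thus extracts the common factor Gamma(beta N + 1), which is nonzero and can be cancelled in
    [hab]; for N = 0 it is Gamma(1) = 1. *)
Lemma beta_convolution_coef N :
  \sum_(k < N.+1) x k (N - k)%N = (N == 0%N)%:R.
Proof.
have /andP[a0 a1] := halpha.
have N0 : 0 < Re (beta * N%:R + 1 : R[i]).
  have -> : beta * N%:R + 1 = beta * N%:R + 1%:C by [].
  by apply: lt_le_trans (Re_arg_ge _ _).
have gN : cgamma (beta * N%:R + 1) != 0 by exact: cgamma_neq0.
have K : (\sum_(k < N.+1) x k (N - k)%N) * cgamma (beta * N%:R + 1) = (N == 0%N)%:R.
  rewrite -hab mulr_suml; apply: eq_bigr => k _.
  have kN : (k <= N)%N by rewrite -ltnS.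
  have z0 : 0 < Re (beta * k%:R + alpha%:C) by apply: lt_le_trans (Re_arg_ge _ _).
  have w0 : 0 < Re (beta * (N - k)%:R + (1 - alpha)%:C).
    by apply: lt_le_trans (Re_arg_ge _ _); rewrite subr_gt0.
  rewrite /x /gamma_coef [RHS]mulrACA (cgammaM z0 w0) !mulrA; congr (_ * cgamma _).
  by rewrite natrB// rmorphB rmorph1/=; ring.
case: N N0 gN K => [|N] N0 gN K.
  move: K; rewrite mulr0 add0r => /(congr1 ( *%R^~ (cgamma 1)^-1)).
  by rewrite mulfK cgamma1 ?oner_neq0// eqxx divr1.
by move/eqP : K; rewrite mulf_eq0 (negbTE gN) orbF => /eqP.
Qed.

Let pwc (s : R) := pw `]0, +oo[ (alpha - 1) (1 - s) * pw `]0, +oo[ (- alpha) s.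

Let econv_pw_alpha t : (econv (nabs (pw `]0%R, +oo[ (alpha - 1)))
  (nabs (pw `]0%R, +oo[ (- alpha))) t < +oo)%E.
Proof.
have /andP[a0 a1] := halpha.
have E y : nabs (pw `]0%R, +oo[ y) = EFin \o pw `]0%R, +oo[ y.
  by apply/funext => s; rewrite /nabs ger0_norm ?pw_ge0.
rewrite !E; have [t0|t0] := leP t 0; first by rewrite econv_pw_neg.
rewrite econv_pw_scale// lte_mul_pinfty//; last by apply: econv_pw_lty; lra.
by rewrite lee_fin powR_ge0.
Qed.

Let integrable_pwc : mu.-integrable setT (EFin \o pwc).
Proof. exact: (conv_integrable_at (measurable_pw _ _) (measurable_pw _ _) (econv_pw_alpha 1)). Qed.

Let B0 := 2 * \int[mu]_s pwc s.

Let B0_ge0 : 0 <= B0.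
Proof.
by rewrite mulr_ge0// Rintegral_ge0// => s _; rewrite mulr_ge0 ?pw_ge0.
Qed.

(** The bases s and 1 - s lie in []0, 1[], where raising the real part of an exponent lowers the
    power; the case k = m = 0 therefore bounds all others. *)
Lemma normc_cbeta_le k m :
  normc (cbeta (beta * k%:R + alpha%:C) (beta * m%:R + (1 - alpha)%:C)) <= B0.
Proof.
have /andP[a0 a1] := halpha.
have z0 : 0 < Re (beta * k%:R + alpha%:C) by apply: lt_le_trans (Re_arg_ge _ _).
have w0 : 0 < Re (beta * m%:R + (1 - alpha)%:C).
  by apply: lt_le_trans (Re_arg_ge _ _); rewrite subr_gt0.
apply: normc_cintegral integrable_pwc.
  apply: cconv_integrable_at; [exact: cmeasurable_cpw|exact: cmeasurable_cpw|].
  exact: econv_cpw_lty.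
move=> s; rewrite normcM !normc_cpw /pwc /pw !in_itv/= !andbT.
case: ifPn => s1; last by rewrite !mul0r.
case: ifPn => s0; last by rewrite !mulr0.
have := Re_arg_ge alpha k; have := Re_arg_ge (1 - alpha) m => h1 h2.
by rewrite ler_pM ?powR_ge0// powR_anti//; lra.
Qed.

Section partial_sums.
Variables (nu : R) (d : nat -> R[i]) (D : R[i] -> R[i]).
Hypothesis hD : analytic_on_disc rho d D.

Definition kernel_sum n v : R[i] := \sum_(k < n) d k * cpw (beta * k%:R + nu%:C) v.

(* The cut-off at [c] = b - a does not change the fractional integrals on
   [[a, b]] and makes the kernel integrable on the line. *)
Definition kernel_trunc v : R[i] := if 0 < v <= c then kernelD D nu beta v else 0.

Lemma kernel_sumE n v : 0 < v ->
  kernel_sum n v = (v `^ (nu - 1))%:C * \sum_(0 <= k < n) d k * cpow v beta ^+ k.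
Proof.
move=> v0; rewrite /kernel_sum big_mkord mulr_sumr; apply: eq_bigr => k _.
rewrite /cpw v0 -addrA cpowD// cpow_nat//.
have -> : nu%:C - 1 = (nu - 1)%:C :> R[i] by rewrite rmorphB.
by rewrite cpow_real; ring.
Qed.

Let pow_le v : 0 < v -> v <= c -> v `^ Re beta <= q.
Proof. by move=> v0 vc; rewrite ge0_ler_powR ?nnegrE// ltW. Qed.

Lemma kernel_sum_cvg v : 0 < v -> v <= c -> forall e, 0 < e ->
  \forall n \near \oo, normc (kernel_trunc v - kernel_sum n v) < e.
Proof.
move=> v0 vc e e0; pose p := v `^ (nu - 1).
have p0 : 0 < p by rewrite powR_gt0.
have zr : `|cpow v beta| < rho%:C.
  by rewrite normrE normc_cpow ?ltW// ltcR (le_lt_trans (pow_le v0 vc)).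
have /cvg_normc/(_ (e / p)) H := hD zr.
have /H : 0 < e / p by rewrite divr_gt0.
apply: filterS => n h; rewrite kernel_sumE// /kernel_trunc v0 vc/= /kernelD -mulrBr.
by rewrite normcM normc_real ger0_norm ?(ltW p0)// mulrC -ltr_pdivlMr.
Qed.

(** For 0 < v <= c the modulus of v^beta is at most q < rho, so all partial sums are dominated by
    the absolutely convergent series at q. *)
Lemma kernel_sum_bound : exists2 M, 0 <= M & forall n v, v <= c ->
  normc (kernel_sum n v) <= M * pw `]0, +oo[ (nu - 1) v.
Proof.
have [M HM] := analytic_summable hD q0 hrho.
have M0 : 0 <= M by have := HM 0%N; rewrite big_ord0.
exists M => // n v vc; rewrite /pw in_itv/= andbT; case: ifPn => v0; last first.
  by rewrite mulr0 /kernel_sum big1 ?normc0// => k _; rewrite /cpw (negbTE v0) mulr0.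
rewrite kernel_sumE// normcM normc_real ger0_norm ?powR_ge0// mulrC ler_wpM2r ?powR_ge0//.
apply: le_trans (HM n); rewrite big_mkord; apply: le_trans (normc_sum _ _ _) _.
apply: ler_sum => k _; rewrite normcM normc_prod normc_cpow ?(ltW v0)// ler_wpM2l ?normc_ge0//.
by rewrite lerXn2r ?nnegrE ?powR_ge0// pow_le.
Qed.

Lemma cmeasurable_kernel_sum n : cmeasurable (kernel_sum n).
Proof.
elim: n => [|n ih].
  by split; under eq_fun do rewrite /kernel_sum big_ord0; exact: measurable_cst.
have E v : kernel_sum n.+1 v = kernel_sum n v + d n * cpw (beta * n%:R + nu%:C) v.
  by rewrite /kernel_sum big_ord_recr.
have mt : cmeasurable (fun v => d n * cpw (beta * n%:R + nu%:C) v).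
  by apply: cmeasurableM; [split; exact: measurable_cst|exact: cmeasurable_cpw].
split.
- by under eq_fun do rewrite E ReD; apply: measurable_funD; [exact: ih.1|exact: mt.1].
- by under eq_fun do rewrite E ImD; apply: measurable_funD; [exact: ih.2|exact: mt.2].
Qed.

(** D is only given as the pointwise sum of its series, so measurability is inherited from the
    partial sums. *)
Lemma cmeasurable_kernel_trunc : cmeasurable kernel_trunc.
Proof.
pose S n v : R[i] := if 0 < v <= c then kernel_sum n v else 0.
have Scv v : (Re (S n v) @[n --> \oo] --> Re (kernel_trunc v)) /\
             (Im (S n v) @[n --> \oo] --> Im (kernel_trunc v)).
  apply: normc_cvg => e e0; have [/andP[v0 vc]|/negbTE v0] := boolP (0 < v <= c).
    by rewrite /S v0 vc; exact: kernel_sum_cvg.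
  by apply: nearW => n; rewrite /S /kernel_trunc v0 subrr normc0.
have SE n v : S n v = (if v \in `]0%R, c] then 1 else 0)%:C * kernel_sum n v.
  by rewrite /S in_itv/=; case: ifP => _; rewrite ?mul1r ?mul0r.
have mS n : cmeasurable (S n).
  have -> : S n = fun v => (if v \in `]0%R, c] then 1 else 0)%:C * kernel_sum n v.
    by apply/funext => v; exact: SE.
  apply: cmeasurableM; last exact: cmeasurable_kernel_sum.
  by apply: cmeasurable_real; apply: (@measurable_if_itv R (fun=> 1)).
split.
- apply: (measurable_fun_cvg (h := fun n v => Re (S n v))).
  + by move=> n; exact: (mS n).1.
  + by move=> v _; exact: (Scv v).1.
- apply: (measurable_fun_cvg (h := fun n v => Im (S n v))).
  + by move=> n; exact: (mS n).2.
  + by move=> v _; exact: (Scv v).2.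
Qed.

Lemma kernel_trunc_bound : exists2 M, 0 <= M & forall v,
  normc (kernel_trunc v) <= M * pw `]0, c] (nu - 1) v.
Proof.
have [M M0 HM] := kernel_sum_bound; exists M => // v.
rewrite /pw in_itv/=; case: ifPn => [/andP[v0 vc]|/negbTE v0]; last first.
  by rewrite mulr0 /kernel_trunc v0 normc0.
apply/ler_addgt0Pr => e e0.
have [n _ /(_ n (leqnn n)) /= h] := kernel_sum_cvg v0 vc e0.
rewrite -[kernel_trunc v](subrK (kernel_sum n v)) addrC.
apply: le_trans (le_normcD _ _) _; apply: lerD (ltW h).
by have := HM n v vc; rewrite /pw in_itv/= v0.
Qed.

End partial_sums.

Local Notation pK := (kernel_trunc alpha A).
Local Notation qK := (kernel_trunc (1 - alpha) B).

Let y (r : R) k m := x k m * cpow r (beta * (k + m)%:R).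

Let partial_conv n r : 0 < r ->
  cintegral setT (fun s => kernel_sum alpha a n (r - s) * kernel_sum (1 - alpha) b n s) =
  \sum_(k < n) \sum_(m < n) y r k m.
Proof.
have /andP[a0 a1] := halpha.
move=> r0; pose z (k : nat) := beta * k%:R + alpha%:C.
pose w (m : nat) := beta * m%:R + (1 - alpha)%:C.
have z0 k : 0 < Re (z k) by apply: lt_le_trans (Re_arg_ge _ _).
have w0 m : 0 < Re (w m) by apply: lt_le_trans (Re_arg_ge _ _); rewrite subr_gt0.
have -> : (fun s => kernel_sum alpha a n (r - s) * kernel_sum (1 - alpha) b n s) =
    fun s => \sum_(k < n) \sum_(m < n) (a k * b m) * (cpw (z k) (r - s) * cpw (w m) s).
  apply/funext => s; rewrite /kernel_sum big_distrlr/=.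
  by apply: eq_bigr => k _; apply: eq_bigr => m _; rewrite mulrACA.
have ic k m : cintegrable setT (fun s => (a k * b m) * (cpw (z k) (r - s) * cpw (w m) s)).
  apply: cintegrableZ; apply: cconv_integrable_at; [exact: cmeasurable_cpw|exact: cmeasurable_cpw|].
  exact: econv_cpw_lty.
rewrite cintegral_sum; last by move=> k; exact: cintegrable_sum.
apply: eq_bigr => k _; rewrite cintegral_sum//; apply: eq_bigr => m _.
rewrite cintegralZ; last first.
  apply: cconv_integrable_at; [exact: cmeasurable_cpw|exact: cmeasurable_cpw|].
  exact: econv_cpw_lty.
rewrite -[cintegral _ _]/(cconv (cpw (z k)) (cpw (w m)) r) cconv_cpw//.
rewrite /y /x -/(z k) -/(w m) {1}/cpw r0.
have -> : z k + w m - 1 = beta * (k + m)%:R.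
  by rewrite /z /w natrD rmorphB rmorph1/=; ring.
by ring.
Qed.

Let normc_y_le r k m : 0 < r -> r <= c ->
  normc (y r k m) <= B0 * ((normc (a k) * q ^+ k) * (normc (b m) * q ^+ m)).
Proof.
move=> r0 rc; rewrite /y normcM normc_cpow ?(ltW r0)// /x normcM normcM.
have -> : Re (beta * (k + m)%:R) = Re beta * (k + m)%:R.
  by have := Re_arg 0 (k + m); rewrite !addr0.
rewrite powRrM powR_mulrn ?powR_ge0// exprD.
have h : r `^ Re beta <= q by rewrite ge0_ler_powR ?nnegrE// ltW.
rewrite [leRHS](_ : _ = normc (a k) * normc (b m) * B0 * (q ^+ k * q ^+ m)); last by ring.
rewrite ler_pM ?mulr_ge0 ?normc_ge0 ?exprn_ge0 ?powR_ge0//.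
  by rewrite ler_wpM2l ?mulr_ge0 ?normc_ge0 ?normc_cbeta_le.
by rewrite ler_pM ?exprn_ge0 ?powR_ge0// lerXn2r ?nnegrE ?powR_ge0.
Qed.

(** The triangle k + m < n of the square sum is exactly 1 by [beta_convolution_coef]; the remaining
    corner is controlled by [triangle_defect]. *)
Let square_sum_cvg r : 0 < r -> r <= c -> forall e, 0 < e ->
  \forall n \near \oo, normc (1 - \sum_(k < n) \sum_(m < n) y r k m) < e.
Proof.
move=> r0 rc e e0.
have [Ma HMa] := analytic_summable hA q0 hrho.
have [Mb HMb] := analytic_summable hB q0 hrho.
pose M := Num.max Ma Mb.
have HA n : \sum_(k < n) normc (a k) * q ^+ k <= M by rewrite (le_trans (HMa n))// le_max lexx.
have HB n : \sum_(k < n) normc (b k) * q ^+ k <= M by rewrite (le_trans (HMb n))// le_max lexx orbT.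
have A0 k : 0 <= normc (a k) * q ^+ k by rewrite mulr_ge0 ?normc_ge0 ?exprn_ge0.
have Bk0 k : 0 <= normc (b k) * q ^+ k by rewrite mulr_ge0 ?normc_ge0 ?exprn_ge0.
have d0 : 0 < e / (2 * (B0 + 1)).
  by rewrite divr_gt0// mulr_gt0// ltr_wpDl.
have := triangle_defect A0 Bk0 HA HB d0.
(* [N.+1] forces n > 0, so that the term of degree 0, the only nonzero one, is present. *)
move=> [N _ HN]; exists N.+1 => // n /= Nn.
have n0 : (0 < n)%N by rewrite (leq_trans _ Nn).
have tri : \sum_(k < n) \sum_(0 <= m < n - k) y r k m = 1.
  rewrite -triangle_sum.
  rewrite (eq_bigr (fun N : 'I_n => (N == 0%N :> nat)%:R * cpow r (beta * N%:R))); last first.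
    move=> i _; rewrite -beta_convolution_coef mulr_suml; apply: eq_bigr => k _.
    by rewrite /y subnKC// -ltnS.
  rewrite (bigD1 (Ordinal n0))//= mulr0 cpow0 mulr1 big1 ?addr0// => i.
  by rewrite -val_eqE/= => /negbTE ->; rewrite mul0r.
have -> : 1 - \sum_(k < n) \sum_(m < n) y r k m = - \sum_(k < n) \sum_(n - k <= m < n) y r k m.
  rewrite -[X in X - _]tri -sumrB -sumrN; apply: eq_bigr => k _.
  rewrite -(big_mkord xpredT (y r k)) (big_cat_nat (leq0n (n - k)) (leq_subr _ _))/=.
  by ring.
rewrite normcN; apply: (@le_lt_trans _ _ (B0 * (e / (2 * (B0 + 1))))); last first.
  rewrite mulrCA -[ltRHS]mulr1 ltr_pM2l// ltr_pdivrMr ?mul1r; last by rewrite mulr_gt0// ltr_wpDl.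
  by have := B0_ge0; lra.
apply: le_trans (normc_sum _ _ _) _.
apply: (@le_trans _ _ (\sum_(k < n) B0 * (normc (a k) * q ^+ k * \sum_(n - k <= m < n) normc (b m) * q ^+ m))).
  apply: ler_sum => k _; apply: le_trans (normc_sum _ _ _) _.
  rewrite mulr_sumr mulr_sumr; apply: ler_sum => m _; exact: normc_y_le.
by rewrite -mulr_sumr ler_wpM2l// HN//= (leq_trans _ Nn).
Qed.

(** Dominated convergence in the convolution of the partial sums: the majorant is a multiple of the
    product of the two powers, and the integrals are the square sums, which tend to 1. *)
Lemma sonine r : 0 < r -> r <= c -> cconv pK qK r = 1.
Proof.
have /andP[a0 a1] := halpha; have a1' : 0 < 1 - alpha by rewrite subr_gt0.
move=> r0 rc.
have [Ma Ma0 HMa] := kernel_sum_bound alpha hA.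
have [Mb Mb0 HMb] := kernel_sum_bound (1 - alpha) hB.
pose F n s := kernel_sum alpha a n (r - s) * kernel_sum (1 - alpha) b n s.
pose v s := Ma * Mb * (pw `]0, +oo[ (alpha - 1) (r - s) * pw `]0, +oo[ (- alpha) s).
have v0 s : 0 <= v s by rewrite !mulr_ge0 ?pw_ge0.
have out n nu d s : s <= 0 -> kernel_sum nu d n s = 0.
  by move=> s0; rewrite /kernel_sum big1// => k _; rewrite /cpw ltNge s0 mulr0.
have outK nu D s : s <= 0 -> kernel_trunc nu D s = 0.
  by move=> s0; rewrite /kernel_trunc ltNge s0.
have iv : mu.-integrable setT (EFin \o v).
  have := conv_integrable_at (measurable_pw _ _) (measurable_pw _ _) (econv_pw_alpha r).
  by move=> /(integrableZl measurableT (Ma * Mb)).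
have Fv n s : normc (F n s) <= v s.
  rewrite /F; have [s0|s0] := leP s 0; first by rewrite (out _ _ _ _ s0) mulr0 normc0.
  have [rs|rs] := leP (r - s) 0; first by rewrite (out _ _ _ _ rs) mul0r normc0.
  rewrite normcM /v mulrACA ler_pM ?normc_ge0//; first by rewrite HMa//; lra.
  have := HMb n s; rewrite (_ : 1 - alpha - 1 = - alpha); last by ring.
  by apply; lra.
have cF s : (Re (F n s) @[n --> \oo] --> Re (pK (r - s) * qK s)) /\
            (Im (F n s) @[n --> \oo] --> Im (pK (r - s) * qK s)).
  have [s0|s0] := leP s 0.
    by apply: normc_cvg => e e0; apply: nearW => n; rewrite /F (out _ _ _ _ s0) (outK (1 - alpha) B _ s0) !mulr0 subrr normc0.
  have [rs|rs] := leP (r - s) 0.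
    by apply: normc_cvg => e e0; apply: nearW => n; rewrite /F (out _ _ _ _ rs) (outK alpha A _ rs) !mul0r subrr normc0.
  have rsc : r - s <= c by lra.
  have sc : s <= c by lra.
  have [p1 p2] := normc_cvg (kernel_sum_cvg alpha hA rs rsc).
  have [q1 q2] := normc_cvg (kernel_sum_cvg (1 - alpha) hB s0 sc).
  split.
    rewrite ReM (_ : (fun n => _) = fun n =>
      Re (kernel_sum alpha a n (r - s)) * Re (kernel_sum (1 - alpha) b n s) -
      Im (kernel_sum alpha a n (r - s)) * Im (kernel_sum (1 - alpha) b n s)); last first.
      by apply/funext => n; rewrite /F ReM.
    exact: cvgB (cvgM p1 q1) (cvgM p2 q2).
  rewrite ImM (_ : (fun n => _) = fun n =>
    Re (kernel_sum alpha a n (r - s)) * Im (kernel_sum (1 - alpha) b n s) +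
    Im (kernel_sum alpha a n (r - s)) * Re (kernel_sum (1 - alpha) b n s)); last first.
    by apply/funext => n; rewrite /F ImM.
  exact: cvgD (cvgM p1 q2) (cvgM p2 q1).
have mF n : cmeasurable (F n).
  exact: (cmeasurableM
    (cmeasurable_comp (cmeasurable_kernel_sum alpha a n) (measurable_shift r))
    (cmeasurable_kernel_sum (1 - alpha) b n)).
have mf : cmeasurable (fun s => pK (r - s) * qK s).
  exact: (cmeasurableM
    (cmeasurable_comp (cmeasurable_kernel_trunc alpha hA) (measurable_shift r))
    (cmeasurable_kernel_trunc (1 - alpha) hB)).
have [cR cI] := cintegral_dominated_cvg mF (fun s => (cF s).1) (fun s => (cF s).2) mf Fv iv.
have [tR tI] := normc_cvg (square_sum_cvg r0 rc).
apply: complex_eq.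
- apply: (cvg_unique _ cR); first exact: Rhausdorff.
  rewrite (_ : (fun n => _) = fun n => Re (\sum_(k < n) \sum_(m < n) y r k m)); first exact: tR.
  by apply/funext => n; rewrite partial_conv.
- apply: (cvg_unique _ cI); first exact: Rhausdorff.
  rewrite (_ : (fun n => _) = fun n => Im (\sum_(k < n) \sum_(m < n) y r k m)); first exact: tI.
  by apply/funext => n; rewrite partial_conv.
Qed.

End sonine.

(** * Abel inversion *)

Section differentiation.
Context {R : realType}.
Notation mu := (@lebesgue_measure R).

Lemma ae_neq (x : R) : {ae mu, forall t : R, t != x}.
Proof.
exists [set x]; split => //; first exact: lebesgue_measure_set1.
by move=> t /= /negP; rewrite negbK => /eqP.
Qed.

Lemma ae_mono (P Q : R -> Prop) : (forall t, P t -> Q t) ->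
  {ae mu, forall t, P t} -> {ae mu, forall t, Q t}.
Proof. by move=> PQ; apply: filterS => //; exact: (ae_filter_ringOfSetsType mu). Qed.

Lemma ae_conj (P Q : R -> Prop) : {ae mu, forall t, P t} -> {ae mu, forall t, Q t} ->
  {ae mu, forall t, P t /\ Q t}.
Proof. by move=> p q; apply: filterI => //; exact: (ae_filter_ringOfSetsType mu). Qed.

Lemma ae_affine (c d : R) (P : R -> Prop) : c != 0 -> {ae mu, forall t, P t} ->
  {ae mu, forall t, P (c * t + d)}.
Proof.
move=> c0 [N [mN N0 PN]]; exists ((fun t => c * t + d) @^-1` N); split.
- rewrite -[X in measurable X]setTI; exact: measurable_affine.
- have := lebesgue_measure_affine d c0 mN; rewrite N0 /pushforward => /eqP.
  by rewrite mule_eq0 eqe normr_eq0 (negbTE c0)/= => /eqP.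
- by move=> t /= nP; apply: PN.
Qed.

(** Lebesgue differentiation. The interval is open because F is only known on [a, b], while a
    derivative at t involves a neighbourhood of t. *)
Lemma ae_is_derive_integral a b (F W : R -> R) : a < b ->
  mu.-integrable setT (EFin \o W) ->
  (forall t, t \in `[a, b] -> F t = F a + \int[mu]_(s in `]a, t]) W s) ->
  {ae mu, forall t, t \in `]a, b[ -> is_derive t 1 F (W t)}.
Proof.
move=> ab iW FE.
have locW : locally_integrable setT W by apply: open_integrable_locally => //; exact: openT.
have iWy y : mu.-integrable [set` Interval (BRight a) (BRight y)] (EFin \o W).
  exact: integrableS iW.
have := FTC1 iWy locW.
move=> /=; apply: filterS; first exact: (ae_filter_ringOfSetsType mu).
move=> t H; rewrite in_itv/= => /andP[at_ tb].
have /H [D E] : (BRight a < BRight t)%O by rewrite bnd_simp.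
have dF : is_derive t 1 (fun y => F a + \int[mu]_(s in `]a, y]) W s) (W t).
  rewrite -[W t]add0r; apply: is_deriveD; rewrite -E derive1E.
  exact: derivableP.
apply: near_eq_is_derive dF.
have : t \in `]a, b[ by rewrite in_itv/= at_.
move=> /near_in_itvoo; apply: filterS => y yab; rewrite [RHS]FE//.
exact: subset_itv_oo_cc.
Qed.

End differentiation.

Section abel.
Context {R : realType}.
Notation mu := (@lebesgue_measure R).
Implicit Types f g P Q : R -> R.

(** An almost everywhere bound on the second factor yields a bound at every t. This turns the almost
    everywhere inversion formula into the pointwise [abel_bound]. *)
Lemma econv_le u u' v v' (t : R) :
  measurable_fun setT u -> measurable_fun setT u' ->
  measurable_fun setT v -> measurable_fun setT v' ->
  (forall s, 0 <= u s)%E -> (forall s, 0 <= v s)%E ->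
  (forall s, u s <= u' s)%E -> {ae mu, forall s, v s <= v' s}%E ->
  (forall s, 0 <= v' s)%E ->
  (@econv R u v t <= econv u' v' t)%E.
Proof.
move=> mu_ mu' mv mv' u0 v0 uu' vv' v'0; apply: ae_ge0_le_integral => //.
- by move=> s _; exact: mule_ge0.
- by apply: emeasurable_funM => //; exact: emeasurable_reflect.
- by move=> s _; apply: mule_ge0 => //; exact: le_trans (uu' _).
- by apply: emeasurable_funM => //; exact: emeasurable_reflect.
- by move: vv'; apply: filterS => s vs _; exact: lee_pmul.
Qed.

Lemma econvDr u v w (t : R) :
  measurable_fun setT u -> measurable_fun setT v -> measurable_fun setT w ->
  (forall s, 0 <= u s)%E -> (forall s, 0 <= v s)%E -> (forall s, 0 <= w s)%E ->
  (@econv R u (fun s => v s + w s) t = econv u v t + econv u w t)%E.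
Proof.
move=> mu_ mv mw u0 v0 w0; rewrite /econv -ge0_integralD//.
- by apply: eq_integral => s _; rewrite ge0_muleDr.
- by move=> s _; rewrite mule_ge0.
- by apply: emeasurable_funM => //; exact: emeasurable_reflect.
- by move=> s _; rewrite mule_ge0.
- by apply: emeasurable_funM => //; exact: emeasurable_reflect.
Qed.

Lemma econv_ub u v (C : R) (t : R) : 0 <= C ->
  measurable_fun setT u -> measurable_fun setT v ->
  (forall s, 0 <= u s)%E -> (forall s, 0 <= v s)%E ->
  (forall s, u s <= C%:E)%E -> (@econv R u v t <= C%:E * \int[mu]_s v s)%E.
Proof.
move=> C0 mu_ mv u0 v0 uC; rewrite -ge0_integralZl//.
apply: ge0_le_integral => //.
- by move=> s _; exact: mule_ge0.
- by apply: emeasurable_funM => //; exact: emeasurable_reflect.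
- by apply: emeasurable_funM.
- by move=> s _; apply: lee_pmul.
Qed.

Local Notation econvpw x y r := (econv (EFin \o pw `]0%R, +oo[ x) (EFin \o pw `]0%R, +oo[ y) r).

Variables (alpha a b : R).
Hypothesis halpha : 0 < alpha < 1.
Hypothesis ab : a < b.

(** The bound also forces f to vanish outside []0, b - a]]. *)
Definition dominated_by (x : R) (f : R -> R) : Prop :=
  measurable_fun setT f /\
  exists2 M, 0 <= M & forall r, `|f r| <= M * pw `]0, b - a] x r.

Definition off_itv (f : R -> R) : Prop := forall t, t \notin `[a, b] -> f t = 0.

Lemma dominated_by_integrable x f : -1 < x -> dominated_by x f ->
  mu.-integrable setT (EFin \o f).
Proof.
move=> x1 [mf [M M0 hf]]; apply: (integrable_dominated mf hf).
by have /(integrableZl measurableT M) := pw_integrable (b - a) x1.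
Qed.

(* The convolution of r^(alpha-1) and r^(-alpha) is homogeneous of degree 0. *)
Lemma econv_dominated P Q : dominated_by (alpha - 1) P -> dominated_by (- alpha) Q ->
  exists2 C : R, 0 <= C & forall r, (econv (nabs P) (nabs Q) r <= C%:E)%E.
Proof.
have /andP[a0 a1] := halpha.
move=> [mP [M M0 hP]] [mQ [N N0 hQ]].
have mpw x : measurable_fun setT (fun r : R => (pw `]0%R, +oo[ x r)%:E : \bar R).
  by apply/measurable_EFinP; exact: measurable_pw.
pose K := econvpw (alpha - 1) (- alpha) (1 : R).
have K0 : (0 <= K)%E by apply: econv_ge0 => r; rewrite lee_fin pw_ge0.
have Klt : (K < +oo)%E by apply: econv_pw_lty; lra.
have KE : K = (fine K)%:E by rewrite fineK// ge0_fin_numE.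
have pwle x r : pw `]0, b - a] x r <= pw `]0, +oo[ x r.
  by rewrite /pw !in_itv/= andbT; case: ltP => //=; case: ifP => //; rewrite powR_ge0.
exists (M * N * fine K) => [|r].
  by rewrite mulr_ge0 ?mulr_ge0// fine_ge0.
apply: (@le_trans _ _ (econv (fun r => M%:E * (pw `]0%R, +oo[ (alpha - 1) r)%:E)
    (fun r => N%:E * (pw `]0%R, +oo[ (- alpha) r)%:E) r)%E).
  apply: econv_le.
  - exact: measurable_nabs.
  - by apply: emeasurable_funM => //; exact: mpw.
  - exact: measurable_nabs.
  - by apply: emeasurable_funM => //; exact: mpw.
  - exact: nabs_ge0.
  - exact: nabs_ge0.
  - by move=> s; rewrite -EFinM lee_fin (le_trans (hP s))// ler_wpM2l.
  - by apply: aeW => s; rewrite -EFinM lee_fin (le_trans (hQ s))// ler_wpM2l.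
  - by move=> s; rewrite mule_ge0 ?lee_fin ?pw_ge0.
have -> : (econv (fun r => M%:E * (pw `]0%R, +oo[ (alpha - 1) r)%:E)
    (fun r => N%:E * (pw `]0%R, +oo[ (- alpha) r)%:E) r =
    (M * N)%:E * econvpw (alpha - 1) (- alpha) r)%E.
  rewrite /econv -ge0_integralZl//.
  - by apply: eq_integral => s _; rewrite EFinM muleACA.
  - apply: emeasurable_funM; last exact: mpw.
    exact: (emeasurable_reflect r (mpw (alpha - 1))).
  - by move=> s _; rewrite mule_ge0 ?lee_fin ?pw_ge0.
  - by rewrite lee_fin mulr_ge0.
rewrite [leRHS]EFinM; apply: lee_wpmul2l; first by rewrite lee_fin mulr_ge0.
have [r0|r0] := leP r 0; first by rewrite econv_pw_neg// lee_fin fine_ge0.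
rewrite econv_pw_scale// (_ : alpha - 1 + - alpha + 1 = 0); last by ring.
by rewrite powRr0 mul1e -/K KE.
Qed.

Lemma dominated_by0 x f r : dominated_by x f -> r \notin `]0, b - a] -> f r = 0.
Proof.
move=> [_ [M _ hf]] r0; apply/eqP; rewrite -normr_le0 (le_trans (hf r))//.
by rewrite /pw (negbTE r0) mulr0.
Qed.

Lemma dominated_by_left0 x f r : dominated_by x f -> r <= 0 -> f r = 0.
Proof. by move=> df r0; apply: (dominated_by0 df); rewrite in_itv/= ltNge r0. Qed.

Lemma conv_left0 f g x t : (forall r, r <= 0 -> f r = 0) -> (forall s, s < x -> g s = 0) ->
  t <= x -> conv f g t = 0.
Proof.
move=> f0 g0 tx; transitivity (\int[mu]_s (0 : R)); last by rewrite /Rintegral integral0.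
apply: eq_Rintegral => s _; have [ts|st] := leP t s; first by rewrite f0 ?mul0r// subr_le0.
by rewrite g0 ?mulr0// (lt_le_trans st).
Qed.

Lemma conv_dominated_left0 y f g x t : dominated_by y f -> (forall s, s < x -> g s = 0) ->
  t <= x -> conv f g t = 0.
Proof. by move=> df; apply: conv_left0 => r; exact: dominated_by_left0 df. Qed.

(** Written as a power of exponent 0, so that [dominated_by] covers it. For t in [a, b] and
    functions vanishing before a, the cut-off is invisible and convolution is integration from a. *)
Definition heaviside : R -> R := pw `]0, b - a] 0.

Lemma heavisideE r : heaviside r = if r \in `]0, b - a] then 1 else 0.
Proof. by rewrite /heaviside /pw powRr0. Qed.

Lemma heaviside_dominated : dominated_by 0 heaviside.
Proof.
split; first exact: measurable_pw.
by exists 1 => // r; rewrite mul1r ger0_norm// pw_ge0.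
Qed.

Lemma heaviside_le1 r : (nabs heaviside r <= 1%:E)%E.
Proof. by rewrite /nabs heavisideE lee_fin; case: ifP; rewrite ?normr1 ?normr0. Qed.

Lemma conv_heaviside f t : mu.-integrable setT (EFin \o f) ->
  (forall s, s < a -> f s = 0) -> t \in `[a, b] ->
  conv heaviside f t = \int[mu]_(s in `]a, t]) f s.
Proof.
move=> fi f0; rewrite in_itv/= => /andP[at_ tb].
have fiS (i : interval R) : mu.-integrable [set` i] (EFin \o f) by exact: integrableS fi.
rewrite (Rintegral_itv_obnd_cbnd (fiS _)) -(Rintegral_itv_bndo_bndc (fiS _)).
rewrite [RHS]Rintegral_mkcond restrict_if; apply: eq_Rintegral => s _.
rewrite heavisideE !in_itv/= subr_gt0; have [sa|as_] := ltP s a.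
  by rewrite f0// mulr0.
have [st|ts] /= := ltP s t; last by rewrite mul0r.
by rewrite lerB// mul1r.
Qed.

Lemma gtN1_alphaB1 : -1 < alpha - 1. Proof. by have := halpha; lra. Qed.

Lemma gtN1_alphaN : -1 < - alpha. Proof. by have := halpha; lra. Qed.

(** Since the Heaviside factor is bounded and f and g are integrable, the triple convolution of
    absolute values is finite at every t. *)
Lemma conv_heavisideC x f g t : -1 < x -> dominated_by x f -> mu.-integrable setT (EFin \o g) ->
  conv f (conv heaviside g) t = conv heaviside (conv f g) t /\
  (econv (nabs f) (econv (nabs heaviside) (nabs g)) t < +oo)%E.
Proof.
move=> x1 df gi; have [mf _] := df; have mg := integrable_measurable gi.
have [mh _] := heaviside_dominated.
have fi := dominated_by_integrable x1 df.
have mnf := measurable_nabs mf; have mng := measurable_nabs mg; have mnh := measurable_nabs mh.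
have fin : (econv (nabs heaviside) (econv (nabs f) (nabs g)) t < +oo)%E.
  have := econv_ub t ler01 mnh (measurable_econv mnf mng (nabs_ge0 f) (nabs_ge0 g)) (nabs_ge0 _)
    (fun s => econv_ge0 s (nabs_ge0 f) (nabs_ge0 g)) heaviside_le1.
  move=> /le_lt_trans; apply; rewrite mul1e.
  by apply: econv_lty_ae => //; [exact: nabs_ge0|exact: nabs_ge0|exact: integrable_nabs|exact: integrable_nabs].
have fin' : (econv (nabs f) (econv (nabs heaviside) (nabs g)) t < +oo)%E.
  rewrite econvA//; [|exact: nabs_ge0..].
  rewrite (econvC mnf mnh (nabs_ge0 _) (nabs_ge0 _)) -econvA//; exact: nabs_ge0.
split; last exact: fin'.
transitivity (conv (conv f heaviside) g t); first exact: (convA mf mh mg fin').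
by rewrite (convC mf mh); symmetry; exact: (convA mh mf mg fin).
Qed.

(** Real and imaginary parts of the two kernels; [hPQ] is the real part of the complex Sonine
    identity. *)
Variables (P1 P2 Q1 Q2 : R -> R).
Hypothesis hP1 : dominated_by (alpha - 1) P1.
Hypothesis hP2 : dominated_by (alpha - 1) P2.
Hypothesis hQ1 : dominated_by (- alpha) Q1.
Hypothesis hQ2 : dominated_by (- alpha) Q2.
Hypothesis hPQ : forall r, 0 < r -> r <= b - a -> conv P1 Q1 r - conv P2 Q2 r = 1.

Let conv_PQA P Q f t : dominated_by (alpha - 1) P -> dominated_by (- alpha) Q ->
  mu.-integrable setT (EFin \o f) ->
  conv P (conv Q f) t = conv (conv P Q) f t /\
  mu.-integrable setT (fun s => (conv P Q (t - s) * f s)%:E).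
Proof.
move=> dP dQ fi; have [mP _] := dP; have [mQ _] := dQ; have mf := integrable_measurable fi.
have mnP := measurable_nabs mP; have mnQ := measurable_nabs mQ; have mnf := measurable_nabs mf.
have [C C0 hC] := econv_dominated dP dQ.
have fin : (econv (econv (nabs P) (nabs Q)) (nabs f) t < +oo)%E.
  have := econv_ub t C0 (measurable_econv mnP mnQ (nabs_ge0 P) (nabs_ge0 Q)) mnf
    (fun s => econv_ge0 s (nabs_ge0 P) (nabs_ge0 Q)) (nabs_ge0 f) hC.
  by move=> /le_lt_trans; apply; rewrite lte_mul_pinfty// integrable_nabs.
split; first by rewrite convA// econvA//; exact: nabs_ge0.
apply: conv_integrable_at => //; first exact: measurable_conv.
apply: le_lt_trans fin; apply: econv_le => //.
- by apply: measurable_nabs; exact: measurable_conv.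
- by apply: measurable_econv => //; exact: nabs_ge0.
- exact: nabs_ge0.
- exact: nabs_ge0.
- by move=> s; exact: abs_conv_le.
- exact: aeW.
- exact: nabs_ge0.
Qed.

Section inversion.
Variables (l G1 G2 : R -> R).
Hypothesis li : mu.-integrable setT (EFin \o l).
Hypothesis l0 : off_itv l.
Hypothesis G1i : mu.-integrable setT (EFin \o G1).
Hypothesis G2i : mu.-integrable setT (EFin \o G2).
Hypothesis G10 : off_itv G1.
Hypothesis G20 : off_itv G2.
Hypothesis hF1 : forall t, t \in `[a, b] -> conv Q1 l t = conv heaviside G1 t.
Hypothesis hF2 : forall t, t \in `[a, b] -> conv Q2 l t = conv heaviside G2 t.

Let off_left f s : off_itv f -> s < a -> f s = 0.
Proof. by move=> f0 sa; rewrite f0// in_itv/= leNgt sa. Qed.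

(** The relation Q * l = H * G is known on [a, b] only. Before a both sides vanish, and beyond t <=
    b they are multiplied by P(t - s) = 0. *)
Let conv_extend P Q G t : dominated_by (alpha - 1) P -> dominated_by (- alpha) Q ->
  off_itv G -> (forall t, t \in `[a, b] -> conv Q l t = conv heaviside G t) -> t <= b ->
  conv P (conv Q l) t = conv P (conv heaviside G) t.
Proof.
move=> dP dQ G0 hF tb; apply: eq_Rintegral => s _.
have [ts|st] := leP t s; first by rewrite (dominated_by_left0 dP) ?subr_le0// !mul0r.
congr (_ * _); have [sa|as_] := ltP s a.
  have off f : off_itv f -> forall s, s < a -> f s = 0 by move=> f0 r; exact: off_left.
  rewrite (conv_dominated_left0 dQ (off _ l0) (ltW sa)).
  by rewrite (conv_dominated_left0 heaviside_dominated (off _ G0) (ltW sa)).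
by apply: hF; rewrite in_itv/= as_ (le_trans (ltW st)).
Qed.

(* Convolving Q * l = H * G with P gives H * l = H * (P * G). *)
Lemma abel_inversion : {ae mu, forall t, t \in `]a, b[ -> l t = conv P1 G1 t - conv P2 G2 t}.
Proof.
have V1i : mu.-integrable setT (EFin \o conv P1 G1).
  by apply: integrable_conv => //; exact: dominated_by_integrable gtN1_alphaB1 hP1.
have V2i : mu.-integrable setT (EFin \o conv P2 G2).
  by apply: integrable_conv => //; exact: dominated_by_integrable gtN1_alphaB1 hP2.
have V0 P G : dominated_by (alpha - 1) P -> off_itv G -> forall s, s < a -> conv P G s = 0.
  by move=> dP G0 s sa; apply: (conv_dominated_left0 dP _ (ltW sa)) => r; exact: off_left.
have PQ0 P Q r : dominated_by (alpha - 1) P -> dominated_by (- alpha) Q -> r <= 0 -> conv P Q r = 0.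
  move=> dP dQ r0; apply: (conv_dominated_left0 dP _ r0) => s s0.
  exact: dominated_by_left0 dQ (ltW s0).
pose W t := l t - (conv P1 G1 t - conv P2 G2 t).
have Di : mu.-integrable setT (EFin \o (fun t => conv P1 G1 t - conv P2 G2 t)).
  exact: integrableBR V1i V2i.
have Wi : mu.-integrable setT (EFin \o W).
  exact: integrableBR li Di.
have fiS f (i : interval R) : mu.-integrable setT (EFin \o f) -> mu.-integrable [set` i] (EFin \o f).
  by move=> fi; exact: integrableS fi.
have intl t : t \in `[a, b] -> conv heaviside l t =
    conv heaviside (conv P1 G1) t - conv heaviside (conv P2 G2) t.
  move=> tab; have tb : t <= b by move: tab; rewrite in_itv/= => /andP[].
  rewrite -(conv_heavisideC t gtN1_alphaB1 hP1 G1i).1 -(conv_heavisideC t gtN1_alphaB1 hP2 G2i).1.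
  rewrite -(conv_extend hP1 hQ1 G10 hF1 tb) -(conv_extend hP2 hQ2 G20 hF2 tb).
  have [-> i1] := conv_PQA t hP1 hQ1 li; have [-> i2] := conv_PQA t hP2 hQ2 li.
  rewrite /conv -RintegralB//; apply: eq_Rintegral => s _; rewrite -mulrBl.
  have [sab|sab] := boolP (s \in `[a, b]); last by rewrite (l0 sab) !mulr0.
  congr (_ * _); rewrite heavisideE in_itv/=; move: sab; rewrite in_itv/= => /andP[as_ sb].
  have [st|ts] := ltP 0 (t - s); last first.
    by rewrite -/(conv _ _ _) -/(conv _ _ _) !PQ0// subrr.
  by rewrite lerB// hPQ// lerB.
(* W has integral 0 over every []a, t]], so the zero function is a primitive of W on [a, b] and
   differentiation gives W = 0 almost everywhere. *)
have FE t : t \in `[a, b] -> (fun=> 0) t = (fun=> 0) a + \int[mu]_(s in `]a, t]) W s.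
  move=> tab; have := intl t tab.
  rewrite !conv_heaviside//; [|exact: V0|exact: V0|by move=> s; exact: off_left].
  move=> E; rewrite /W RintegralB//; [|exact: fiS|exact: fiS Di].
  rewrite RintegralB; [by rewrite E; ring|exact: measurable_itv|exact: fiS|exact: fiS].
apply: ae_mono (ae_is_derive_integral ab Wi FE) => t H /H dW.
have := @derive_val _ _ _ _ _ _ _ dW; rewrite derive_cst /W => /esym/eqP.
by rewrite subr_eq0 => /eqP.
Qed.

(** By the inversion |l| is at most |P1| * |G1| + |P2| * |G2| almost everywhere. Each |Q1| * |Pi| is
    bounded by a constant, so |Q1| * |l| is bounded by these constants times the L1 norms of the
    densities. *)
Lemma abel_bound : exists2 C : R, 0 <= C & forall r, (econv (nabs Q1) (nabs l) r <= C%:E)%E.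
Proof.
have [mP1 _] := hP1; have [mP2 _] := hP2; have [mQ1 _] := hQ1.
have mnP1 := measurable_nabs mP1; have mnP2 := measurable_nabs mP2; have mnQ1 := measurable_nabs mQ1.
have mnG1 := measurable_nabs (integrable_measurable G1i).
have mnG2 := measurable_nabs (integrable_measurable G2i).
have mnl := measurable_nabs (integrable_measurable li).
have [C1 C10 hC1] := econv_dominated hP1 hQ1.
have [C2 C20 hC2] := econv_dominated hP2 hQ1.
pose v s := (econv (nabs P1) (nabs G1) s + econv (nabs P2) (nabs G2) s)%E.
have e1 s : (0 <= econv (nabs P1) (nabs G1) s)%E by apply: econv_ge0; exact: nabs_ge0.
have e2 s : (0 <= econv (nabs P2) (nabs G2) s)%E by apply: econv_ge0; exact: nabs_ge0.
have me1 : measurable_fun setT (econv (nabs P1) (nabs G1)).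
  by apply: measurable_econv => //; exact: nabs_ge0.
have me2 : measurable_fun setT (econv (nabs P2) (nabs G2)).
  by apply: measurable_econv => //; exact: nabs_ge0.
have v0 s : (0 <= v s)%E by rewrite adde_ge0.
have lv : {ae mu, forall s, nabs l s <= v s}%E.
  apply: ae_mono (ae_conj abel_inversion (ae_conj (ae_neq a) (ae_neq b))) => s [H [sa sb]].
  have [sab|sab] := boolP (s \in `[a, b]); last first.
    by rewrite /nabs (l0 sab) normr0.
  have so : s \in `]a, b[.
    by move: sab; rewrite !in_itv/= !lt_neqAle sb eq_sym sa.
  rewrite /nabs (H so); apply: (@le_trans _ _ ((`|conv P1 G1 s|)%:E + (`|conv P2 G2 s|)%:E)%E).
    by rewrite -EFinD lee_fin ler_normB.
  by apply: leeD; exact: abs_conv_le (integrable_measurable _).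
have iG1 : (\int[mu]_s nabs G1 s)%E = (fine (\int[mu]_s nabs G1 s))%:E.
  by rewrite fineK// ge0_fin_numE ?integrable_nabs// integral_ge0// => *; exact: nabs_ge0.
have iG2 : (\int[mu]_s nabs G2 s)%E = (fine (\int[mu]_s nabs G2 s))%:E.
  by rewrite fineK// ge0_fin_numE ?integrable_nabs// integral_ge0// => *; exact: nabs_ge0.
have i1 : 0 <= fine (\int[mu]_s nabs G1 s)%E by rewrite fine_ge0// integral_ge0// => *; exact: nabs_ge0.
have i2 : 0 <= fine (\int[mu]_s nabs G2 s)%E by rewrite fine_ge0// integral_ge0// => *; exact: nabs_ge0.
have bound P G C r : measurable_fun setT (nabs P) -> measurable_fun setT (nabs G) -> 0 <= C ->
    (forall r, econv (nabs P) (nabs Q1) r <= C%:E)%E ->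
    (econv (nabs Q1) (econv (nabs P) (nabs G)) r <= C%:E * \int[mu]_s nabs G s)%E.
  move=> mP mG C0 hC; rewrite econvA//; [|exact: nabs_ge0..].
  rewrite (econvC mnQ1 mP (nabs_ge0 _) (nabs_ge0 _)); apply: econv_ub => //.
  - by apply: measurable_econv => //; exact: nabs_ge0.
  - by move=> s; apply: econv_ge0; exact: nabs_ge0.
  - exact: nabs_ge0.
exists (C1 * fine (\int[mu]_s nabs G1 s)%E + C2 * fine (\int[mu]_s nabs G2 s)%E).
  by rewrite addr_ge0// mulr_ge0.
move=> r; apply: (@le_trans _ _ (econv (nabs Q1) v r)).
  apply: econv_le => //; [exact: emeasurable_funD|exact: nabs_ge0|exact: nabs_ge0].
have -> : econv (nabs Q1) v r = (econv (nabs Q1) (econv (nabs P1) (nabs G1)) r +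
    econv (nabs Q1) (econv (nabs P2) (nabs G2)) r)%E.
  by apply: econvDr => //; exact: nabs_ge0.
rewrite EFinD !EFinM -iG1 -iG2; apply: leeD; exact: bound.
Qed.

End inversion.

End abel.

(** * Fractional integration by parts *)

Section pairing.
Context {R : realType}.
Notation mu := (@lebesgue_measure R).

(** A bounded |g| * |f| against an integrable h makes the triple convolution finite at every t, even
    where f and h alone have no convolution. *)
Lemma conv_swap (f g h : R -> R) (C t : R) :
  measurable_fun setT f -> measurable_fun setT g -> mu.-integrable setT (EFin \o h) ->
  0 <= C -> (forall r, econv (nabs g) (nabs f) r <= C%:E)%E ->
  conv f (conv g h) t = conv (conv g f) h t /\
  mu.-integrable setT (fun s => (f (t - s) * conv g h s)%:E).
Proof.
move=> mf mg hi C0 hC; have mh := integrable_measurable hi.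
have mnf := measurable_nabs mf; have mng := measurable_nabs mg; have mnh := measurable_nabs mh.
have fin : (econv (nabs f) (econv (nabs g) (nabs h)) t < +oo)%E.
  rewrite econvA//; [|exact: nabs_ge0..].
  rewrite (econvC mnf mng (nabs_ge0 _) (nabs_ge0 _)).
  have := econv_ub t C0 (measurable_econv mng mnf (nabs_ge0 g) (nabs_ge0 f)) mnh
    (fun s => econv_ge0 s (nabs_ge0 g) (nabs_ge0 f)) (nabs_ge0 h) hC.
  by move=> /le_lt_trans; apply; rewrite lte_mul_pinfty// integrable_nabs.
split.
  transitivity (conv (conv f g) h t); first exact: (convA mf mg mh fin).
  by rewrite (convC mf mg).
apply: conv_integrable_at => //; first exact: measurable_conv.
apply: le_lt_trans fin; apply: econv_le => //.
- by apply: measurable_nabs; exact: measurable_conv.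
- by apply: measurable_econv => //; exact: nabs_ge0.
- exact: nabs_ge0.
- exact: nabs_ge0.
- by apply: aeW => s; exact: abs_conv_le.
- by move=> s; apply: econv_ge0; exact: nabs_ge0.
Qed.

Variables (a b : R).
Hypothesis ab : a < b.
Local Notation heaviside := (heaviside a b).

(** Convolution at a + b pairs one function with the reflection of the other. Y vanishes off [a, b],
    and s in [a, b] puts a + b - s there too, so the relation [hG] on [a, b] suffices. *)
Lemma conv_reflect_pairing (Q l G Y : R -> R) (C : R) :
  measurable_fun setT Q -> measurable_fun setT l ->
  mu.-integrable setT (EFin \o G) -> mu.-integrable setT (EFin \o Y) -> off_itv a b Y ->
  0 <= C -> (forall r, econv (nabs Q) (nabs l) r <= C%:E)%E ->
  (forall t, t \in `[a, b] -> conv Q l t = conv heaviside G t) ->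
  [/\ conv l (conv Q Y) (a + b) = conv G (conv heaviside Y) (a + b),
      mu.-integrable setT (fun s => (l (a + b - s) * conv Q Y s)%:E) &
      mu.-integrable setT (fun s => (G (a + b - s) * conv heaviside Y s)%:E)].
Proof.
move=> mQ ml Gi Yi Y0 C0 hC hG; have mG := integrable_measurable Gi.
have [mh _] := heaviside_dominated a b.
have [E1 I1] := conv_swap (a + b) ml mQ Yi C0 hC.
have fG r : (econv (nabs heaviside) (nabs G) r <= (fine (\int[mu]_s nabs G s))%:E)%E.
  have mnG := measurable_nabs mG.
  have := econv_ub r ler01 (measurable_nabs mh) mnG (nabs_ge0 _) (nabs_ge0 G) (heaviside_le1 a b).
  by rewrite mul1e fineK// ge0_fin_numE ?integrable_nabs// integral_ge0// => *; exact: nabs_ge0.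
have G0 : 0 <= fine (\int[mu]_s nabs G s)%E.
  by rewrite fine_ge0// integral_ge0// => *; exact: nabs_ge0.
have [E2 I2] := conv_swap (a + b) mG mh Yi G0 fG.
split; [|exact: I1|exact: I2]; rewrite E1 E2; apply: eq_Rintegral => s _.
have [sab|sab] := boolP (s \in `[a, b]); last by rewrite (Y0 _ sab) !mulr0.
congr (_ * _); apply: hG; move: sab; rewrite !in_itv/=; lra.
Qed.

End pairing.

(** * Reflection t -> a + b - t, exchanging left-sided and right-sided operators *)

Section reflection.
Context {R : realType}.
Notation mu := (@lebesgue_measure R).

Lemma ae_reflect (d : R) (P : R -> Prop) : {ae mu, forall t, P t} ->
  {ae mu, forall t, P (d - t)}.
Proof.
have n0 : (-1 : R) != 0 by rewrite oppr_eq0 oner_eq0.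
by move=> /(ae_affine d n0); apply: ae_mono => t; rewrite mulN1r addrC.
Qed.

Lemma Rintegral_reflect (d : R) (f : R -> R) : measurable_fun setT f ->
  \int[mu]_x f x = \int[mu]_x f (d - x).
Proof.
have n0 : (-1 : R) != 0 by rewrite oppr_eq0 oner_eq0.
move=> mf; rewrite (Rintegral_affine d n0 mf) normrN1 mul1r.
by apply: eq_Rintegral => x _; rewrite mulN1r addrC.
Qed.

Lemma integrable_reflect (d : R) (f : R -> R) : mu.-integrable setT (EFin \o f) ->
  mu.-integrable setT (EFin \o (fun x => f (d - x))).
Proof.
have n0 : (-1 : R) != 0 by rewrite oppr_eq0 oner_eq0.
move=> /(integrable_affine d n0); congr (mu.-integrable _ _).
by apply/funext => x /=; rewrite mulN1r addrC.
Qed.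

Lemma is_derive_reflect (d t y : R) (f : R -> R) : is_derive (d - t) 1 f y ->
  is_derive t 1 (fun s => f (d - s)) (- y).
Proof.
move=> df; have dr : is_derive t 1 (fun s : R => d - s) (-1).
  by rewrite -[-1]add0r; apply: is_deriveB.
by rewrite -mulrN1; exact: is_derive1_comp.
Qed.

Variables (a b : R).
Hypothesis ab : a < b.

Lemma in_itv_reflect t : (a + b - t \in `[a, b]) = (t \in `[a, b]).
Proof. by rewrite !in_itv/= andbC; congr (_ && _); apply/idP/idP; lra. Qed.

Lemma in_itvoo_reflect t : (a + b - t \in `]a, b[) = (t \in `]a, b[).
Proof. by rewrite !in_itv/= andbC; congr (_ && _); apply/idP/idP; lra. Qed.

Lemma abs_continuous_reflect (g : R -> R) : abs_continuous a b g ->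
  abs_continuous a b (fun t => g (a + b - t)).
Proof.
move=> acg e e0; have [d d0 H] := acg e e0; exists d => // n u v uv disj len.
have := H n (fun i => a + b - v i) (fun i => a + b - u i).
have -> : \sum_i (a + b - u i - (a + b - v i)) = \sum_i (v i - u i).
  by apply: eq_bigr => i _; ring.
have -> : \sum_i `|g (a + b - u i) - g (a + b - v i)| =
    \sum_i `|g (a + b - v i) - g (a + b - u i)|.
  by apply: eq_bigr => i _; rewrite distrC.
apply => //.
- by move=> i; have := uv i; lra.
- by move=> i j ij; have [|] := disj i j ij; [right|left]; lra.
Qed.

Definition cut (x : R -> R) (s : R) : R := if s \in `[a, b] then x s else 0.

Lemma cutE x s : s \in `[a, b] -> cut x s = x s.
Proof. by rewrite /cut => ->. Qed.

Lemma cut_off x : off_itv a b (cut x).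
Proof. by move=> s /negbTE sab; rewrite /cut sab. Qed.

Lemma cut_reflect x : cut (fun s => x (a + b - s)) = fun s => cut x (a + b - s).
Proof. by apply/funext => s; rewrite /cut in_itv_reflect. Qed.

Lemma integrable_cut x : mu.-integrable `[a, b] (EFin \o x) <->
  mu.-integrable setT (EFin \o cut x).
Proof.
split; first exact: integrable_if_itv.
move=> xi; have : mu.-integrable `[a, b] (EFin \o cut x) by exact: integrableS xi.
apply: eq_integrable; first exact: measurable_itv.
by move=> s /set_mem/= sab; rewrite /cut sab.
Qed.

Lemma Rintegral_if_itv (x : R -> R) (i : interval R) :
  \int[mu]_(s in [set` i]) x s = \int[mu]_s (if s \in i then x s else 0).
Proof. by rewrite Rintegral_mkcond restrict_if. Qed.

Lemma L1_reflect x : L1 a b x -> L1 a b (fun s => x (a + b - s)).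
Proof.
move=> /integrable_cut xi; apply/integrable_cut; rewrite cut_reflect.
exact: integrable_reflect.
Qed.

End reflection.

Section fractional_integrals.
Context {R : realType}.
Notation mu := (@lebesgue_measure R).
Local Open Scope complex_scope.
Variables (a b nu : R) (beta : R[i]) (B : R[i] -> R[i]).
Hypothesis ab : a < b.
Hypothesis nu1 : nu != 1.

Local Notation K := (kernel_trunc (b - a) beta nu B).
Local Notation K1 := (@complex.Re R \o K).
Local Notation K2 := (@complex.Im R \o K).

(** By convention 0 to a nonzero power is 0. Hence for nu different from 1 the kernel and its
    cut-off agree also at s = t, and the integrands in [fint_leftE] coincide everywhere. *)
Lemma kernelD0 : kernelD B nu beta 0 = 0.
Proof. by rewrite /kernelD powR0 ?mul0r// subr_eq0. Qed.

Lemma fint_leftE x t : t \in `[a, b] ->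
  fint_left B nu beta a x t = conv K1 (cut a b x) t +i* conv K2 (cut a b x) t.
Proof.
rewrite in_itv/= => /andP[at_ tb].
have E s : (if s \in `[a, t] then kernelD B nu beta (t - s) * (x s)%:C else 0) =
    K (t - s) * (cut a b x s)%:C.
  rewrite /cut /kernel_trunc !in_itv/= subr_gt0; have [as_|sa] := leP a s; last by rewrite mulr0.
  have [st|ts|->] /= := ltgtP s t; last by rewrite subrr kernelD0 !mul0r.
    by rewrite lerB// (le_trans (ltW st) tb).
  by rewrite mul0r.
rewrite /fint_left /cintegral !Rintegral_if_itv.
congr (_ +i* _); apply: eq_Rintegral => s _; have := E s.
- by move=> /(congr1 (@complex.Re R)); rewrite ReM/= mulr0 subr0 => <-; case: ifP.
- by move=> /(congr1 (@complex.Im R)); rewrite ImM/= mulr0 add0r => <-; case: ifP.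
Qed.

Lemma fint_rightE x t : measurable_fun setT (cut a b x) -> cmeasurable K -> t \in `[a, b] ->
  fint_right B nu beta b x t = fint_left B nu beta a (fun s => x (a + b - s)) (a + b - t).
Proof.
move=> mx [mK1 mK2] tab; rewrite fint_leftE ?in_itv_reflect// cut_reflect.
move: tab; rewrite in_itv/= => /andP[at_ tb].
have E s : (if s \in `[t, b] then kernelD B nu beta (s - t) * (x s)%:C else 0) =
    K (s - t) * (cut a b x s)%:C.
  rewrite /cut /kernel_trunc !in_itv/= subr_gt0; have [sb|bs] := leP s b; last by rewrite !andbF mulr0.
  have [ts|st|->] /= := ltgtP t s; last by rewrite subrr kernelD0 !mul0r.
    by rewrite lerB// (le_trans at_ (ltW ts)).
  by rewrite mul0r.
have mt (k : R -> R) : measurable_fun setT k -> measurable_fun setT (fun s : R => k (s - t) * cut a b x s).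
  move=> mk; apply: measurable_funM => //; apply: measurableT_comp => //.
  by apply: measurable_funD.
have R1 (k : R -> R) : measurable_fun setT k ->
    \int[mu]_s (k (s - t) * cut a b x s) = conv k (fun s => cut a b x (a + b - s)) (a + b - t).
  move=> mk; rewrite (Rintegral_reflect (a + b) (mt _ mk)).
  by apply: eq_Rintegral => s _; congr (k _ * _); ring.
rewrite /fint_right /cintegral !Rintegral_if_itv -(R1 _ mK1) -(R1 _ mK2).
congr (_ +i* _); apply: eq_Rintegral => s _; have := E s.
- by move=> /(congr1 (@complex.Re R)); rewrite ReM/= mulr0 subr0 => <-; case: ifP.
- by move=> /(congr1 (@complex.Im R)); rewrite ImM/= mulr0 add0r => <-; case: ifP.
Qed.

Lemma fint_left_a x : fint_left B nu beta a x a = 0.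
Proof.
rewrite fint_leftE; last by rewrite in_itv/= lexx ltW.
have K0 r : r <= 0 -> K r = 0 by move=> r0; rewrite /kernel_trunc ltNge r0.
have c0 s : s < a -> cut a b x s = 0 by move=> sa; rewrite /cut in_itv/= leNgt sa.
rewrite (@conv_left0 R _ _ a a _ c0)//; last by move=> r r0; rewrite /= K0.
by rewrite (@conv_left0 R _ _ a a _ c0)// => r r0; rewrite /= K0.
Qed.

End fractional_integrals.

Section operators.
Context {R : realType}.
Notation mu := (@lebesgue_measure R).
Local Open Scope complex_scope.
Import ComplexField.Normc.
Local Notation Re := complex.Re.
Local Notation Im := complex.Im.
Variables (alpha rho a b : R) (beta : R[i]) (A Abar : R[i] -> R[i]) (c cbar : nat -> R[i]).
Hypothesis ab : a < b.
Hypothesis halpha : 0 < alpha < 1.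
Hypothesis hbeta : 0 <= Re beta.
Hypothesis hrho : (b - a) `^ Re beta < rho.
Hypothesis hA : analytic_on_disc rho c A.
Hypothesis hAbar : analytic_on_disc rho cbar Abar.
Hypothesis hinv : gamma_inverse alpha beta c cbar.

Let ba0 : 0 < b - a. Proof. by rewrite subr_gt0. Qed.

Local Notation K := (kernel_trunc (b - a) beta (1 - alpha) Abar).
Local Notation P := (kernel_trunc (b - a) beta alpha A).
Local Notation H := (heaviside a b).
Local Notation lint := (fint_left Abar (1 - alpha) beta a).
Local Notation rint := (fint_right Abar (1 - alpha) beta b).

Let dominated_ReIm nu d D : analytic_on_disc rho d D ->
  [/\ dominated_by a b (nu - 1) (@complex.Re R \o kernel_trunc (b - a) beta nu D),
      dominated_by a b (nu - 1) (@complex.Im R \o kernel_trunc (b - a) beta nu D) &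
      dominated_by a b (nu - 1) (fun s => normc (kernel_trunc (b - a) beta nu D s))].
Proof.
move=> hD; have [m1 m2] := cmeasurable_kernel_trunc hbeta ba0 hrho nu hD.
have [M M0 hM] := kernel_trunc_bound hbeta ba0 hrho nu hD.
split; split => //.
- by exists M => // r; exact: le_trans (normc_Re _) (hM r).
- by exists M => // r; exact: le_trans (normc_Im _) (hM r).
- exact: (measurable_normc (conj m1 m2)).
- by exists M => // r; rewrite ger0_norm ?normc_ge0// hM.
Qed.

Let cmK : cmeasurable K.
Proof. exact: cmeasurable_kernel_trunc hAbar. Qed.

Let domK : [/\ dominated_by a b (- alpha) (@complex.Re R \o K),
  dominated_by a b (- alpha) (@complex.Im R \o K) &
  dominated_by a b (- alpha) (fun s => normc (K s))].
Proof. by have := dominated_ReIm (1 - alpha) hAbar; rewrite (_ : 1 - alpha - 1 = - alpha)//; ring. Qed.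

Let sonineR r : 0 < r -> r <= b - a ->
  conv (@complex.Re R \o P) (@complex.Re R \o K) r -
  conv (@complex.Im R \o P) (@complex.Im R \o K) r = 1.
Proof.
move=> r0 rb; have cmP : cmeasurable P by exact: cmeasurable_kernel_trunc hA.
have [_ _ dP] := dominated_ReIm alpha hA; have [_ _ dK] := domK.
have [C C0 hC] := econv_dominated halpha dP dK.
have [<- _] := cconv_ReIm cmP cmK (le_lt_trans (hC r) (ltry _)).
by rewrite (sonine halpha hbeta ba0 hrho hA hAbar hinv r0 rb).
Qed.

Let alpha_neq : 1 - alpha != 1.
Proof. by rewrite subr_eq addrC -subr_eq subrr eq_sym gt_eqF//; case/andP: halpha. Qed.

Let cut_left x s : s < a -> cut a b x s = 0.
Proof. by move=> sa; rewrite cut_off// in_itv/= leNgt sa. Qed.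

Let density (F k : R -> R) x : L1 a b x -> abs_continuous a b F -> F a = 0 ->
  (forall t, t \in `[a, b] -> F t = conv k (cut a b x) t) ->
  exists G, [/\ mu.-integrable setT (EFin \o G), off_itv a b G,
    forall t, t \in `[a, b] -> conv k (cut a b x) t = conv H G t &
    forall t, t \in `[a, b] -> F t = F a + \int[mu]_(s in `]a, t]) G s].
Proof.
move=> xi acF Fa Fk; have [G [Gi FG]] := abs_continuous_density ab acF.
have cGi : mu.-integrable setT (EFin \o cut a b G).
  by apply/integrable_cut; exact: integrableS Gi.
have cG t : t \in `[a, b] -> \int[mu]_(s in `]a, t]) cut a b G s = \int[mu]_(s in `]a, t]) G s.
  rewrite in_itv/= => /andP[_ tb]; apply: eq_Rintegral => s /set_mem/=.
  by rewrite in_itv/= => /andP[as_ st]; rewrite cutE// in_itv/= ltW//= (le_trans st).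
exists (cut a b G); split => //; first exact: cut_off.
- move=> t tab; rewrite -Fk// FG// Fa add0r conv_heaviside//; first by rewrite cG.
  by move=> s; exact: cut_left.
- by move=> t tab; rewrite cG// FG.
Qed.

(** Integration by parts in its left-sided form, with x and G reflected. The conclusions concern
    real parts, but the imaginary part of [lint x] supplies the second density needed by
    [abel_bound]. *)
Lemma left_pairing x : L1 a b x -> cabs_continuous a b (lint x) ->
  exists G, [/\ mu.-integrable setT (EFin \o G), off_itv a b G,
    forall t, t \in `[a, b] -> Re (lint x t) = \int[mu]_(s in `]a, t]) G s,
    {ae mu, forall t, t \in `]a, b[ -> is_derive t 1 (fun s => Re (lint x s)) (G t)} &
    forall y, abs_continuous a b y -> exists D,
      [/\ {ae mu, forall t, t \in `]a, b[ ->
            is_derive t 1 (fun s => Re (lint (fun r => y r - y a) s)) (D t)},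
          mu.-integrable setT (fun s => (cut a b x (a + b - s) * D s)%:E),
          mu.-integrable setT (fun s => (G (a + b - s) * cut a b (fun r => y r - y a) s)%:E) &
          \int[mu]_s (cut a b x (a + b - s) * D s) =
          \int[mu]_s (G (a + b - s) * cut a b (fun r => y r - y a) s)]].
Proof.
move=> xi [acR acI].
have xE t : t \in `[a, b] -> Re (lint x t) = conv (@complex.Re R \o K) (cut a b x) t.
  by move=> tab; rewrite (fint_leftE _ _ alpha_neq _ tab).
have xE' t : t \in `[a, b] -> Im (lint x t) = conv (@complex.Im R \o K) (cut a b x) t.
  by move=> tab; rewrite (fint_leftE _ _ alpha_neq _ tab).
have la z : lint z a = 0 by exact: (fint_left_a beta Abar ab alpha_neq z).
have la1 : Re (lint x a) = 0 by rewrite la.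
have la2 : Im (lint x a) = 0 by rewrite la.
have [G1 [G1i G10 G1H G1F]] := density xi acR la1 xE.
have [G2 [G2i G20 G2H _]] := density xi acI la2 xE'.
have [dP1 dP2 _] := dominated_ReIm alpha hA; have [dK1 dK2 _] := domK.
have /integrable_cut cxi := xi.
have [C C0 hC] := abel_bound halpha ab dP1 dP2 dK1 dK2 sonineR cxi (cut_off _) G1i G2i G10 G20 G1H G2H.
exists G1; split => //.
- by move=> t tab; rewrite G1F// la1 add0r.
- exact: ae_is_derive_integral.
move=> y acy; have [Y0 [Y0i yY0]] := abs_continuous_density ab acy.
pose Y := cut a b Y0.
have Yi : mu.-integrable setT (EFin \o Y) by apply/integrable_cut; exact: integrableS Y0i.
have yY t : t \in `[a, b] -> conv H Y t = y t - y a.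
  move=> tab; rewrite conv_heaviside//; last by move=> s; exact: cut_left.
  rewrite [y t]yY0// addrAC subrr add0r; apply: eq_Rintegral => s /set_mem/=.
  move: tab; rewrite !in_itv/= => /andP[_ tb] /andP[as_ st].
  by rewrite /Y cutE// in_itv/= ltW//= (le_trans st).
have [mK1 _] := dK1.
have Di : mu.-integrable setT (EFin \o conv (@complex.Re R \o K) Y).
  by apply: integrable_conv => //; exact: dominated_by_integrable (gtN1_alphaN halpha) dK1.
have [E I1 I2] := conv_reflect_pairing mK1 (integrable_measurable cxi) G1i Yi (cut_off _) C0 hC G1H.
have cE s : G1 (a + b - s) * conv H Y s = G1 (a + b - s) * cut a b (fun r => y r - y a) s.
  have [sab|sab] := boolP (s \in `[a, b]); first by rewrite yY// cutE.
  by rewrite G10 ?mul0r// in_itv_reflect.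
(* With y - y(a) = H * Y on [a, b], the fractional integral is Q * (H * Y) = H * (Q * Y), so Q * Y
   is its derivative almost everywhere. *)
exists (conv (@complex.Re R \o K) Y); split.
- apply: (ae_is_derive_integral ab Di) => t tab; rewrite la add0r.
  rewrite (fint_leftE _ _ alpha_neq _ tab)/=.
  have -> : conv (@complex.Re R \o K) (cut a b (fun r => y r - y a)) t =
      conv (@complex.Re R \o K) (conv H Y) t.
    apply: eq_Rintegral => s _; have [ts|st] := leP t s.
      by rewrite (dominated_by_left0 dK1) ?subr_le0// !mul0r.
    congr (_ * _); have [sa|as_] := ltP s a.
      rewrite cut_left//; symmetry; apply: (conv_dominated_left0 (heaviside_dominated a b) _ (ltW sa)).
      by move=> r; exact: cut_left.
    have sab : s \in `[a, b] by move: tab; rewrite !in_itv/= as_ => /andP[_ /(le_trans (ltW st))].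
    by rewrite cutE// yY.
  rewrite (conv_heavisideC t (gtN1_alphaN halpha) dK1 Yi).1 conv_heaviside//.
  move=> s sa; apply: (conv_dominated_left0 dK1 _ (ltW sa)) => r; exact: cut_left.
- exact: I1.
- by move: I2; congr (mu.-integrable _ _); apply/funext => s; rewrite cE.
- rewrite -[LHS]/(conv _ _ _) E; apply: eq_Rintegral => s _; exact: cE.
Qed.

End operators.

Section adjoints.
Context {R : realType}.
Notation mu := (@lebesgue_measure R).
Local Open Scope complex_scope.
Local Notation Re := complex.Re.
Local Notation Im := complex.Im.

Lemma abs_continuous_eq (a b : R) (f g : R -> R) : (forall t, t \in `[a, b] -> f t = g t) ->
  abs_continuous a b f -> abs_continuous a b g.
Proof.
move=> fg acf e e0; have [d d0 H] := acf e e0; exists d => // n u v uv disj len.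
rewrite (eq_bigr (fun i => `|f (v i) - f (u i)|)); first exact: H.
by move=> i _; have := uv i => -[au [uvi vb]]; rewrite !fg// in_itv/= ?au ?vb ?andbT/=; lra.
Qed.

Lemma abs_continuous_measurable_cut (a b : R) (y : R -> R) : a < b ->
  abs_continuous a b y -> measurable_fun setT (cut a b y).
Proof.
move=> ab acy; have cy := abs_continuous_clamp (ltW ab) acy.
have -> : cut a b y = cut a b (y \o clamp a b).
  by apply/funext => s; rewrite /cut; case: ifP => //=; rewrite in_itv/= => sab; rewrite clamp_id.
by apply: measurable_if_itv; apply: measurable_funTS; exact: continuous_measurable_fun.
Qed.

Variables (alpha rho a b : R) (beta : R[i]) (A Abar : R[i] -> R[i]) (c cbar : nat -> R[i]).
Hypothesis ab : a < b.
Hypothesis halpha : 0 < alpha < 1.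
Hypothesis hbeta : 0 <= Re beta.
Hypothesis hrho : (b - a) `^ Re beta < rho.
Hypothesis hA : analytic_on_disc rho c A.
Hypothesis hAbar : analytic_on_disc rho cbar Abar.
Hypothesis hinv : gamma_inverse alpha beta c cbar.

Local Notation lint := (fint_left Abar (1 - alpha) beta a).
Local Notation rint := (fint_right Abar (1 - alpha) beta b).

Let reflect_fint x t : measurable_fun setT (cut a b x) -> t \in `[a, b] ->
  rint x t = lint (fun s => x (a + b - s)) (a + b - t).
Proof.
have ba0 : 0 < b - a by rewrite subr_gt0.
have alpha_neq : 1 - alpha != 1.
  by rewrite subr_eq addrC -subr_eq subrr eq_sym gt_eqF//; case/andP: halpha.
by move=> mx; apply: fint_rightE => //; exact: cmeasurable_kernel_trunc hAbar.
Qed.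

(** The minus sign of the right-sided derivative cancels the one produced by the reflection. *)
Let derive_rint x z G : measurable_fun setT (cut a b x) ->
  (forall s, z s = x (a + b - s)) ->
  {ae mu, forall t, t \in `]a, b[ -> is_derive t 1 (fun s => Re (lint z s)) (G t)} ->
  {ae mu, forall t, t \in `]a, b[ -> Re (- cderive (rint x) t) = G (a + b - t)}.
Proof.
move=> mx zx; have -> : z = fun s => x (a + b - s) by apply/funext.
move=> /(ae_reflect (a + b)); apply: ae_mono => t; rewrite in_itvoo_reflect => H tab.
have {}H := is_derive_reflect (H tab).
have D : is_derive t 1 (fun s => Re (rint x s)) (- G (a + b - t)).
  apply: near_eq_is_derive H; move: tab => /near_in_itvoo; apply: filterS => s sab.
  by rewrite reflect_fint//; exact: subset_itv_oo_cc.
by rewrite /cderive/= derive1E (@derive_val _ _ _ _ _ _ _ D) opprK.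
Qed.

Let derive_lint x G :
  {ae mu, forall t, t \in `]a, b[ -> is_derive t 1 (fun s => Re (lint x s)) (G t)} ->
  {ae mu, forall t, t \in `]a, b[ -> Re (cderive (lint x) t) = G t}.
Proof.
by apply: ae_mono => t H /H D; rewrite /cderive/= derive1E (@derive_val _ _ _ _ _ _ _ D).
Qed.

(** [left_pairing] for the reflected multiplier: its own reflection then restores lam. *)
Lemma RL_right_C_left lam : L1 a b lam -> cabs_continuous a b (rint lam) ->
  exists G, {ae mu, forall t, t \in `]a, b[ -> Re (RL_right Abar alpha beta b lam t) = G t} /\
    forall y, abs_continuous a b y -> exists D,
      [/\ {ae mu, forall t, t \in `]a, b[ -> Re (C_left Abar alpha beta a y t) = D t},
          mu.-integrable setT (fun s => (cut a b lam s * D s)%:E),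
          mu.-integrable setT (fun s => (G s * cut a b (fun r => y r - y a) s)%:E) &
          \int[mu]_s (cut a b lam s * D s) =
          \int[mu]_s (G s * cut a b (fun r => y r - y a) s)].
Proof.
move=> li [acR acI]; pose z s := lam (a + b - s).
have ml : measurable_fun setT (cut a b lam).
  by apply: integrable_measurable; apply/integrable_cut.
have zE t : t \in `[a, b] -> rint lam (a + b - t) = lint z t.
  move=> tab; have rab : a + b - t \in `[a, b] by rewrite in_itv_reflect.
  by rewrite (reflect_fint ml rab) (subKr (a + b) t).
have acz : cabs_continuous a b (lint z).
  split.
    apply: abs_continuous_eq (abs_continuous_reflect acR) => t tab; by rewrite zE.
  apply: abs_continuous_eq (abs_continuous_reflect acI) => t tab; by rewrite zE.
have [G [Gi G0 _ GD GP]] := left_pairing ab halpha hbeta hrho hA hAbar hinv (L1_reflect li) acz.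
exists (fun t => G (a + b - t)); split; first exact: derive_rint GD.
move=> y /GP[D [HD I1 I2 E]]; exists D.
have cl s : cut a b z (a + b - s) = cut a b lam s by rewrite /z cut_reflect subKr.
split.
- exact: derive_lint.
- by move: I1; congr (mu.-integrable _ _); apply/funext => s; rewrite cl.
- exact: I2.
- by rewrite -E; apply: eq_Rintegral => s _; rewrite cl.
Qed.

(** [left_pairing] for lam itself, tested on the reflected y. The Caputo derivative subtracts y(b),
    where the values are not prescribed, so the integral of G is recorded for the boundary term. *)
Lemma RL_left_C_right lam : L1 a b lam -> cabs_continuous a b (lint lam) ->
  exists G, [/\ mu.-integrable setT (EFin \o G), off_itv a b G,
    {ae mu, forall t, t \in `]a, b[ -> Re (RL_left Abar alpha beta a lam t) = G t},
    \int[mu]_s G s = Re (lint lam b) &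
    forall y, abs_continuous a b y -> exists D,
      [/\ {ae mu, forall t, t \in `]a, b[ -> Re (C_right Abar alpha beta b y t) = D t},
          mu.-integrable setT (fun s => (cut a b lam s * D s)%:E),
          mu.-integrable setT (fun s => (G s * cut a b (fun r => y r - y b) s)%:E) &
          \int[mu]_s (cut a b lam s * D s) =
          \int[mu]_s (G s * cut a b (fun r => y r - y b) s)]].
Proof.
move=> li acl.
have [G [Gi G0 GF GD GP]] := left_pairing ab halpha hbeta hrho hA hAbar hinv li acl.
exists G; split => //.
- exact: derive_lint.
- rewrite GF; last by rewrite in_itv/= lexx andbT ltW.
  have fiS (i : interval R) : mu.-integrable [set` i] (EFin \o G) by exact: integrableS Gi.
  rewrite (Rintegral_itv_obnd_cbnd (fiS _)) Rintegral_if_itv; apply: eq_Rintegral => s _.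
  by case: ifPn => // /G0.
move=> y acy; have [D [HD I1 I2 E]] := GP _ (abs_continuous_reflect acy).
have ra : a + b - a = b by ring.
pose u s := y s - y b.
have uE : (fun r => y (a + b - r) - y (a + b - a)) = fun r => u (a + b - r).
  by apply/funext => r; rewrite ra.
rewrite uE in HD I2 E.
have cl s : cut a b (fun r => u (a + b - r)) (a + b - s) = cut a b u s by rewrite cut_reflect subKr.
have mu_ : measurable_fun setT (cut a b u).
  have -> : cut a b u = fun s => cut a b y s - cut a b (fun=> y b) s.
    by apply/funext => s; rewrite /cut /u; case: ifP => //; rewrite subr0.
  apply: measurable_funB; first exact: abs_continuous_measurable_cut.
  by apply: measurable_if_itv; exact: measurable_cst.
exists (fun t => D (a + b - t)); split.
- exact: derive_rint mu_ _ HD.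
- have := integrable_reflect (a + b) I1; congr (mu.-integrable _ _).
  by apply/funext => s /=; rewrite subKr.
- have := integrable_reflect (a + b) I2; congr (mu.-integrable _ _).
  by apply/funext => s /=; rewrite subKr cl.
have m1 := integrable_measurable I1; have m2 := integrable_measurable I2.
have := E; rewrite (Rintegral_reflect (a + b) m1) (Rintegral_reflect (a + b) m2).
move=> E'; transitivity (\int[mu]_x (cut a b lam (a + b - (a + b - x)) * D (a + b - x))).
  by apply: eq_Rintegral => s _; rewrite (subKr (a + b) s).
by rewrite E'; apply: eq_Rintegral => s _; rewrite (subKr (a + b) s) cl.
Qed.

End adjoints.

Section adjoint_identity.
Context {R : realType}.
Notation mu := (@lebesgue_measure R).
Local Open Scope complex_scope.
Local Notation Re := complex.Re.
Variables (alpha rho a b g : R) (beta : R[i]) (A Abar : R[i] -> R[i]) (c cbar : nat -> R[i]).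
Hypothesis ab : a < b.
Hypothesis halpha : 0 < alpha < 1.
Hypothesis hbeta : 0 <= Re beta.
Hypothesis hrho : (b - a) `^ Re beta < rho.
Hypothesis hA : analytic_on_disc rho c A.
Hypothesis hAbar : analytic_on_disc rho cbar Abar.
Hypothesis hinv : gamma_inverse alpha beta c cbar.

Lemma Re_combination (k : R) (z w : R[i]) :
  Re (k%:C * z + (1 - k)%:C * w) = k * Re z + (1 - k) * Re w.
Proof. by rewrite ReD !ReM/= !mul0r !subr0. Qed.

Lemma Re_RL_combined (k : R) x t : Re (RL_combined Abar alpha beta k a b x t) =
  k * Re (RL_left Abar alpha beta a x t) + (1 - k) * Re (RL_right Abar alpha beta b x t).
Proof. exact: Re_combination. Qed.

Lemma Re_C_combined (k : R) x t : Re (C_combined Abar alpha beta k a b x t) =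
  k * Re (C_left Abar alpha beta a x t) + (1 - k) * Re (C_right Abar alpha beta b x t).
Proof. exact: Re_combination. Qed.

Lemma fint_right_b (nu : R) x : fint_right Abar nu beta b x b = 0.
Proof. by rewrite /fint_right /cintegral !set_itv1 !Rintegral_set1. Qed.

Lemma integrableZR (k : R) (u : R -> R) : mu.-integrable setT (EFin \o u) ->
  mu.-integrable setT (EFin \o (fun x => k * u x)).
Proof. by move=> /(integrableZl measurableT k). Qed.

(** The reals q, k, l stand for the values of complex operators, which are known to be real only
    where the adjoint and state equations hold; psi itself is built from the real densities. *)
Lemma adjoint_identity lam x y : Lab Abar alpha beta a b lam ->
  (1 - g)%:C * fint_left Abar (1 - alpha) beta a lam b +
    g%:C * fint_right Abar (1 - alpha) beta b lam b = 0 ->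
  abs_continuous a b x -> abs_continuous a b y -> x a = y a ->
  exists psi, [/\ mu.-integrable setT (EFin \o psi), \int[mu]_s psi s = 0,
    off_itv a b psi &
    {ae mu, forall t, t \in `[a, b] -> forall q k l : R,
      RL_combined Abar alpha beta (1 - g) a b lam t = q%:C ->
      C_combined Abar alpha beta g a b y t = k%:C ->
      C_combined Abar alpha beta g a b x t = l%:C ->
      psi t = q * (y t - x t) - lam t * (k - l)}].
Proof.
move=> [li _ _ acl acr] tr acx acy xya.
have [G [HG HC]] := RL_right_C_left ab halpha hbeta hrho hA hAbar hinv li acr.
have [F [Fi F0 HF intF HC']] := RL_left_C_right ab halpha hbeta hrho hA hAbar hinv li acl.
have [Dx [HDx Ix1 Ix2 Ex]] := HC _ acx; have [Dy [HDy Iy1 Iy2 Ey]] := HC _ acy.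
have [Dx' [HDx' Ix1' Ix2' Ex']] := HC' _ acx; have [Dy' [HDy' Iy1' Iy2' Ey']] := HC' _ acy.
have I1 := integrableBR (integrableBR Iy2 Ix2) (integrableBR Iy1 Ix1).
have I2 := integrableBR (integrableBR Iy2' Ix2') (integrableBR Iy1' Ix1').
have I3 := integrableDR I2 (integrableZR (y b - x b) Fi).
have I4 := integrableDR (integrableZR g I1) (integrableZR (1 - g) I3).
(* The g-part pairs to 0 and gives G (y - x), as x(a) = y(a). In the other part y - y(b) and x -
   x(b) leave out (y(b) - x(b)) F, which is added back. Its integral is a multiple of the
   transversality condition, since the right-sided integral vanishes at b. *)
pose psi s := g * (G s * cut a b (fun r => y r - y a) s - G s * cut a b (fun r => x r - x a) s -
    (cut a b lam s * Dy s - cut a b lam s * Dx s)) +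
  (1 - g) * (F s * cut a b (fun r => y r - y b) s - F s * cut a b (fun r => x r - x b) s -
    (cut a b lam s * Dy' s - cut a b lam s * Dx' s) + (y b - x b) * F s).
exists psi; split; first exact: I4.
- rewrite /psi; have B (u v : R -> R) : mu.-integrable setT (EFin \o u) -> mu.-integrable setT (EFin \o v) ->
      \int[mu]_s (u s - v s) = \int[mu]_s u s - \int[mu]_s v s by exact: RintegralB.
  have D (u v : R -> R) : mu.-integrable setT (EFin \o u) -> mu.-integrable setT (EFin \o v) ->
      \int[mu]_s (u s + v s) = \int[mu]_s u s + \int[mu]_s v s by exact: RintegralD.
  have Z (u : R -> R) k : mu.-integrable setT (EFin \o u) ->
      \int[mu]_s (k * u s) = k * \int[mu]_s u s by exact: RintegralZl.
  rewrite (D _ _ (integrableZR g I1) (integrableZR (1 - g) I3)) (Z _ g I1) (Z _ (1 - g) I3).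
  rewrite (D _ _ I2 (integrableZR _ Fi)) (Z _ _ Fi) intF.
  rewrite (B _ _ (integrableBR Iy2 Ix2) (integrableBR Iy1 Ix1)) (B _ _ Iy2 Ix2) (B _ _ Iy1 Ix1).
  rewrite (B _ _ (integrableBR Iy2' Ix2') (integrableBR Iy1' Ix1')) (B _ _ Iy2' Ix2') (B _ _ Iy1' Ix1').
  rewrite Ex Ey Ex' Ey' !subrr mulr0 !add0r.
  rewrite mulrCA; apply/eqP; rewrite mulf_eq0; apply/orP; right; apply/eqP.
  have := congr1 (@complex.Re R) tr; rewrite fint_right_b mulr0 addr0 ReM/= mul0r subr0.
  by [].
- by move=> s s0; rewrite /psi !(cut_off _ s0) (F0 _ s0); ring.
apply: ae_mono (ae_conj (ae_conj (ae_conj HG HF) (ae_conj HDx HDy))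
  (ae_conj (ae_conj HDx' HDy') (ae_conj (ae_neq a) (ae_neq b)))) => t.
move=> [[[hG hF] [hDx hDy]] [[hDx' hDy'] [ta tb]]] tab q k l hq hk hl.
have tab' : t \in `]a, b[ by move: tab; rewrite !in_itv/= !lt_neqAle tb eq_sym ta.
have EL : Re (RL_combined Abar alpha beta (1 - g) a b lam t) = (1 - g) * F t + g * G t.
  by rewrite Re_RL_combined (hF tab') (hG tab') subKr.
have Ey0 : Re (C_combined Abar alpha beta g a b y t) = g * Dy t + (1 - g) * Dy' t.
  by rewrite Re_C_combined (hDy tab') (hDy' tab').
have Ex0 : Re (C_combined Abar alpha beta g a b x t) = g * Dx t + (1 - g) * Dx' t.
  by rewrite Re_C_combined (hDx tab') (hDx' tab').
have -> : q = (1 - g) * F t + g * G t by exact: etrans (esym (congr1 (@complex.Re R) hq)) EL.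
have -> : k = g * Dy t + (1 - g) * Dy' t by exact: etrans (esym (congr1 (@complex.Re R) hk)) Ey0.
have -> : l = g * Dx t + (1 - g) * Dx' t by exact: etrans (esym (congr1 (@complex.Re R) hl)) Ex0.
by rewrite /psi /cut tab xya; ring.
Qed.

End adjoint_identity.

(** * Concavity and comparison of the objectives *)

Section concavity.
Context {R : realType}.
Implicit Types h hx : R -> R -> R.

Lemma continuous_pair (T U V : topologicalType) (f : T -> U) (k : T -> V) :
  continuous f -> continuous k -> continuous (fun p => (f p, k p)).
Proof. by move=> cf ck p; exact: (cvg_pair (cf p) (ck p)). Qed.

Lemma continuous_strip_comp (T : topologicalType) (a b : R) (F : R -> R -> R -> R)
    (j : T -> R * R * R) : continuous_strip a b F -> continuous j ->
  (forall p, (j p).1.1 \in `[a, b]) -> continuous (fun p => F (j p).1.1 (j p).1.2 (j p).2).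
Proof.
move=> cF cj jab p; apply/cvgrPdist_lt => e e0.
have := cF (j p); rewrite /continuous_at /prop_for/=.
have jp : [set q : R * R * R | q.1.1 \in `[a, b]] (j p) by exact: jab.
move=> /cvgrPdist_lt/(_ e e0) H.
have {}H : within [set q : R * R * R | q.1.1 \in `[a, b]] (nbhs (j p))
    (fun q => `|F (j p).1.1 (j p).1.2 (j p).2 - F q.1.1 q.1.2 q.2| < e).
  by rewrite (nbhs_subspace_in jp).
exact: (filterS (fun q Hq => Hq (jab q)) (cj p _ H)).
Qed.

Lemma concave_maximum_tangent h hx (x0 u0 x u : R) : concave2 h ->
  (forall y w : R, is_derive y 1 (fun z : R => h z w) (hx y w)) ->
  continuous (fun p : R * R => hx p.1 p.2) ->
  (forall w, h x0 w <= h x0 u0) -> h x u - h x0 u0 <= hx x0 u0 * (x - x0).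
Proof.
move=> hc hd chx hmax.
apply/ler_addgt0Pr => e e0.
pose j (p : R * R) := (x0 + p.1 * (x - x0), u0 + p.2 * (u - u0)).
pose q (p : R * R) := hx (j p).1 (j p).2 * (x - x0).
have cj : continuous j.
  apply: continuous_pair => p; apply: cvgD; try exact: cvg_cst; apply: cvgM; try exact: cvg_cst.
    exact: cvg_fst.
  exact: cvg_snd.
have cq : continuous q.
  move=> p; apply: cvgM; last exact: cvg_cst.
  exact: (continuous_comp (cj p) (chx (j p))).
have /cvgrPdist_lt/(_ e e0)/nbhs_ballP[d /= d0 Hd] := cq (0, 0).
pose s := Num.min 1 (d / 2).
have s0 : 0 < s by rewrite lt_min ltr01/= divr_gt0.
have s1 : s <= 1 by rewrite ge_min lexx.
have sd : s < d.
  by rewrite gt_min; apply/orP; right; rewrite ltr_pdivrMr// ltr_pMr// ltr1n.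
pose v := u0 + s * (u - u0).
have dphi (tau : R) : is_derive tau 1 (fun r : R => h (x0 + r * (x - x0)) v)
    (hx (x0 + tau * (x - x0)) v * (x - x0)).
  apply: (is_derive1_comp (hd _ _)).
  rewrite -[X in is_derive _ _ _ X]add0r; apply: is_deriveD.
  have D := @is_deriveM R R id (cst (x - x0)) tau 1 1 0 (is_derive_id _ _) (is_derive_cst _ _ _).
  by apply: (is_derive_eq D); rewrite /= scaler0 add0r /GRing.scale/= mulr1.
have [|tau] := MVT s0 (fun r _ => dphi r).
  by apply: derivable_within_continuous => r _; apply: ex_derive.
rewrite in_itv/= => /andP[tau0 taus] E.
have bd : ball ((0, 0) : R * R) d (tau, s).
  split => /=; rewrite /ball/= sub0r normrN gtr0_norm//; exact: lt_trans sd.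
have := Hd _ bd; rewrite /q /j/= !mul0r !addr0 -/v ltr_distlC.
move=> /andP[_ qe].
have := hc x x0 u u0 s; rewrite (ltW s0) s1 => /(_ isT).
have -> : s * x + (1 - s) * x0 = x0 + s * (x - x0) by ring.
have -> : s * u + (1 - s) * u0 = v by rewrite /v; ring.
have := hmax v; move: E; rewrite mul0r addr0 subr0 => E m cc.
have : s * (h x u - h x0 u0) <= s * (hx x0 u0 * (x - x0) + e).
  apply: (@le_trans _ _ (h (x0 + s * (x - x0)) v - h x0 v)); first by lra.
  by rewrite E mulrC ler_wpM2l ?(ltW s0)// ltW.
by rewrite ler_pM2l.
Qed.

(** Here the sign of the multiplier enters: F + l G is concave because l >= 0. *)
Lemma concave_extremal_le (F G Fx Gx : R -> R -> R) (l x0 u0 x u : R) :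
  concave2 F -> concave2 G -> 0 <= l ->
  (forall y w : R, is_derive y 1 (fun z : R => F z w) (Fx y w)) ->
  (forall y w : R, is_derive y 1 (fun z : R => G z w) (Gx y w)) ->
  continuous (fun p : R * R => Fx p.1 p.2) -> continuous (fun p : R * R => Gx p.1 p.2) ->
  (forall w, F x0 w + l * G x0 w <= F x0 u0 + l * G x0 u0) ->
  F x u <= F x0 u0 +
    (derive1 (fun y => F y u0 + l * G y u0) x0 * (x - x0) - l * (G x u - G x0 u0)).
Proof.
move=> cF cG l0 dF dG cFx cGx hmax.
pose h y w := F y w + l * G y w; pose hx y w := Fx y w + l * Gx y w.
have dh (y w : R) : is_derive y 1 (fun z : R => h z w) (hx y w).
  by have := dF y w; have := dG y w => dGy dFy; apply: is_deriveD; exact: is_deriveZ.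
have ch : concave2 h.
  move=> z1 z2 w1 w2 s s01; have := cF z1 z2 w1 w2 s s01.
  by have := ler_wpM2l l0 (cG z1 z2 w1 w2 s s01); rewrite /h; lra.
have chx : continuous (fun p : R * R => hx p.1 p.2).
  move=> p; apply: cvgD; first exact: cFx.
  by apply: cvgM; [exact: cvg_cst|exact: cGx].
have := concave_maximum_tangent x u ch dh chx hmax.
rewrite derive1E (@derive_val _ _ _ _ _ _ _ (dh x0 u0)) /h; lra.
Qed.

End concavity.

Section nemytskii.
Import HBSimple.
Context {R : realType}.
Notation mu := (@lebesgue_measure R).

Lemma measurable_fun_select (s : R -> R) (F : R -> R -> R) : finite_set (range s) ->
  measurable_fun setT s -> (forall w, measurable_fun setT (F w)) ->
  measurable_fun setT (fun t : R => F (s t) t).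
Proof.
move=> fs ms mF _ Y mY; rewrite setTI.
have -> : (fun t => F (s t) t) @^-1` Y =
    \bigcup_(w in range s) (s @^-1` [set w] `&` F w @^-1` Y).
  apply/seteqP; split => [t Yt|t [w _ [/= <- //]]].
  by exists (s t) => //; exists t.
apply: fin_bigcup_measurable => // w _; apply: measurableI.
  by have := ms measurableT [set w] (measurable_set1 w); rewrite setTI.
by have := mF w measurableT Y mY; rewrite setTI.
Qed.

Lemma abs_continuous_id (a b : R) : abs_continuous a b id.
Proof.
move=> e e0; exists e => // n u v uv _; apply: le_lt_trans; apply: ler_sum => i _.
by have [_ [h _]] := uv i; rewrite ger0_norm// subr_ge0.
Qed.

(** Clamping t makes F continuous in t for a fixed control value. A control with finitely many
    values is then handled value by value, and continuity in the control passes to the limit of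
    simple functions. *)
Lemma measurable_nemytskii (a b : R) (F : R -> R -> R -> R) (x u : R -> R) : a < b ->
  continuous_strip a b F -> abs_continuous a b x -> measurable_fun `[a, b] u ->
  measurable_fun `[a, b] (fun t => F t (x t) (u t)).
Proof.
move=> ab cF acx mu_.
pose X t := x (clamp a b t); have cX : continuous X by exact: abs_continuous_clamp (ltW ab) acx.
have clamp_in t : clamp a b t \in `[a, b] by rewrite in_itv/= clamp_itv// ltW.
have cclamp : continuous (clamp a b).
  exact: abs_continuous_clamp (ltW ab) (@abs_continuous_id a b).
pose w t := cut a b u t.
have mw : measurable_fun setT w by exact: measurable_if_itv.
have [s Hs] := approximation_sfun measurableT (proj2 (measurable_EFinP _ _) mw).
have mc v : measurable_fun setT (fun t => F (clamp a b t) (X t) v).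
  apply: continuous_measurable_fun.
  apply: (@continuous_strip_comp R _ a b F (fun t => (clamp a b t, X t, v))) => //.
  by apply: continuous_pair; [exact: continuous_pair|move=> t; exact: cvg_cst].
have : measurable_fun setT (fun t : R => F (clamp a b t) (X t) (w t)).
  pose S n (t : R) : R := s n t.
  apply: (measurable_fun_cvg (h := fun n (t : R) => F (clamp a b t) (X t) (S n t))).
    move=> n; apply: (measurable_fun_select (F := fun v t => F (clamp a b t) (X t) v)) => //.
  move=> t _; have /fine_cvgP[_ st] := Hs t I.
  have cv : continuous (fun v : R => F (clamp a b t) (X t) v).
    apply: (@continuous_strip_comp R _ a b F (fun v => (clamp a b t, X t, v))) => //.
    - by apply: continuous_pair => v; [exact: cvg_cst|exact: cvg_id].
    - by move=> v; exact: clamp_in.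
  exact: (cvg_comp _ _ st (cv (w t))).
move=> /(measurable_funS measurableT (@subsetT _ `[a, b])).
apply: eq_measurable_fun => t /set_mem/= tab.
by rewrite /X /w cutE// clamp_id//; move: tab; rewrite in_itv/=.
Qed.

End nemytskii.

Section integral_comparison.
Context {R : realType} d (T : measurableType d) (mu : {measure set T -> \bar R}).
Variable (D : set T).
Hypothesis mD : measurable D.
Local Open Scope ereal_scope.

Lemma ae_le_integral_EFin (f k : T -> R) : measurable_fun D f -> measurable_fun D k ->
  {ae mu, forall t, D t -> (f t <= k t)%R} ->
  \int[mu]_(t in D) (f t)%:E <= \int[mu]_(t in D) (k t)%:E.
Proof.
move=> mf mk fk; have mf' : measurable_fun D (EFin \o f) by exact/measurable_EFinP.
have mk' : measurable_fun D (EFin \o k) by exact/measurable_EFinP.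
rewrite integralE [leRHS]integralE; apply: leeB; apply: ae_ge0_le_integral => //.
- exact: measurable_funepos.
- exact: measurable_funepos.
- move: fk; apply: filterS => t h /h fkt.
  by rewrite !funeposE; apply: le_max2 => //; rewrite /= lee_fin.
- exact: measurable_funeneg.
- exact: measurable_funeneg.
- move: fk; apply: filterS => t h /h fkt.
  by rewrite !funenegE; apply: le_max2 => //; rewrite leeN2 /= lee_fin.
Qed.

(** f and k are merely measurable, as objectives may be infinite. If k is integrable, psi is simply
    integrated away; otherwise the integral of k is +oo, or those of f and k are both -oo. *)
Lemma integral_le_perturbed (f k psi : T -> R) : measurable_fun D f -> measurable_fun D k ->
  mu.-integrable D (EFin \o psi) -> \int[mu]_(t in D) (psi t)%:E = 0 ->
  {ae mu, forall t, D t -> (f t <= k t + psi t)%R} ->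
  \int[mu]_(t in D) (f t)%:E <= \int[mu]_(t in D) (k t)%:E.
Proof.
move=> mf mk ipsi psi0 fk; have mf' : measurable_fun D (EFin \o f) by exact/measurable_EFinP.
have mk' : measurable_fun D (EFin \o k) by exact/measurable_EFinP.
have mpsi : measurable_fun D (EFin \o psi) by exact: measurable_int ipsi.
have /integrableP[_ apsi] := ipsi.
(* In [\bar R], [+oo - oo = -oo]: if the negative part of k has infinite integral, then
   so has that of f, and the integral of f is -oo. *)
have [kn|kn] := eqVneq (\int[mu]_(t in D) (EFin \o k)^\- t) +oo.
  have fn : \int[mu]_(t in D) (EFin \o f)^\- t = +oo.
    have : +oo <= \int[mu]_(t in D) (EFin \o f)^\- t + \int[mu]_(t in D) `|(EFin \o psi) t|.
      rewrite -kn -ge0_integralD//; last 2 first.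
      - exact: measurable_funeneg.
      - exact: measurableT_comp.
      apply: ae_ge0_le_integral => //.
      - exact: measurable_funeneg.
      - by move=> t _; rewrite adde_ge0.
      - by apply: emeasurable_funD; [exact: measurable_funeneg|exact: measurableT_comp].
      move: fk; apply: filterS => t h /h fkt; rewrite !funenegE /=.
      rewrite -(EFin_max (- k t)%R 0%R) -(EFin_max (- f t)%R 0%R) -EFinD lee_fin ge_max.
      have m1 : (- f t <= Num.max (- f t) 0)%R by rewrite le_max lexx.
      have m2 : (0 <= Num.max (- f t) 0)%R by rewrite le_max lexx orbT.
      by have := ler_norm (psi t); have := normr_ge0 (psi t); lra.
    rewrite leye_eq; case: (\int[mu]_(t in D) (EFin \o f)^\- t) => //.
    by move=> r; move: apsi; case: (\int[mu]_(t in D) _).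
  by rewrite integralE fn addeNy leNye.
have [kp|kp] := eqVneq (\int[mu]_(t in D) (EFin \o k)^\+ t) +oo.
  rewrite [leRHS]integralE kp; move: kn.
  have : 0 <= \int[mu]_(t in D) (EFin \o k)^\- t by exact: integral_ge0.
  by case: (\int[mu]_(t in D) (EFin \o k)^\- t) => //= r _ _; rewrite leey.
have ik : mu.-integrable D (EFin \o k).
  apply/integrableP; split => //.
  rewrite (_ : (fun _ => _) = (EFin \o k)^\+ \+ (EFin \o k)^\-); last by rewrite -fune_abse.
  rewrite ge0_integralD//; [|exact: measurable_funepos|exact: measurable_funeneg].
  by rewrite lte_add_pinfty// ltey.
apply: le_trans (ae_le_integral_EFin mf (measurable_funD mk _) fk) _.
  exact/measurable_EFinP.
by under eq_integral do rewrite EFinD; rewrite integralD// psi0 adde0.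
Qed.

End integral_comparison.

(* At alpha = 0 or 1 the coefficient of order 0 has a factor Gamma(0) = 0. *)
Lemma gamma_inverse_order (R : realType) (alpha : R) (beta : R[i]) (c cbar : nat -> R[i]) :
  0 <= alpha <= 1 -> gamma_inverse alpha beta c cbar -> 0 < alpha < 1.
Proof.
move=> /andP[a0 a1] /(_ 0%N); rewrite big_ord1 /gamma_coef !mulr0 !add0r eqxx => H.
have n10 : (1 : R[i]) != 0 := oner_neq0 _.
apply/andP; split; rewrite lt_neqAle ?a0 ?a1 andbT; apply/eqP => E; move: H n10.
- by rewrite -E rmorph0 cgamma0 mulr0 mul0r => H /eqP; apply; exact: esym H.
- by rewrite E subrr rmorph0 cgamma0 !mulr0 => H /eqP; apply; exact: esym H.
Qed.

Local Open Scope complex_scope.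

Theorem theorem3 (R : realType) (a b alpha g rho xa : R) (beta : R[i])
    (A Abar : R[i] -> R[i]) (c cbar : nat -> R[i])
    (L f : R -> R -> R -> R) (xt ut lam : R -> R)
    (hab : a < b)
    (halpha : 0 <= alpha <= 1)
    (hbeta : 0 <= complex.Re beta)
    (hrho : (b - a) `^ (complex.Re beta) < rho)
    (hA : analytic_on_disc rho c A)
    (hAbar : analytic_on_disc rho cbar Abar)
    (hinv : gamma_inverse alpha beta c cbar)
    (habs : 1 <= `|alpha%:C + beta|)
    (hg : 0 <= g <= 1)
    (hL : C1_strip a b L)
    (hf : C1_strip a b f)
    (hLconc : forall t, t \in `[a, b] -> concave2 (L t))
    (hfconc : forall t, t \in `[a, b] -> concave2 (f t))
    (hext : pontryagin_extremal Abar alpha beta g a b xa L f xt ut lam)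
    (hlam : {ae @lebesgue_measure R, forall t, t \in `[a, b] -> 0 <= lam t}) :
  solution Abar alpha beta g a b xa L f xt ut.
Proof.
have alpha01 := gamma_inverse_order halpha hinv.
have [admx labl hmax hadj tr] := hext; split => // y v [[acy _] [mv _] fy ya].
have [[acx _] [mut _] fx xta] := admx.
have [psi [ipsi psi0 psioff psiE]] :=
  adjoint_identity hab alpha01 hbeta hrho hA hAbar hinv labl tr acx acy (etrans xta (esym ya)).
have [cL [Lt [Lx [Lu [_ cLx _ dL]]]]] := hL; have [cf [ft [fx' [fu [_ cfx _ df]]]]] := hf.
have slice F t : continuous_strip a b F -> t \in `[a, b] ->
    continuous (fun p : R * R => F t p.1 p.2).
  move=> cF tab; apply: (@continuous_strip_comp R _ a b F (fun p => (t, p.1, p.2))) => //.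
  apply: continuous_pair; last by move=> p; exact: cvg_snd.
  by apply: continuous_pair => p; [exact: cvg_cst|exact: cvg_fst].
apply: (@integral_le_perturbed _ _ _ _ _ _ _ _ psi).
- exact: measurable_itv.
- exact: measurable_nemytskii.
- exact: measurable_nemytskii.
- exact: integrableS ipsi.
- rewrite -integral_if_itv; move: psi0; rewrite /Rintegral.
  have := integrable_fin_num measurableT ipsi.
  rewrite (_ : (fun r => (if r \in `[a, b] then psi r else 0)%:E) = EFin \o psi).
    by move=> fin p0; rewrite -[LHS]fineK// p0.
  by apply/funext => s /=; case: ifPn => // /psioff ->.
apply: ae_mono (ae_conj (ae_conj psiE (ae_conj hmax hadj)) (ae_conj hlam (ae_conj fx fy))) => t.
move=> [[hpsi [hm hd]] [hl [hx hy]]] tab.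
have dLx z w := let: And3 _ D _ := dL t z w tab in D.
have dfx z w := let: And3 _ D _ := df t z w tab in D.
(* The adjoint equation and the two state equations provide q, k and l, so psi(t) becomes the
   correction term of [concave_extremal_le]. *)
rewrite (hpsi tab _ _ _ (hd tab) (hy tab) (hx tab)).
exact: (concave_extremal_le _ _ (hLconc t tab) (hfconc t tab) (hl tab) dLx dfx
  (slice Lx t cLx tab) (slice fx' t cfx tab) (hm tab)).
Qed.
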